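(* Let $\mu$ be a $*$-infinitely divisible probability measure on $\mathbb{R}$. Let $(\mu_n)$ be a sequence of probability measures on $\mathbb{R}$ and $(k_n)$ a sequence of integers tending to $+\infty$ such that the sequence $\mu_n^{*k_n}$ converges weakly to $\mu$. For $d\ge 1$ and $n\ge 1$, let $\mathbb{Q}_d^{\mu_n}$ be the distribution of $U\,\mathrm{diag}(X_{n,1},\ldots,X_{n,d})\,U^*$, where $U$ is a Haar-distributed $d\times d$ unitary random matrix, independent of the i.i.d. random variables $X_{n,1},\ldots,X_{n,d}$ with distribution $\mu_n$. Then for every $d\geq 1$ the sequence $\big((\mathbb{Q}_d^{\mu_n})^{*k_n}\big)_n$ of probability measures on the space of $d\times d$ Hermitian matrices converges weakly, as $n\to\infty$, to a probability distribution $\mathbb{P}_d^\mu$. Moreover, the Fourier transform of $\mathbb{P}_d^\mu$ on the space of $d\times d$ Hermitian matrices endowed with the scalar product $(M,N)\mapsto \mathrm{Tr}\,MN$ is given by: for every $d\times d$ Hermitian matrix $A$, $$\int \exp(i\,\mathrm{Tr}\,AM)\,d\mathbb{P}_d^\mu(M)=\exp\big(\mathbb{E}\big(d\times\psi_\mu(\langle u,Au\rangle)\big)\big),$$ where $\psi_\mu$ is the Lévy exponent of $\mu$, $\langle\cdot,\cdot\rangle$ is the usual Hermitian product of $\mathbb{C}^d$, and $u=(u_1,\ldots,u_d)$ is a uniformly distributed random vector on the unit sphere of $\mathbb{C}^d$.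
   Context: A probability measure $\mu$ on $\mathbb{R}$ is $*$-infinitely divisible if for every $n\ge1$ there is a probability measure $\mu_n$ on $\mathbb{R}$ with $\mu_n^{*n}=\mu$ ($*$ denotes classical convolution; on the space of Hermitian matrices, $*$ is the convolution for matrix addition, so $\mathbb{Q}^{*k}$ is the law of the sum of $k$ independent $\mathbb{Q}$-distributed matrices). The Lévy exponent $\psi_\mu$ of a $*$-infinitely divisible $\mu$ is the unique continuous function $f:\mathbb{R}\to\mathbb{C}$ such that $f(0)=0$ and $\int e^{itx}\,d\mu(x)=\exp(f(t))$ for all $t\in\mathbb{R}$. *)

(* Defs.v *)
From HB Require Import structures.
From mathcomp Require Import all_boot all_order all_algebra.
From mathcomp Require Import complex.
From mathcomp Require Import all_classical all_reals all_analysis.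
From mathcomp Require Import measurable_realfun.
From mathcomp Require Import ring lra.

Set Implicit Arguments.
Unset Strict Implicit.
Unset Printing Implicit Defensive.
Import Order.TTheory GRing.Theory Num.Theory.
Import numFieldNormedType.Exports.
Local Open Scope classical_set_scope.
Local Open Scope ring_scope.
Local Open Scope complex_scope.
Local Open Scope sesquilinear_scope.

(* [R[i]] gets the topology given by the modulus. *)
Set Warnings "-redundant-canonical-projection".
HB.instance Definition _ (R : rcfType) := NormedModule.copy R[i] R[i]^o.

(* Matrices are equipped with the Borel sigma-algebra of their (entrywise)
   topology. *)
Section matrix_borel.
Variables (T : ptopologicalType) (m n : nat).

HB.instance Definition _ := @isMeasurable.Build (sigma_display (@open 'M[T]_(m, n)))
  'M[T]_(m, n) <<s @open 'M[T]_(m, n) >> (@sigma_algebra0 _ setT open)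
  (@sigma_algebraC _ open) (@sigma_algebra_bigcup _ setT open).

End matrix_borel.

(* Topological spaces whose measurable sets are the Borel sets. *)
HB.mixin Record isBorel d T & Topological T & Measurable d T := {
  borelE : @measurable d T = <<s @open T >>
}.

#[short(type="borelType")]
HB.structure Definition Borel d :=
  {T of Topological T & Measurable d T & isBorel d T}.

HB.instance Definition _ (T : ptopologicalType) m n :=
  isBorel.Build _ 'M[T]_(m, n) erefl.

Record hermmx (R : rcfType) (d : nat) := Hermmx {
  hermmx_val :> 'M[R[i]]_d;
  hermmxP : hermmx_val \is hermsymmx
}.

Section hermmx_zmodule.
Variables (R : rcfType) (d : nat).

HB.instance Definition _ := [isSub for @hermmx_val R d].
HB.instance Definition _ := [Choice of hermmx R d by <:].


Definition hermsymmx_pred : {pred 'M[R[i]]_d} := fun M => M \is hermsymmx.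

Let hermsymmx_zmod_closed : zmod_closed hermsymmx_pred.
Proof.
split=> [|A B]; rewrite !unfold_in.
  by apply/is_hermitianmxP; rewrite expr0 scale1r linear0 map_mx0.
move=> /is_hermitianmxP hA /is_hermitianmxP hB; apply/is_hermitianmxP.
rewrite !expr0 !scale1r in hA hB *.
by rewrite linearB /= map_mxB -hA -hB.
Qed.

HB.instance Definition _ :=
  GRing.SubChoice_isSubZmodule.Build 'M[R[i]]_d hermsymmx_pred (hermmx R d) hermsymmx_zmod_closed.

(* The topology induced by that of the matrices, and its Borel sets. *)
HB.instance Definition _ := isPointed.Build (hermmx R d) 0.
HB.instance Definition _ := Topological.copy (hermmx R d)
  (initial_topology (@hermmx_val R d)).
HB.instance Definition _ := @isMeasurable.Build
  (sigma_display (@open (hermmx R d))) (hermmx R d)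
  <<s @open (hermmx R d) >> (@sigma_algebra0 _ setT open)
  (@sigma_algebraC _ open) (@sigma_algebra_bigcup _ setT open).
HB.instance Definition _ := isBorel.Build _ (hermmx R d) erefl.
End hermmx_zmodule.

Section real_borel.
Variable R : realType.

Let real_borelE : @measurable _ R = <<s @open R >>.
Proof.
rewrite eqEsubset; split => [A|]; last first.
  apply: smallest_sub; first exact: sigma_algebra_measurable.
  exact: open_measurable.
rewrite [X in X A](RGenOpens.measurableE R).
apply: smallest_sub; first exact: smallest_sigma_algebra.
by move=> _ [x [y ->]]; apply: sub_sigma_algebra; exact: interval_open.
Qed.

#[non_forgetful_inheritance]
HB.instance Definition _ := isBorel.Build default_measure_display R real_borelE.

End real_borel.

Section measurable_complex_matrix.
Context {R : realType}.

Lemma ler_norm_complex (z : R[i]) :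
  `|z| <= (`|complex.Re z| + `|complex.Im z|)%:C.
Proof.
case: z => a b /=; have -> : a +i* b = a%:C + b *i.
  by simpc.
apply: le_trans (ler_normD _ _) _; rewrite rmorphD /=.
rewrite !normc_def /=.
by rewrite expr0n/= !(add0r, addr0) !sqrtr_sqr.
Qed.


Let rect (q : rat * rat * (rat * rat)) : set R[i] :=
  [set z | ratr q.1.1 < complex.Re z < ratr q.1.2 /\
           ratr q.2.1 < complex.Im z < ratr q.2.2].

Let nbhs_rect (z : R[i]) (A : set R[i]) : nbhs z A ->
  exists q, rect q z /\ rect q `<=` A.
Proof.
move=> [e e0 eA].
have er : e = (complex.Re e)%:C.
  by move: e0 => /=; rewrite ltcE; case: (e) => a b /= /andP[/eqP ->].
set r := complex.Re e in er; have r0 : 0 < r by move: e0 => /=; rewrite er ltcR.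
have aux (x : R) : exists p : rat * rat, ratr p.1 < x < ratr p.2 /\
    forall y, ratr p.1 < y < ratr p.2 -> `|x - y| < r / 2.
  have [|a /[!in_itv]/= ha] := @rat_in_itvoo R (x - r / 2) x; first by lra.
  have [|b /[!in_itv]/= hb] := @rat_in_itvoo R x (x + r / 2); first by lra.
  exists (a, b); split=> [|y] /=; first by lra.
  by rewrite ltr_norml => hy; lra.
have [p [hp pr]] := aux (complex.Re z); have [p' [hp' pr']] := aux (complex.Im z).
exists (p, p'); split=> // w [/pr hw /pr' hw'].
apply: eA; rewrite /ball_/= er; apply: le_lt_trans (ler_norm_complex _) _.
rewrite ltcR; case: z w hw hw' {hp pr hp' pr'} => [a b] [a' b'] /=; lra.
Qed.

Let open_rect m n (O : set 'M[R[i]]_(m, n)) : open O ->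
  O = \bigcup_(q in [set q : {ffun 'I_m * 'I_n -> rat * rat * (rat * rat)} |
      [set M : 'M[R[i]]_(m, n) | forall i j, rect (q (i, j)) (M i j)] `<=` O])
    [set M | forall i j, rect (q (i, j)) (M i j)].
Proof.
move=> oO; rewrite eqEsubset; split=> [M OM|M [q qO qM]]; last exact: qO.
have [P MP PO] : nbhs M O by exact: open_nbhs_nbhs.
have /choice[q hq] (ij : 'I_m * 'I_n) := nbhs_rect (MP ij.1 ij.2).
exists (finfun q) => [N /= hN|/= i j].
  by apply: PO => i j; have := hN i j; rewrite ffunE; apply: (hq (i, j)).2.
by rewrite ffunE; exact: (hq (i, j)).1.
Qed.

Context {disp} {X : measurableType disp}.

Let measurable_preimage_open m n (f : X -> 'M[R[i]]_(m, n)) O :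
  (forall i j, measurable_fun setT (fun x => complex.Re (f x i j))) ->
  (forall i j, measurable_fun setT (fun x => complex.Im (f x i j))) ->
  open O -> measurable (f @^-1` O).
Proof.
move=> mRe mIm oO; rewrite (open_rect oO) preimage_bigcup bigcup_mkcond.
apply: countable_bigcupT_measurable => [|q]; first exact: countableP.
case: ifPn => // _.
rewrite (_ : _ @^-1` _ = \bigcap_(i in [set: 'I_m]) \bigcap_(j in [set: 'I_n])
   (f @^-1` [set M | rect (q (i, j)) (M i j)])); last first.
  by apply/seteqP; split=> [x h i _ j _|x h i j]; [exact: h|exact: h].
apply: fin_bigcap_measurable => // i _.
apply: fin_bigcap_measurable => // j _.
have mE (g : X -> R) (a b : rat) : measurable_fun setT g ->
    measurable [set x | ratr a < g x < ratr b].
  move=> mg; rewrite (_ : mkset _ = setT `&` g @^-1`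
    [set` Interval (BRight (ratr a)) (BLeft (ratr b))]); first by exact: mg.
  by rewrite setTI; apply/seteqP; split=> x /=; rewrite in_itv.
exact: measurableI (mE _ _ _ (mRe i j)) (mE _ _ _ (mIm i j)).
Qed.

Lemma measurable_fun_matrix m n (f : X -> 'M[R[i]]_(m, n)) :
  (forall i j, measurable_fun setT (fun x => complex.Re (f x i j))) ->
  (forall i j, measurable_fun setT (fun x => complex.Im (f x i j))) ->
  measurable_fun setT f.
Proof.
move=> mRe mIm; apply: (@measurability _ _ _ _ _ _ (@open 'M[R[i]]_(m, n))) => //.
by move=> _ [B oB <-]; rewrite setTI; exact: measurable_preimage_open.
Qed.

Lemma measurable_fun_hermmx d (f : X -> hermmx R d) :
  (forall i j, measurable_fun setT (fun x => complex.Re (f x i j))) ->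
  (forall i j, measurable_fun setT (fun x => complex.Im (f x i j))) ->
  measurable_fun setT f.
Proof.
move=> mRe mIm; apply: (@measurability _ _ _ _ _ _ (@open (hermmx R d))) => //.
move=> _ [_ [B oB <-] <-]; rewrite setTI -comp_preimage.
exact: measurable_preimage_open.
Qed.

Definition measurable_complex (g : X -> R[i]) :=
  measurable_fun setT (fun x => complex.Re (g x)) /\
  measurable_fun setT (fun x => complex.Im (g x)).

Lemma measurable_complexM g h : measurable_complex g -> measurable_complex h ->
  measurable_complex (fun x => g x * h x).
Proof.
move=> [g1 g2] [h1 h2]; split.
  rewrite (_ : (fun _ => _) = (fun x => complex.Re (g x) * complex.Re (h x) -
    complex.Im (g x) * complex.Im (h x))).
    by apply: measurable_funB; exact: measurable_funM.
  by apply/funext => x; case: (g x); case: (h x).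
rewrite (_ : (fun _ => _) = (fun x => complex.Re (g x) * complex.Im (h x) +
  complex.Im (g x) * complex.Re (h x))).
  by apply: measurable_funD; exact: measurable_funM.
by apply/funext => x; case: (g x); case: (h x).
Qed.

Lemma measurable_complex_sum I (s : seq I) (g : I -> X -> R[i]) :
  (forall k, measurable_complex (g k)) ->
  measurable_complex (fun x => \sum_(k <- s) g k x).
Proof.
move=> mg; split.
  rewrite (_ : (fun _ => _) = (fun x => \sum_(k <- s) complex.Re (g k x))).
    by apply: measurable_sum => k; exact: (mg k).1.
  by apply/funext => x; rewrite (big_morph (@complex.Re R) (id1 := 0)
    (op1 := +%R)) => // -[? ?] [].
rewrite (_ : (fun _ => _) = (fun x => \sum_(k <- s) complex.Im (g k x))).
  by apply: measurable_sum => k; exact: (mg k).2.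
by apply/funext => x; rewrite (big_morph (@complex.Im R) (id1 := 0)
  (op1 := +%R)) => // -[? ?] [].
Qed.

Lemma measurable_complex_real (g : X -> R) :
  measurable_fun setT g -> measurable_complex (fun x => (g x)%:C).
Proof. by []. Qed.

Lemma measurable_complexC g :
  measurable_complex g -> measurable_complex (fun x => Num.conj (g x)).
Proof.
move=> [g1 g2]; split.
  rewrite (_ : (fun _ => _) = (fun x => complex.Re (g x)))//.
  by apply/funext => x; case: (g x).
rewrite (_ : (fun _ => _) = (fun x => - complex.Im (g x))).
  exact: measurableT_comp.
by apply/funext => x; case: (g x).
Qed.

End measurable_complex_matrix.

Section continuous_coordinates.
Context {R : realType}.

Lemma continuous_Re : continuous (@complex.Re R : R[i] -> R).
Proof.
move=> z A [e /= e0 eA]; exists e%:C; rewrite /= ?ltcR// => w /= zw.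
apply: eA; rewrite /ball_/= -ltcR; apply: le_lt_trans zw.
rewrite normc_def lecR; case: z w => [a b] [c d]/=.
by rewrite -sqrtr_sqr ler_sqrt ?addr_ge0 ?sqr_ge0// lerDl sqr_ge0.
Qed.

Lemma continuous_Im : continuous (@complex.Im R : R[i] -> R).
Proof.
move=> z A [e /= e0 eA]; exists e%:C; rewrite /= ?ltcR// => w /= zw.
apply: eA; rewrite /ball_/= -ltcR; apply: le_lt_trans zw.
rewrite normc_def lecR; case: z w => [a b] [c d]/=.
by rewrite -sqrtr_sqr ler_sqrt ?addr_ge0 ?sqr_ge0// lerDr sqr_ge0.
Qed.

Lemma continuous_borel_measurable d d' (T : borelType d) (T' : borelType d')
  (f : T -> T') : continuous f -> measurable_fun setT f.
Proof.
move=> /continuousP cf; apply: (@measurability _ _ _ _ _ _ (@open T') borelE) => _ [B oB <-].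
by rewrite setTI borelE; apply: sub_sigma_algebra; exact: cf.
Qed.

Lemma measurable_coord m n i j :
  measurable_complex (fun M : 'M[R[i]]_(m, n) => M i j).
Proof.
split; apply: continuous_borel_measurable => M;
  (apply: (@continuous_comp _ _ _ (fun M : 'M[R[i]]_(m, n) => M i j));
  [exact: coord_continuous|]); [exact: continuous_Re|exact: continuous_Im].
Qed.

Lemma measurable_hermmx_coord d i j :
  measurable_complex (fun M : hermmx R d => M i j).
Proof.
split; apply: continuous_borel_measurable => M;
  (apply: (@continuous_comp _ _ _ (fun M : hermmx R d => M i j));
  [apply: (@continuous_comp _ _ _ (@hermmx_val R d) (fun M => M i j));
    [exact: initial_continuous|exact: coord_continuous]|]);
  [exact: continuous_Re|exact: continuous_Im].
Qed.

Lemma measurable_complex_comp d d' (X : measurableType d) (Y : measurableType d')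
  (g : Y -> R[i]) (f : X -> Y) : measurable_complex g ->
  measurable_fun setT f -> measurable_complex (g \o f).
Proof.
by move=> [g1 g2] mf; split; [exact: (measurableT_comp g1 mf)|
  exact: (measurableT_comp g2 mf)].
Qed.

End continuous_coordinates.

Section complex_expectation.
Context {R : realType}.

Definition cexp (z : R[i]) : R[i] :=
  (expR (complex.Re z))%:C * (cos (complex.Im z) +i* sin (complex.Im z)).

(* Componentwise integration of a complex-valued function; the two real
   integrals are total, with a meaningless value on non-integrable functions. *)
Definition cexpectation d (T : measurableType d) (P : probability T R)
    (f : T -> R[i]) : R[i] :=
  (\int[P]_x complex.Re (f x)) +i* (\int[P]_x complex.Im (f x)).

End complex_expectation.

Section convolution.
Context {R : realType} d (T : measurableType d).

Definition convolution (add : {mfun (T * T)%type >-> T}) (P Q : probability T R) :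
  probability T R := distribution (P \x Q)%E add.

(* [convolution_power add zero P 0] is the Dirac mass at the neutral element. *)
Definition convolution_power (add : {mfun (T * T)%type >-> T}) (zero : T)
    (P : probability T R) (n : nat) : probability T R :=
  iter n (convolution add P) (\d_zero : probability T R).

End convolution.

Section addition.
Variables (R : realType) (d : nat).

Definition real_add (z : R * R) : R := z.1 + z.2.

Let measurable_real_add : measurable_fun setT real_add.
Proof. exact: measurable_funD. Qed.

HB.instance Definition _ :=
  isMeasurableFun.Build _ _ _ _ real_add measurable_real_add.

Definition hermmx_add (z : hermmx R d * hermmx R d) : hermmx R d :=
  z.1 + z.2.

Let measurable_hermmx_add : measurable_fun setT hermmx_add.
Proof.
have m1 i j := measurable_complex_comp (@measurable_hermmx_coord R d i j)
  (@measurable_fst _ _ (hermmx R d) (hermmx R d)).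
have m2 i j := measurable_complex_comp (@measurable_hermmx_coord R d i j)
  (@measurable_snd _ _ (hermmx R d) (hermmx R d)).
apply: measurable_fun_hermmx => i j.
  rewrite (_ : (fun _ => _) = (fun z => complex.Re ((z.1 : hermmx R d) i j) +
      complex.Re ((z.2 : hermmx R d) i j))).
    by apply: measurable_funD; [exact: (m1 i j).1|exact: (m2 i j).1].
  by apply/funext => z; rewrite mxE; case: (_ i j); case: (_ i j).
rewrite (_ : (fun _ => _) = (fun z => complex.Im ((z.1 : hermmx R d) i j) +
    complex.Im ((z.2 : hermmx R d) i j))).
  by apply: measurable_funD; [exact: (m1 i j).2|exact: (m2 i j).2].
by apply/funext => z; rewrite mxE; case: (_ i j); case: (_ i j).
Qed.

HB.instance Definition _ :=
  isMeasurableFun.Build _ _ _ _ hermmx_add measurable_hermmx_add.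

End addition.

Section limit_theorem_notions.
Context {R : realType}.

Definition weakly_converges d (T : borelType d)
    (P_ : nat -> probability T R) (P : probability T R) : Prop :=
  forall f : T -> R, continuous f -> (exists M : R, forall x, `|f x| <= M) ->
    \int[P_ n]_x f x @[n --> \oo] --> \int[P]_x f x.

(* Set functions are compared on measurable sets only, since the values of a
   [probability] on other sets are unspecified. *)
Definition infinitely_divisible (mu : probability R R) : Prop :=
  forall n, (0 < n)%N -> exists nu : probability R R,
    forall A : set R, measurable A ->
      convolution_power (@real_add R) 0 nu n A = mu A.

Definition is_levy_exponent (mu : probability R R) (psi : R -> R[i]) : Prop :=
  [/\ continuous psi, psi 0 = 0 & forall t : R,
    cexpectation mu (fun x : R => cexp ('i%C * (t * x)%:C)) = cexp (psi t)].

End limit_theorem_notions.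

Section iid.
Context {R : realType} d (T : measurableType d).

Definition tcons n (z : T * n.-tuple T) : n.+1.-tuple T := [tuple of z.1 :: z.2].

Let measurable_tcons n : measurable_fun setT (@tcons n).
Proof. exact: measurable_cons. Qed.

HB.instance Definition _ n :=
  isMeasurableFun.Build _ _ _ _ (@tcons n) (@measurable_tcons n).

(* The n-fold product measure, i.e. the joint law of n i.i.d. variables. *)
Fixpoint iid (mu : probability T R) n : probability (n.-tuple T) R :=
  if n is n'.+1 then distribution (mu \x iid mu n')%E (@tcons n')
  else (\d_[tuple] : probability (0.-tuple T) R).

End iid.

Section random_matrices.
Variables (R : realType) (d : nat).

(* The law of a Haar-distributed unitary matrix, as a law on all matrices which
   charges only the unitary group. *)
Definition is_haar_unitary (h : probability 'M[R[i]]_d R) : Prop :=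
  h [set U | U \is unitarymx] = 1%E /\
  forall V : 'M[R[i]]_d, V \is unitarymx ->
    forall A, measurable A -> h (mulmx V @^-1` A) = h A.

(* Antilinear in [u], linear in [v]. *)
Definition hdot (u v : 'cV[R[i]]_d) : R[i] := (u ^t* *m v) 0 0.

Definition is_isometry (f : 'cV[R[i]]_d -> 'cV[R[i]]_d) : Prop :=
  forall u v, hdot (f u - f v) (f u - f v) = hdot (u - v) (u - v).

(* The law of a uniform vector on the unit sphere of C^d = R^(2d), as a law on
   C^d: it charges only the sphere and is invariant under all the linear
   isometries of R^(2d) (an isometry fixing 0 is real-linear). *)
Definition is_uniform_on_sphere (s : probability 'cV[R[i]]_d R) : Prop :=
  s [set u | hdot u u = 1] = 1%E /\
  forall f, is_isometry f -> f 0 = 0 ->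
    forall A, measurable A -> s (f @^-1` A) = s A.

(* [(U, x)] is mapped to [U diag(x) U^*], which is Hermitian for any [U]. *)
Definition conj_diag_mx (z : 'M[R[i]]_d * d.-tuple R) : 'M[R[i]]_d :=
  z.1 *m diag_mx (\row_i (tnth z.2 i)%:C) *m z.1 ^t*.

Let conj_diag_mxE z i j : conj_diag_mx z i j =
  \sum_k z.1 i k * (tnth z.2 k)%:C * Num.conj (z.1 j k).
Proof.
rewrite /conj_diag_mx mul_mx_diag mxE; apply: eq_bigr => k _.
by rewrite !mxE.
Qed.

Lemma conj_diag_mx_hermsym z : conj_diag_mx z \is hermsymmx.
Proof.
apply/is_hermitianmxP; rewrite expr0 scale1r; apply/matrixP => i j.
rewrite [RHS]mxE [in RHS]mxE !conj_diag_mxE rmorph_sum/=.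
apply: eq_bigr => k _; rewrite !rmorphM/= conjCK.
have -> : Num.conj (tnth z.2 k)%:C = (tnth z.2 k)%:C :> R[i] by exact: conjc_real.
by ring.
Qed.

Definition conj_diag (z : 'M[R[i]]_d * d.-tuple R) : hermmx R d :=
  Hermmx (conj_diag_mx_hermsym z).

Let measurable_conj_diag : measurable_fun setT conj_diag.
Proof.
have mc i j : measurable_complex (fun z => conj_diag z i j).
  rewrite (_ : (fun _ => _) = (fun z : 'M[R[i]]_d * d.-tuple R =>
    \sum_k z.1 i k * (tnth z.2 k)%:C * Num.conj (z.1 j k))); last by apply/funext => z; exact: conj_diag_mxE.
  apply: measurable_complex_sum => k.
  have mU i' : measurable_complex
      (fun z : 'M[R[i]]_d * d.-tuple R => z.1 i' k).
    exact: (measurable_complex_comp (measurable_coord i' k)).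
  apply: measurable_complexM; last exact: measurable_complexC.
  apply: measurable_complexM => //; apply: measurable_complex_real.
  exact: (measurableT_comp (measurable_tnth k)).
by apply: measurable_fun_hermmx => i j; [exact: (mc i j).1|exact: (mc i j).2].
Qed.

HB.instance Definition _ :=
  isMeasurableFun.Build _ _ _ _ conj_diag measurable_conj_diag.

(* The law of [U diag(X_1, .., X_d) U^*] for [U] of law [h] independent of the
   i.i.d. [X_k] of law [mu]; independence is the product measure. *)
Definition unitary_diag_law (h : probability 'M[R[i]]_d R)
    (mu : probability R R) : probability (hermmx R d) R :=
  distribution (h \x iid mu d)%E conj_diag.

End random_matrices.

(* Main.v *)
(**
With [X_j] of law [mu_n], [Tr (U^* A U diag(X)) = sum_j X_j <U_j, A U_j>], so the
Fourier transform of [Q_d^{mu_n}] at [A] is [E prod_j phi_n(<U_j, A U_j>)], where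
[phi_n] is that of [mu_n] and [U_j] are the columns of [U].  Since [phi_n^{k_n}]
converges to [exp psi] locally uniformly and [phi_n] is continuous with
[phi_n 0 = 1], the k_n-th roots are taken on the right branch and
[k_n (phi_n - 1)] converges to [psi] locally uniformly.  Hence [k_n (... - 1)],
for the above Fourier transform, converges to [E sum_j psi(<U_j, A U_j>)], which is
[d E psi(<u, A u>)] because each column is uniform on the sphere, and its k_n-th
power converges to the exponential of that limit.

The limit is continuous at [0], and Lévy's continuity theorem provides [P_d^mu]:
the sequence is tight; its limit along an ultrafilter is realised on [[0, 1]] by
coding the countably many events [q <= x_i] as successive bits; Stone-Weierstrass
and tightness extend the convergence from trigonometric polynomials to all bounded
continuous functions.
*)

Require Import Defs.
From HB Require Import structures.
From mathcomp Require Import all_boot all_order all_algebra.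
From mathcomp Require Import complex.
From mathcomp Require Import all_classical all_reals all_analysis.
From mathcomp Require Import measurable_realfun.
From mathcomp Require Import ring lra.
Set Implicit Arguments.
Unset Strict Implicit.
Unset Printing Implicit Defensive.
Import Order.TTheory GRing.Theory Num.Theory.
Import numFieldNormedType.Exports.
Local Open Scope classical_set_scope.
Local Open Scope ring_scope.
Local Open Scope complex_scope.

(** * Bounded measurable functions *)

(** Limits of masses of events along an ultrafilter are a priori only finitely additive, and this
    shapes the construction of the limit law. Only the masses of finite bit words are passed to the
    limit: they are nonnegative and split consistently, so they are lengths of nested intervals of
    [0, 1], and Lebesgue measure restores countable additivity. In exchange, boundary information is
    lost: the limit bit for [q <= x] and the limit variable [Y] may disagree when [Y = q].
    Convergence is therefore obtained for bounded Lipschitz functions of the coordinates, which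
    include the cosines and sines of linear forms. Their integrals converge along the whole
    sequence, so the ultrafilter leaves no trace in the end. A second obstacle is that [psi] may be
    unbounded on the line, while the calculus of expectations is set up for bounded functions.
    Quadratic forms are clamped to a window in which they lie almost surely. *)

Section bounded_measurable.
Context {R : realType} d (T : measurableType d).
Implicit Types f g : T -> R.

(** Under a probability measure such functions are always integrable, so linearity and Fubini
    exchanges raise no further integrability conditions. *)
Definition bounded_measurable f :=
  measurable_fun setT f /\ exists M, forall x, `|f x| <= M.

Lemma bounded_measurable_cst (c : R) : bounded_measurable (fun=> c).
Proof. by split=> //; exists `|c|. Qed.

Lemma bounded_measurableD f g : bounded_measurable f -> bounded_measurable g ->
  bounded_measurable (fun x => f x + g x).
Proof.
move=> [mf [M fM]] [mg [N gN]]; split; first exact: measurable_funD.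
by exists (M + N) => x; rewrite (le_trans (ler_normD _ _))// lerD.
Qed.

Lemma bounded_measurableM f g : bounded_measurable f -> bounded_measurable g ->
  bounded_measurable (fun x => f x * g x).
Proof.
move=> [mf [M fM]] [mg [N gN]]; split; first exact: measurable_funM.
by exists (M * N) => x; rewrite normrM ler_pM.
Qed.

Lemma bounded_measurableN f : bounded_measurable f ->
  bounded_measurable (fun x => - f x).
Proof.
move=> [mf [M fM]]; split; first exact: measurableT_comp.
by exists M => x; rewrite normrN.
Qed.

Lemma bounded_measurableB f g : bounded_measurable f -> bounded_measurable g ->
  bounded_measurable (fun x => f x - g x).
Proof. by move=> bf /bounded_measurableN; exact: bounded_measurableD. Qed.

Lemma bounded_measurable_sum I (s : seq I) (F : I -> T -> R) :
  (forall i, bounded_measurable (F i)) ->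
  bounded_measurable (fun x => \sum_(i <- s) F i x).
Proof.
move=> bF; elim: s => [|i s ih].
  under eq_fun do rewrite big_nil; exact: bounded_measurable_cst.
by under eq_fun do rewrite big_cons; exact: bounded_measurableD.
Qed.

Lemma bounded_measurable_indic (A : set T) : measurable A ->
  bounded_measurable (\1_A : T -> R).
Proof.
move=> mA; split; first exact: measurable_indic.
by exists 1 => x; rewrite indicE; case: (_ \in _); rewrite ?normr1 ?normr0.
Qed.

Lemma bounded_measurable_integrable (P : probability T R) f :
  bounded_measurable f -> P.-integrable setT (EFin \o f).
Proof.
move=> [mf [M fM]]; apply: measurable_bounded_integrable => //.
  exact: fin_num_fun_lty.
by exists M; split=> [|x Mx y _]; [rewrite num_real|exact: le_trans (fM _) (ltW Mx)].
Qed.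

End bounded_measurable.
Arguments bounded_measurable_cst {R d} T c.

Lemma bounded_measurable_comp {R : realType} d d' (T : measurableType d)
    (T' : measurableType d') (g : T' -> T) (f : T -> R) :
  measurable_fun setT g -> bounded_measurable f -> bounded_measurable (f \o g).
Proof.
move=> mg [mf [M fM]]; split; first exact: measurableT_comp.
by exists M => x; exact: fM.
Qed.

Lemma bounded_measurable_cos {R : realType} d (T : measurableType d) (f : T -> R) :
  measurable_fun setT f -> bounded_measurable (fun x => cos (f x)).
Proof.
move=> mf; split.
  apply: (measurableT_comp _ mf).
  apply: continuous_measurable_fun; exact: continuous_cos.
by exists 1 => x; rewrite ler_norml cos_le1 cos_geN1.
Qed.

Lemma bounded_measurable_sin {R : realType} d (T : measurableType d) (f : T -> R) :
  measurable_fun setT f -> bounded_measurable (fun x => sin (f x)).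
Proof.
move=> mf; split.
  apply: (measurableT_comp _ mf).
  apply: continuous_measurable_fun; exact: continuous_sin.
by exists 1 => x; rewrite ler_norml sin_le1 sin_geN1.
Qed.

Section Rintegral_probability.
Context {R : realType} d (T : measurableType d) (P : probability T R).
Implicit Types f g : T -> R.

Lemma Rintegral_probability_cst (c : R) : \int[P]_x c = c.
Proof.
by rewrite /Rintegral integral_cst//= [X in (_ * X)%E]probability_setT mule1.
Qed.

Lemma bounded_RintegralD f g : bounded_measurable f -> bounded_measurable g ->
  \int[P]_x (f x + g x) = \int[P]_x f x + \int[P]_x g x.
Proof. by move=> bf bg; rewrite RintegralD//; exact: bounded_measurable_integrable. Qed.

Lemma bounded_RintegralB f g : bounded_measurable f -> bounded_measurable g ->
  \int[P]_x (f x - g x) = \int[P]_x f x - \int[P]_x g x.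
Proof. by move=> bf bg; rewrite RintegralB//; exact: bounded_measurable_integrable. Qed.

Lemma bounded_RintegralZl f c : bounded_measurable f ->
  \int[P]_x (c * f x) = c * \int[P]_x f x.
Proof. by move=> bf; rewrite RintegralZl//; exact: bounded_measurable_integrable. Qed.

Lemma bounded_le_Rintegral f g : bounded_measurable f -> bounded_measurable g ->
  (forall x, f x <= g x) -> \int[P]_x f x <= \int[P]_x g x.
Proof. by move=> bf bg fg; apply: le_Rintegral => //; exact: bounded_measurable_integrable. Qed.

Lemma bounded_Rintegral_sum I (s : seq I) (F : I -> T -> R) :
  (forall i, bounded_measurable (F i)) ->
  \int[P]_x (\sum_(i <- s) F i x) = \sum_(i <- s) \int[P]_x F i x.
Proof.
move=> bF; elim: s => [|i s ih].
  rewrite big_nil; under eq_Rintegral do rewrite big_nil.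
  exact: Rintegral_probability_cst.
rewrite big_cons; under eq_Rintegral do rewrite big_cons.
by rewrite bounded_RintegralD ?ih//; exact: bounded_measurable_sum.
Qed.

Lemma Rintegral_le_cst f M : bounded_measurable f ->
  (forall x, f x <= M) -> \int[P]_x f x <= M.
Proof.
move=> bf fM; rewrite -(Rintegral_probability_cst M).
by apply: bounded_le_Rintegral => //; exact: bounded_measurable_cst.
Qed.

Lemma Rintegral_normr_le f g : bounded_measurable f -> bounded_measurable g ->
  (forall x, `|f x| <= g x) -> `|\int[P]_x f x| <= \int[P]_x g x.
Proof.
move=> bf bg fg; rewrite ler_norml; apply/andP; split; last first.
  by apply: bounded_le_Rintegral => // x; rewrite (le_trans (ler_norm _)).
rewrite -mulN1r -bounded_RintegralZl//; apply: bounded_le_Rintegral => //.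
  by apply: bounded_measurableM => //; exact: bounded_measurable_cst.
by move=> x; have := fg x; rewrite ler_norml => /andP[+ _]; rewrite mulN1r.
Qed.

Lemma Rintegral_indic_probability A : measurable A ->
  \int[P]_x \1_A x = fine (P A).
Proof. by move=> mA; rewrite /Rintegral integral_indic// setIT. Qed.

Lemma ae_eq_Rintegral f g : measurable_fun setT f -> measurable_fun setT g ->
  {ae P, forall x, f x = g x} -> \int[P]_x f x = \int[P]_x g x.
Proof.
move=> mf mg fg; congr fine; apply: ae_eq_integral => //.
- exact/measurable_EFinP.
- exact/measurable_EFinP.
- by apply: filterS fg => x fgx _; rewrite fgx.
Qed.

End Rintegral_probability.

Section Rintegral_transfer.
Context {R : realType}.

Lemma Rintegral_distribution d d' (T : measurableType d) (T' : measurableType d')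
    (P : probability T R) (X : {mfun T >-> T'}) (f : T' -> R) :
  bounded_measurable f ->
  \int[distribution P X]_y f y = \int[P]_x f (X x).
Proof.
move=> bf; congr fine; apply: (@integral_distribution _ _ _ _ _ P X (EFin \o f)).
  by apply/measurable_EFinP; exact: bf.1.
apply: (bounded_measurable_integrable P (f := f \o X)).
by apply: bounded_measurable_comp => //; exact: measurable_funPT.
Qed.

Lemma Rintegral_dirac d (T : measurableType d) (a : T) (f : T -> R) :
  measurable_fun setT f -> \int[\d_a : probability T R]_x f x = f a.
Proof.
move=> mf; rewrite /Rintegral integral_dirac//; last exact/measurable_EFinP.
by rewrite diracT mul1e.
Qed.

Section prod.
Context d1 d2 (T1 : measurableType d1) (T2 : measurableType d2).
Variables (P : probability T1 R) (Q : probability T2 R) (f : T1 * T2 -> R).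
Hypothesis bf : bounded_measurable f.

Let intf : (P \x Q)%E.-integrable setT (EFin \o f).
Proof. exact: (@bounded_measurable_integrable _ _ _ (P \x Q)%E). Qed.

Let bounded_section1 x : bounded_measurable (fun y => f (x, y)).
Proof.
by apply: (bounded_measurable_comp (f := f) (g := fun y => (x, y))) => //; exact: pair1_measurable.
Qed.

Let bounded_section2 y : bounded_measurable (fun x => f (x, y)).
Proof.
by apply: (bounded_measurable_comp (f := f) (g := fun x => (x, y))) => //; exact: pair2_measurable.
Qed.

Lemma bounded_measurable_Rintegral2 :
  bounded_measurable (fun x => \int[Q]_y f (x, y)).
Proof.
split.
  rewrite (_ : (fun x => _) = fine \o fubini_F Q (EFin \o f))//.
  by apply: measurableT_comp => //; exact: (measurable_fubini_F (m1 := P)).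
have [M fM] := bf.2; exists M => x.
rewrite -(Rintegral_probability_cst Q M).
by apply: Rintegral_normr_le => //; exact: bounded_measurable_cst.
Qed.

Lemma bounded_measurable_Rintegral1 :
  bounded_measurable (fun y => \int[P]_x f (x, y)).
Proof.
split.
  rewrite (_ : (fun x => _) = fine \o fubini_G P (EFin \o f))//.
  by apply: measurableT_comp => //; exact: (measurable_fubini_G (m2 := Q)).
have [M fM] := bf.2; exists M => x.
rewrite -(Rintegral_probability_cst P M).
by apply: Rintegral_normr_le => //; exact: bounded_measurable_cst.
Qed.

Lemma Rintegral_prod12 : \int[(P \x Q)%E]_z f z = \int[P]_x \int[Q]_y f (x, y).
Proof.
rewrite /Rintegral -integral12_prod_meas1//; congr fine.
apply: eq_integral => x _; rewrite fineK//.
by apply: integrable_fin_num => //; exact: (bounded_measurable_integrable Q).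
Qed.

Lemma Rintegral_prod21 : \int[(P \x Q)%E]_z f z = \int[Q]_y \int[P]_x f (x, y).
Proof.
rewrite /Rintegral -integral21_prod_meas1//; congr fine.
apply: eq_integral => x _; rewrite fineK//.
by apply: integrable_fin_num => //; exact: (bounded_measurable_integrable P).
Qed.

End prod.
End Rintegral_transfer.

(** * Complex modulus and exponential *)

(** Real-valued, whereas the norm of [R[i]] takes its values in [R[i]]; moduli can thus be compared
    directly with real constants and integrals. *)
Definition cmod {R : realType} (z : R[i]) : R := ComplexField.Normc.normc z.
Arguments cmod : simpl never.

Section complex_lemmas.
Context {R : realType}.
Implicit Types (x y : R) (z w : R[i]).


Lemma complexReD z w : complex.Re (z + w) = complex.Re z + complex.Re w.
Proof. by case: z; case: w. Qed.

Lemma complexImD z w : complex.Im (z + w) = complex.Im z + complex.Im w.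
Proof. by case: z; case: w. Qed.

Lemma complexReN z : complex.Re (- z) = - complex.Re z.
Proof. by case: z. Qed.

Lemma complexImN z : complex.Im (- z) = - complex.Im z.
Proof. by case: z. Qed.

Lemma complexReM z w : complex.Re (z * w) =
  complex.Re z * complex.Re w - complex.Im z * complex.Im w.
Proof. by case: z; case: w. Qed.

Lemma complexImM z w : complex.Im (z * w) =
  complex.Re z * complex.Im w + complex.Im z * complex.Re w.
Proof. by case: z; case: w. Qed.

Lemma eq_ReIm z w : complex.Re z = complex.Re w -> complex.Im z = complex.Im w ->
  z = w.
Proof. by case: z; case: w => ? ? ? ? /= -> ->. Qed.

Lemma complexRe_sum I (s : seq I) (F : I -> R[i]) :
  complex.Re (\sum_(i <- s) F i) = \sum_(i <- s) complex.Re (F i).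
Proof. by apply: big_morph => //; exact: complexReD. Qed.

Lemma complexIm_sum I (s : seq I) (F : I -> R[i]) :
  complex.Im (\sum_(i <- s) F i) = \sum_(i <- s) complex.Im (F i).
Proof. by apply: big_morph => //; exact: complexImD. Qed.

Lemma cmodE z : cmod z = Num.sqrt (complex.Re z ^+ 2 + complex.Im z ^+ 2).
Proof. by case: z. Qed.

Lemma cmod0 : cmod (0 : R[i]) = 0.
Proof. exact: ComplexField.Normc.normc0. Qed.

Lemma cmod1 : cmod (1 : R[i]) = 1.
Proof. exact: ComplexField.Normc.normc1. Qed.

Lemma cmodV z : cmod z^-1 = (cmod z)^-1.
Proof. exact: ComplexField.Normc.normcV. Qed.

Lemma cmod_ge0 z : 0 <= cmod z.
Proof. by rewrite cmodE sqrtr_ge0. Qed.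

Lemma sqr_cmodE z : cmod z ^+ 2 = complex.Re z ^+ 2 + complex.Im z ^+ 2.
Proof. by rewrite cmodE sqr_sqrtr// addr_ge0// sqr_ge0. Qed.

Lemma cmod_real x : cmod x%:C = `|x|.
Proof. by rewrite cmodE /= expr0n addr0 sqrtr_sqr. Qed.

Lemma normr_Re_le z : `|complex.Re z| <= cmod z.
Proof.
rewrite cmodE -sqrtr_sqr ler_sqrt ?addr_ge0 ?sqr_ge0//.
by rewrite lerDl sqr_ge0.
Qed.

Lemma normr_Im_le z : `|complex.Im z| <= cmod z.
Proof.
rewrite cmodE -sqrtr_sqr ler_sqrt ?addr_ge0 ?sqr_ge0//.
by rewrite lerDr sqr_ge0.
Qed.

Lemma cmod_leD z w : cmod (z + w) <= cmod z + cmod w.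
Proof. exact: le_normcD. Qed.

Lemma cmod_opp z : cmod (- z) = cmod z.
Proof. by rewrite !cmodE complexReN complexImN !sqrrN. Qed.

Lemma cmod_leB z w : cmod (z - w) <= cmod z + cmod w.
Proof. by rewrite -(cmod_opp w) cmod_leD. Qed.

Lemma cmod_mul z w : cmod (z * w) = cmod z * cmod w.
Proof. exact: ComplexField.Normc.normcM. Qed.

Lemma cmod_nat n : cmod (n%:R : R[i]) = n%:R.
Proof. by rewrite -(rmorph_nat (real_complex R)) cmod_real normr_nat. Qed.

Lemma cmod_exp z n : cmod (z ^+ n) = cmod z ^+ n.
Proof.
by elim: n => [|n ih]; rewrite ?expr0 ?cmod1// !exprS cmod_mul ih.
Qed.

Lemma cmod_le_ReIm z : cmod z <= `|complex.Re z| + `|complex.Im z|.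
Proof.
rewrite -[leRHS]ger0_norm ?addr_ge0// -[leLHS]ger0_norm ?cmod_ge0//.
rewrite -ler_sqr ?nnegrE// !real_normK ?num_real// sqr_cmodE.
rewrite sqrrD !real_normK ?num_real//.
have : 0 <= `|complex.Re z| * `|complex.Im z| by exact: mulr_ge0.
by lra.
Qed.

Lemma cmod_sum_le I (s : seq I) (F : I -> R[i]) :
  cmod (\sum_(i <- s) F i) <= \sum_(i <- s) cmod (F i).
Proof.
elim: s => [|i s ih]; first by rewrite !big_nil cmod0.
by rewrite !big_cons (le_trans (cmod_leD _ _))// lerD2l.
Qed.

Lemma sin_norm_le x : `|sin x| <= `|x|.
Proof.
have aux y : 0 <= y -> `|sin y| <= y.
  move=> y0; have [c _] := MVT_segment y0
    (fun t _ => is_derive_sin t) (continuous_subspaceT (@continuous_sin R)).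
  rewrite sin0 !subr0 => ->; rewrite normrM (ger0_norm y0).
  by rewrite ler_piMl// ler_norml cos_le1 cos_geN1.
have [x0|x0] := leP 0 x; first by rewrite [leRHS]ger0_norm// aux.
by rewrite -normrN -sinN [leRHS]ltr0_norm// aux// oppr_ge0 ltW.
Qed.

(** Half-angle formula: [cos x = 1 - 2 sin(x/2)^2], and [|sin(x/2)| <= |x/2|]. *)
Lemma cos_ge_quad x : 1 - x ^+ 2 / 2 <= cos x.
Proof.
have -> : x = (x / 2) *+ 2 by rewrite -mulr_natr divfK.
rewrite cos_mulr2n cos2sin2; have := sin_norm_le (x / 2).
rewrite -ler_sqr ?nnegrE// !real_normK ?num_real//.
set s := sin _ ^+ 2; rewrite -mulr_natr; lra.
Qed.

(** By the mean value theorem [sin y - y = (cos c - 1) y] with [0 <= c <= y], and [1 - cos c] is at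
    most quadratic in [c]. *)
Lemma sin_sub_le x : `|sin x - x| <= `|x| ^+ 3.
Proof.
have aux y : 0 <= y -> `|sin y - y| <= y ^+ 3.
  move=> y0; have [c] := MVT_segment y0
    (fun t _ => is_derive_sin t) (continuous_subspaceT (@continuous_sin R)).
  rewrite in_itv/= => /andP[c0 cy].
  rewrite sin0 !subr0 => ->; rewrite -[X in _ - X]mul1r -mulrBl normrM.
  rewrite (ger0_norm y0) [leRHS]exprSr ler_wpM2r// distrC ger0_norm ?subr_ge0 ?cos_le1//.
  have := cos_ge_quad c; have : c ^+ 2 <= y ^+ 2 by rewrite ler_sqr.
  by have := sqr_ge0 y; lra.
have [x0|x0] := leP 0 x; first by rewrite [`|x|]ger0_norm// aux.
rewrite [`|x|]ltr0_norm//; have := aux (- x).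
by rewrite sinN -opprD normrN; apply; rewrite oppr_ge0 ltW.
Qed.

Lemma cos_lip x y : `|cos x - cos y| <= `|x - y|.
Proof.
wlog yx : x y / y <= x => [h|].
  by have [/h//|/ltW/h] := leP y x; rewrite distrC (distrC x).
have [c _ ->] := MVT_segment yx
    (fun t _ => is_derive_cos t) (continuous_subspaceT (@continuous_cos R)).
by rewrite normrM ler_piMl// normrN ler_norml sin_le1 sin_geN1.
Qed.

Lemma sin_lip x y : `|sin x - sin y| <= `|x - y|.
Proof.
wlog yx : x y / y <= x => [h|].
  by have [/h//|/ltW/h] := leP y x; rewrite distrC (distrC x).
have [c _ ->] := MVT_segment yx
    (fun t _ => is_derive_sin t) (continuous_subspaceT (@continuous_sin R)).
by rewrite normrM ler_piMl// ler_norml cos_le1 cos_geN1.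
Qed.

(** Applying [1 + y <= exp y] at [-x] gives [exp x (1 - x) <= 1], hence
    [(exp x - 1 - x)(1 - x) <= x^2]; then [1 - x >= 1/2]. *)
Lemma expR_sub1_le x : `|x| <= 1 / 2 -> `|expR x - 1 - x| <= 2 * x ^+ 2.
Proof.
rewrite ler_norml => /andP[x1 x2].
have e1 := expR_ge1Dx x; have e2 := expR_ge1Dx (- x).
have e0 := expR_gt0 x.
rewrite ger0_norm; last by lra.
have ex : expR x * (1 - x) <= 1.
  by rewrite -[leRHS](expRxMexpNx_1 x) ler_pM2l.
by have := @mulr_ge0 _ (expR x - 1 - x) (1 / 2 - x) ltac:(lra) ltac:(lra); nra.
Qed.

Lemma cexpE z : cexp z = (expR (complex.Re z) * cos (complex.Im z)) +i*
  (expR (complex.Re z) * sin (complex.Im z)).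
Proof. by rewrite /cexp; apply: eq_ReIm; rewrite ?complexReM ?complexImM/= mul0r ?subr0 ?addr0. Qed.

Lemma cexp0 : cexp (0 : R[i]) = 1.
Proof. by rewrite cexpE/= expR0 cos0 sin0 !mul1r. Qed.

Lemma cexpD z w : cexp (z + w) = cexp z * cexp w.
Proof.
rewrite !cexpE; apply: eq_ReIm;
  rewrite ?complexReM ?complexImM/= complexReD complexImD expRD ?cosD ?sinD; ring.
Qed.

Lemma cexpMn z n : cexp (n%:R * z) = cexp z ^+ n.
Proof.
elim: n => [|n ih]; first by rewrite mul0r cexp0 expr0.
by rewrite -natr1 mulrDl mul1r cexpD ih exprSr.
Qed.

Lemma cmod_cexp z : cmod (cexp z) = expR (complex.Re z).
Proof.
rewrite /cexp cmod_mul cmod_real ger0_norm ?expR_ge0//=.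
by rewrite cmodE/= cos2Dsin2 sqrtr1 mulr1.
Qed.

Lemma cexp_sum I (s : seq I) (F : I -> R[i]) :
  cexp (\sum_(i <- s) F i) = \prod_(i <- s) cexp (F i).
Proof. by apply: big_morph; [exact: cexpD|exact: cexp0]. Qed.

Lemma cexp_imag x : cexp ('i%C * x%:C) = cos x +i* sin x.
Proof. by rewrite cexpE complexReM complexImM /= !(mul0r, mul1r, subr0, add0r, oppr0, expR0). Qed.

Lemma cmod_cexp_imag x : cmod (cexp ('i%C * x%:C)) = 1.
Proof. by rewrite cexp_imag cmodE/= cos2Dsin2 sqrtr1. Qed.

(** With [z = x + iy], the real part of the error is at most [2x^2 + y^2] and the imaginary part at
    most [x^2 + 2y^2]; the constant 8 leaves room. *)
Lemma cexp_sub1_le z : cmod z <= 1 / 4 ->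
  cmod (cexp z - 1 - z) <= 8 * cmod z ^+ 2.
Proof.
move=> z1; apply: le_trans (cmod_le_ReIm _) _; rewrite cexpE.
have := normr_Re_le z; have := normr_Im_le z; rewrite sqr_cmodE.
move: (cmod z) z1 => n n1; case: z => x y /= yn xn.
have e := @expR_sub1_le x ltac:(lra).
have s := sin_sub_le y; have c := cos_ge_quad y; have c1 := cos_le1 y.
have sy := sin_norm_le y.
have y2 : `|y| ^+ 2 = y ^+ 2 by rewrite real_normK ?num_real.
have x2 : `|x| ^+ 2 = x ^+ 2 by rewrite real_normK ?num_real.
have ex : `|expR x - 1| <= 2 * `|x|.
  have -> : expR x - 1 = (expR x - 1 - x) + x by ring.
  apply: le_trans (ler_normD _ _) _; have := normr_ge0 x; nra.
have ex2 : expR x <= 2 by move: ex; rewrite ler_norml; lra.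
have e0 := expR_gt0 x.
rewrite oppr0 !addr0.
have -> : expR x * cos y - 1 - x = (expR x - 1 - x) - expR x * (1 - cos y) by ring.
have -> : expR x * sin y - y = (expR x - 1) * sin y + (sin y - y) by ring.
have h1 : `|expR x * (1 - cos y)| <= y ^+ 2.
  by rewrite normrM (gtr0_norm e0) ger0_norm; [nra|lra].
have h2 : `|(expR x - 1) * sin y| <= 2 * `|x| * `|y| by rewrite normrM ler_pM.
have h3 : `|y| ^+ 3 <= y ^+ 2 by rewrite exprS y2; have := sqr_ge0 y; nra.
have h4 : 2 * `|x| * `|y| <= x ^+ 2 + y ^+ 2.
  by have := sqr_ge0 (`|x| - `|y|); rewrite -x2 -y2; nra.
have h5 := ler_normB (expR x - 1 - x) (expR x * (1 - cos y)).
have h6 := ler_normD ((expR x - 1) * sin y) (sin y - y).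
by have := sqr_ge0 x; have := sqr_ge0 y; lra.
Qed.

End complex_lemmas.

(** * Products and powers close to 1 *)

Section complex_powers.
Context {R : realType}.
Implicit Types (z w a b : R[i]) (k n : nat).

(** The two bounds go through one induction: a new factor creates the cross term [b i * (p - 1)],
    which the first bound controls in the proof of the second. *)
Lemma prod_sub1_le I (s : seq I) (b : I -> R[i]) (B : R) :
  (forall i, cmod (b i) <= B) -> (size s)%:R * B <= 1 / 2 ->
  cmod (\prod_(i <- s) (1 + b i) - 1) <= 2 * ((size s)%:R * B) /\
  cmod (\prod_(i <- s) (1 + b i) - 1 - \sum_(i <- s) b i) <=
    2 * ((size s)%:R * B) ^+ 2.
Proof.
move=> bB; elim: s => [|i s ih].
  by rewrite !big_nil subrr subr0 cmod0 mul0r mulr0 expr0n/= mulr0.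
rewrite !big_cons /= -natr1 => nB.
have B0 : 0 <= B := le_trans (cmod_ge0 _) (bB i).
have n0 : 0 <= (size s)%:R * B :> R by rewrite mulr_ge0.
have {ih}[] := ih ltac:(lra).
set p := \prod_(j <- s) _; set S := \sum_(j <- s) _ => h1 h2.
set n := (size s)%:R in h1 h2 nB n0 *.
have hb : cmod (b i * (p - 1)) <= B * (2 * (n * B)).
  by rewrite cmod_mul ler_pM ?cmod_ge0.
split.
  have -> : (1 + b i) * p - 1 = (p - 1) + b i + b i * (p - 1) by ring.
  apply: le_trans (cmod_leD _ _) _.
  have := cmod_leD (p - 1) (b i); have := bB i.
  have : B * (2 * (n * B)) <= B by rewrite ler_piMr//; lra.
  lra.
have -> : (1 + b i) * p - 1 - (b i + S) = (p - 1 - S) + b i * (p - 1) by ring.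
apply: le_trans (cmod_leD _ _) _.
have := mulr_ge0 n0 B0; have := mulr_ge0 B0 B0; nra.
Qed.

Lemma prod_sub1_sum_le I (s : seq I) (b : I -> R[i]) (B : R) :
  (forall i, cmod (b i) <= B) -> (size s)%:R * B <= 1 / 2 ->
  cmod (\prod_(i <- s) (1 + b i) - 1 - \sum_(i <- s) b i) <=
    2 * ((size s)%:R * B) ^+ 2.
Proof. by move=> bB /(prod_sub1_le bB)[]. Qed.

(** The linear term [k w] dominates: for [k|w| <= 1/4] the second-order error [2 (k|w|)^2] is at
    most half of [k|w|]. *)
Lemma expr_sub1_ge w k : k%:R * cmod w <= 1 / 4 ->
  k%:R * cmod w <= 2 * cmod ((1 + w) ^+ k - 1).
Proof.
move=> kw; have := @prod_sub1_sum_le _ (nseq k tt) (fun=> w) _ (fun=> lexx _).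
rewrite size_nseq !big_const_seq count_nseq /= mul1n.
rewrite iter_mulr_1 iter_addr_0 => /(_ ltac:(lra)) h.
have k0 : 0 <= k%:R * cmod w by rewrite mulr_ge0// cmod_ge0.
have : cmod (w *+ k) = k%:R * cmod w.
  by rewrite mulr_natl; exact: normcMn.
have := cmod_leB ((1 + w) ^+ k - 1) ((1 + w) ^+ k - 1 - w *+ k).
rewrite opprB addrC subrK; nra.
Qed.

(* The values of [k * cmod (g - 1)] avoid [1 / 4], and vanish at [0]: this
   selects the branch of the k-th root that is close to 1. *)
Lemma continuous_root_close (g : R -> R[i]) k (T eta : R) :
  continuous (fun t => cmod (g t - 1)) -> g 0 = 1 -> eta < 1 / 16 ->
  (forall t, `|t| <= T -> cmod (g t ^+ k - 1) <= eta) ->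
  forall t, `|t| <= T -> k%:R * cmod (g t - 1) <= 2 * eta.
Proof.
move=> cg g0 eta1 gk t tT; set u := fun t => k%:R * cmod (g t - 1).
(* A value of [u] that is at most 1/4 is automatically at most [2 * eta], which is below 1/8. *)
have small s : `|s| <= T -> u s <= 1 / 4 -> u s <= 2 * eta.
  move=> sT us; apply: le_trans (@expr_sub1_ge (g s - 1) k us) _.
  by rewrite addrCA subrr addr0 ler_pM2l ?gk.
have cu : continuous u by move=> x; apply: cvgMl_tmp; exact: cg.
have u0 : u 0 = 0 by rewrite /u g0 subrr cmod0 mulr0.
apply: (small _ tT); rewrite leNgt; apply/negP => ut.
(* A value above 1/4 at [t] would, by the intermediate value theorem from [u 0 = 0], force the value
   1/4 somewhere in between, which [small] excludes. *)
have [c cT uc] : exists2 c, `|c| <= T & u c = 1 / 4.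
  have [t0|t0] := leP 0 t.
    have [|c] := @IVT _ u 0 t (1 / 4) t0 (continuous_subspaceT cu).
      by rewrite u0 ge_min le_max; apply/andP; split; apply/orP; [left|right]; lra.
    rewrite in_itv/= => /andP[c0 ct] uc; exists c => //.
    by apply: le_trans tT; rewrite !ger0_norm// (le_trans c0).
  have [|c] := @IVT _ u t 0 (1 / 4) (ltW t0) (continuous_subspaceT cu).
    by rewrite u0 ge_min le_max; apply/andP; split; apply/orP; [right|left]; lra.
  rewrite in_itv/= => /andP[c0 ct] uc; exists c => //.
  by apply: le_trans tT; rewrite ler0_norm// ltr0_norm// lerN2.
by have := small _ cT; rewrite uc => /(_ (lexx _)); lra.
Qed.

Lemma cexp_div_le z k : (0 < k)%N -> cmod z <= k%:R / 4 ->
  cmod (k%:R * (cexp (z / k%:R) - 1) - z) <= 8 * cmod z ^+ 2 / k%:R.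
Proof.
move=> k0 zk; have kR : 0 < k%:R :> R by rewrite ltr0n.
have kC : k%:R != 0 :> R[i] by rewrite pnatr_eq0 -lt0n.
have nk := cmod_nat k.
have nz : cmod (z / k%:R) = cmod z / k%:R.
  by rewrite cmod_mul cmodV nk.
have -> : k%:R * (cexp (z / k%:R) - 1) - z =
    k%:R * (cexp (z / k%:R) - 1 - z / k%:R).
  by rewrite [RHS]mulrBr; congr (_ - _); rewrite mulrC divfK.
rewrite cmod_mul nk; apply: (@le_trans _ _ (k%:R * (8 * cmod (z / k%:R) ^+ 2))).
  rewrite ler_pM2l//; apply: cexp_sub1_le.
  by rewrite nz ler_pdivrMr//; lra.
rewrite nz le_eqVlt; apply/orP; left; apply/eqP; field.
by rewrite gt_eqF.
Qed.

(** Telescoping of [a^k - b^k]. The bound [M] is on the powers of [b] because [b] itself, later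
    [exp(z/k)], may have modulus above 1. *)
Lemma cmod_subX_le a b k (M : R) : cmod a <= 1 ->
  (forall j, (j <= k)%N -> cmod b ^+ j <= M) ->
  cmod (a ^+ k - b ^+ k) <= k%:R * cmod (a - b) * M.
Proof.
move=> a1; elim: k => [|k ih] bM.
  by rewrite !expr0 subrr cmod0 !mul0r.
have -> : a ^+ k.+1 - b ^+ k.+1 = a * (a ^+ k - b ^+ k) + (a - b) * b ^+ k.
  by rewrite !exprS; ring.
apply: le_trans (cmod_leD _ _) _; rewrite -natr1 !cmod_mul cmod_exp.
have := ih (fun j jk => bM j (leqW jk)); have := bM k (leqnSn k).
have n1 := cmod_ge0 (a - b); have n2 := cmod_ge0 (a ^+ k - b ^+ k).
have := ler_wpM2r n2 a1; move=> h1 /(ler_wpM2l n1) h2 h3.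
by rewrite mulrDl mulrDl; lra.
Qed.

Definition ctends (u : nat -> R[i]) (l : R[i]) :=
  forall e : R, 0 < e -> \forall n \near \oo, cmod (u n - l) <= e.

Lemma near_natr_ge (k : nat -> nat) (C : R) : k n @[n --> \oo] --> \oo ->
  \forall n \near \oo, C <= (k n)%:R.
Proof.
move=> koo; have [m Cm] : exists m : nat, C <= m%:R.
  exists (Num.truncn `|C|).+1; apply: le_trans (ler_norm _) _.
  exact/ltW/truncnS_gt.
have km : \forall n \near \oo, (m <= k n)%N := koo _ (nbhs_infty_ge m).
by near=> n; apply: le_trans Cm _; rewrite ler_nat; near: n.
Unshelve. all: by end_near.
Qed.

(** The base [a n] is compared with [exp(z / k n)], whose powers up to [k n] are all bounded by
    [M = exp |z|]; the k-th powers then differ by at most [M k |a - exp(z/k)|]. *)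
Lemma ctends_exprn (k : nat -> nat) (a : nat -> R[i]) z :
  k n @[n --> \oo] --> \oo -> (forall n, cmod (a n) <= 1) ->
  ctends (fun n => (k n)%:R * (a n - 1)) z ->
  ctends (fun n => a n ^+ k n) (cexp z).
Proof.
move=> koo a1 az e e0; pose M := expR (cmod z).
have M0 : 0 < M by exact: expR_gt0.
have eM0 : 0 < e / (2 * M) by rewrite divr_gt0// mulr_gt0.
near=> n.
have k1 : 1 <= (k n)%:R :> R by near: n; exact: near_natr_ge.
(* [k2] brings [z / k n] into the disc where the quadratic bound on [cexp] holds, and [k3] makes the
   resulting error [8 |z|^2 / k n] at most [e / (2 M)]. *)
have k2 : cmod z * 4 <= (k n)%:R by near: n; exact: near_natr_ge.
have k3 : 8 * cmod z ^+ 2 / (e / (2 * M)) <= (k n)%:R by near: n; exact: near_natr_ge.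
have aze : cmod ((k n)%:R * (a n - 1) - z) <= e / (2 * M).
  by near: n; exact: az.
have k0 : (0 < k n)%N by rewrite -(ltr0n R); lra.
have kC : (k n)%:R != 0 :> R[i] by rewrite pnatr_eq0 -lt0n.
have -> : cexp z = cexp (z / (k n)%:R) ^+ k n.
  by rewrite -cexpMn mulrC divfK.
apply: le_trans (cmod_subX_le (M := M) (a1 n) _) _.
  move=> j jk; rewrite -cmod_exp -cexpMn cmod_cexp ler_expR.
  apply: le_trans (ler_norm _) _; apply: le_trans (normr_Re_le _) _.
  rewrite mulrCA cmod_mul ler_piMr ?cmod_ge0//.
  by rewrite cmod_mul cmodV !cmod_nat ler_pdivrMr ?mul1r ?ler_nat// ltr0n.
have -> : (k n)%:R * cmod (a n - cexp (z / (k n)%:R)) =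
    cmod ((k n)%:R * (a n - cexp (z / (k n)%:R))).
  by rewrite cmod_mul cmod_nat.
rewrite -ler_pdivlMr//.
have -> : (k n)%:R * (a n - cexp (z / (k n)%:R)) = ((k n)%:R * (a n - 1) - z) -
   ((k n)%:R * (cexp (z / (k n)%:R) - 1) - z) by ring.
apply: le_trans (cmod_leB _ _) _.
have : cmod ((k n)%:R * (cexp (z / (k n)%:R) - 1) - z) <= e / (2 * M).
  apply: le_trans (cexp_div_le _ _) _ => //; first by lra.
  by rewrite ler_pdivrMr ?ltr0n// [leRHS]mulrC -ler_pdivrMr.
have -> : e / M = e / (2 * M) + e / (2 * M) by field; lra.
by lra.
Unshelve. all: by end_near.
Qed.

End complex_powers.

(** * Complex expectations *)

Section complex_bounded_measurable.
Context {R : realType} d (T : measurableType d).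
Implicit Types g h : T -> R[i].

Definition complex_bounded_measurable g :=
  bounded_measurable (fun x => complex.Re (g x)) /\
  bounded_measurable (fun x => complex.Im (g x)).

Lemma complex_bounded_measurableP g (M : R) : measurable_complex g ->
  (forall x, cmod (g x) <= M) -> complex_bounded_measurable g.
Proof.
move=> [mg1 mg2] gM; split; split=> //; exists M => x.
  exact: le_trans (normr_Re_le _) (gM x).
exact: le_trans (normr_Im_le _) (gM x).
Qed.

Lemma complex_bounded_measurable_cst (c : R[i]) :
  complex_bounded_measurable (fun=> c).
Proof. by split; exact: bounded_measurable_cst. Qed.

Lemma complex_bounded_measurableD g h : complex_bounded_measurable g ->
  complex_bounded_measurable h -> complex_bounded_measurable (fun x => g x + h x).
Proof.
move=> [g1 g2] [h1 h2]; split.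
  by under eq_fun do rewrite complexReD; exact: bounded_measurableD.
by under eq_fun do rewrite complexImD; exact: bounded_measurableD.
Qed.

Lemma complex_bounded_measurableM g h : complex_bounded_measurable g ->
  complex_bounded_measurable h -> complex_bounded_measurable (fun x => g x * h x).
Proof.
move=> [g1 g2] [h1 h2]; split.
  by under eq_fun do rewrite complexReM; apply: bounded_measurableB; exact: bounded_measurableM.
by under eq_fun do rewrite complexImM; apply: bounded_measurableD; exact: bounded_measurableM.
Qed.

Lemma complex_bounded_measurable_sum I (s : seq I) (G : I -> T -> R[i]) :
  (forall i, complex_bounded_measurable (G i)) ->
  complex_bounded_measurable (fun x => \sum_(i <- s) G i x).
Proof.
move=> bG; split.
  by under eq_fun do rewrite complexRe_sum; apply: bounded_measurable_sum => i; exact: (bG i).1.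
by under eq_fun do rewrite complexIm_sum; apply: bounded_measurable_sum => i; exact: (bG i).2.
Qed.

Lemma complex_bounded_measurable_prod I (s : seq I) (G : I -> T -> R[i]) :
  (forall i, complex_bounded_measurable (G i)) ->
  complex_bounded_measurable (fun x => \prod_(i <- s) G i x).
Proof.
move=> bG; elim: s => [|i s ih].
  by under eq_fun do rewrite big_nil; exact: complex_bounded_measurable_cst.
by under eq_fun do rewrite big_cons; exact: complex_bounded_measurableM.
Qed.

Lemma complex_bounded_measurable_cexp_imag (f : T -> R) :
  measurable_fun setT f ->
  complex_bounded_measurable (fun x => cexp ('i%C * (f x)%:C)).
Proof.
move=> mf; under eq_fun do rewrite cexp_imag.
by split; [exact: bounded_measurable_cos|exact: bounded_measurable_sin].
Qed.

End complex_bounded_measurable.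

Lemma complex_bounded_measurable_comp {R : realType} d d' (T : measurableType d)
    (T' : measurableType d') (f : T' -> T) (g : T -> R[i]) :
  measurable_fun setT f -> complex_bounded_measurable g ->
  complex_bounded_measurable (g \o f).
Proof.
move=> mf [bg1 bg2]; split.
  exact: bounded_measurable_comp mf bg1.
exact: bounded_measurable_comp mf bg2.
Qed.

Section cexpectation_theory.
Context {R : realType} d (T : measurableType d) (P : probability T R).
Implicit Types g h : T -> R[i].

Lemma cexpectation_cst (c : R[i]) : cexpectation P (fun=> c) = c.
Proof. by rewrite /cexpectation !Rintegral_probability_cst; case: c. Qed.

Lemma cexpectation_cexp_imag (f : T -> R) :
  cexpectation P (fun x => cexp ('i%C * (f x)%:C)) =
  (\int[P]_x cos (f x)) +i* (\int[P]_x sin (f x)).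
Proof. by under eq_fun do rewrite cexp_imag. Qed.

Lemma cexpectationD g h : complex_bounded_measurable g ->
  complex_bounded_measurable h ->
  cexpectation P (fun x => g x + h x) = cexpectation P g + cexpectation P h.
Proof.
move=> [g1 g2] [h1 h2]; apply: eq_ReIm; rewrite ?complexReD ?complexImD /=.
  by under eq_Rintegral do rewrite complexReD; exact: bounded_RintegralD.
by under eq_Rintegral do rewrite complexImD; exact: bounded_RintegralD.
Qed.

Lemma cexpectationZl g c : complex_bounded_measurable g ->
  cexpectation P (fun x => c * g x) = c * cexpectation P g.
Proof.
move=> [g1 g2].
have bc f (a : R) : bounded_measurable f -> bounded_measurable (fun x : T => a * f x).
  by move=> bf; apply: bounded_measurableM => //; exact: bounded_measurable_cst.
apply: eq_ReIm; rewrite ?complexReM ?complexImM /=.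
  under eq_Rintegral do rewrite complexReM.
  by rewrite bounded_RintegralB ?bounded_RintegralZl//; exact: bc.
under eq_Rintegral do rewrite complexImM.
by rewrite bounded_RintegralD ?bounded_RintegralZl//; exact: bc.
Qed.

Lemma cexpectation_sum I (s : seq I) (G : I -> T -> R[i]) :
  (forall i, complex_bounded_measurable (G i)) ->
  cexpectation P (fun x => \sum_(i <- s) G i x) = \sum_(i <- s) cexpectation P (G i).
Proof.
move=> bG; elim: s => [|i s ih].
  by rewrite big_nil; under eq_fun do rewrite big_nil; exact: cexpectation_cst.
rewrite big_cons; under eq_fun do rewrite big_cons.
by rewrite cexpectationD ?ih//; exact: complex_bounded_measurable_sum.
Qed.

(* [|E g|^2 = E (Re (conj (E g) * g)) <= |E g| M]. *)
Lemma cmod_cexpectation_le g (M : R) : complex_bounded_measurable g ->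
  (forall x, cmod (g x) <= M) -> cmod (cexpectation P g) <= M.
Proof.
move=> bg gM; set c := cexpectation P g.
have [c0|c0] := eqVneq (cmod c) 0.
  by rewrite c0; apply: le_trans (gM point); exact: cmod_ge0.
have {}c0 : 0 < cmod c by rewrite lt_def c0 cmod_ge0.
rewrite -(ler_pM2l c0) -expr2 sqr_cmodE.
pose c' := complex.Re c -i* complex.Im c.
have cc' : cmod c' = cmod c by rewrite !cmodE/= sqrrN.
have <- : \int[P]_x complex.Re (c' * g x) = complex.Re c ^+ 2 + complex.Im c ^+ 2.
  have /(congr1 (@complex.Re R)) := cexpectationZl c' bg.
  by rewrite complexReM/= -/c => ->; rewrite /=; ring.
apply: Rintegral_le_cst.
  by apply: (complex_bounded_measurableM _ bg).1; exact: complex_bounded_measurable_cst.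
move=> x; apply: le_trans (ler_norm _) _; apply: le_trans (normr_Re_le _) _.
by rewrite cmod_mul cc' ler_pM2l.
Qed.

End cexpectation_theory.

Section cexpectation_transfer.
Context {R : realType}.

Lemma cexpectation_distribution d d' (T : measurableType d)
    (T' : measurableType d') (P : probability T R) (X : {mfun T >-> T'})
    (g : T' -> R[i]) : complex_bounded_measurable g ->
  cexpectation (distribution P X) g = cexpectation P (g \o X).
Proof. by move=> [g1 g2]; rewrite /cexpectation !Rintegral_distribution. Qed.

Section prod.
Context d1 d2 (T1 : measurableType d1) (T2 : measurableType d2).
Variables (P : probability T1 R) (Q : probability T2 R).

Lemma cexpectation_prod12 (g : T1 * T2 -> R[i]) : complex_bounded_measurable g ->
  cexpectation (P \x Q)%E g =
  cexpectation P (fun x => cexpectation Q (fun y => g (x, y))).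
Proof. by move=> [g1 g2]; rewrite /cexpectation !Rintegral_prod12. Qed.

Lemma cexpectation_prodM (g : T1 -> R[i]) (h : T2 -> R[i]) :
  complex_bounded_measurable g -> complex_bounded_measurable h ->
  cexpectation (P \x Q)%E (fun z => g z.1 * h z.2) =
  cexpectation P g * cexpectation Q h.
Proof.
move=> bg bh; rewrite cexpectation_prod12; last first.
  apply: complex_bounded_measurableM.
    by apply: (complex_bounded_measurable_comp (f := fst) _ bg).
  by apply: (complex_bounded_measurable_comp (f := snd) _ bh).
under eq_fun do rewrite /= cexpectationZl// mulrC.
by rewrite cexpectationZl// mulrC.
Qed.

End prod.

(** Stated for an arbitrary character [chi], so as to serve both for measures on the line and for
    laws of Hermitian matrices. *)
Lemma cexpectation_convolution_power d (T : measurableType d)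
    (add : {mfun (T * T)%type >-> T}) (zero : T) (P : probability T R)
    (chi : T -> R[i]) (n : nat) : complex_bounded_measurable chi ->
  (forall x y, chi (add (x, y)) = chi x * chi y) -> chi zero = 1 ->
  cexpectation (convolution_power add zero P n) chi = cexpectation P chi ^+ n.
Proof.
move=> bchi chiM chi0; elim: n => [|n ih].
  rewrite expr0 /convolution_power /= /cexpectation.
  by rewrite !Rintegral_dirac ?chi0//; [exact: bchi.2.1|exact: bchi.1.1].
rewrite exprS -ih -cexpectation_prodM// cexpectation_distribution//.
by congr cexpectation; apply/funext => -[x y]; rewrite /= chiM.
Qed.

Lemma cexpectation_iid d (T : measurableType d) (P : probability T R) n
    (chi : 'I_n -> T -> R[i]) : (forall i, complex_bounded_measurable (chi i)) ->
  cexpectation (iid P n) (fun x => \prod_i chi i (tnth x i)) =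
  \prod_i cexpectation P (chi i).
Proof.
move=> bchi.
have btn m (f : 'I_m -> T -> R[i]) : (forall i, complex_bounded_measurable (f i)) ->
    complex_bounded_measurable (fun x : m.-tuple T => \prod_i f i (tnth x i)).
  move=> bf; apply: complex_bounded_measurable_prod => i.
  apply: (complex_bounded_measurable_comp (f := fun x : m.-tuple T => tnth x i) _ (bf i)).
  exact: measurable_tnth.
elim: n => [|n ih] in chi bchi *.
  rewrite big_ord0; under eq_fun do rewrite big_ord0.
  by rewrite cexpectation_cst.
have bchi' (i : 'I_n) : complex_bounded_measurable (chi (lift ord0 i)) := bchi _.
rewrite big_ord_recl -ih// -cexpectation_prodM//; last first. exact: (btn n _ bchi').
rewrite [iid _ _]/= cexpectation_distribution; last by apply: btn.
congr cexpectation; apply/funext => -[x y] /=.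
rewrite big_ord_recl/= /tcons /=; congr (_ * _).
by apply: eq_bigr => i _; rewrite tnthS.
Qed.

End cexpectation_transfer.

(** * Limits of measures along an ultrafilter, bit by bit *)

(** A segment is compact, so the image ultrafilter has a cluster point; it converges there, since an
    ultrafilter contains each set or its complement. *)
Lemma ultra_bounded_cvg {R : realType} (T : Type) (U : set_system T) (u : T -> R)
    (M : R) : UltraFilter U -> U [set x | `|u x| <= M] ->
  exists l : R, `|l| <= M /\ u x @[x --> U] --> l.
Proof.
move=> UU uM; have cpt := @segment_compact R (- M) M.
have [|l [lM ul]] := cpt (u @ U) _.
  have : U (u @^-1` `[- M, M]); last by [].
  by apply: filterS uM => n /=; rewrite in_itv/= -ler_norml.
exists l; split; first by move: lM; rewrite ler_norml /= in_itv.
move=> A lA; have [//|UA] := in_ultra_setVsetC (u @^-1` A) UU.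
by have [x [/= xA Ax]] := ul (~` A) A UA lA.
Qed.

Lemma measurable_mkseq_eq d (T : measurableType d) (b : nat -> T -> bool) m
    (t : seq bool) : (forall j, measurable [set x | b j x]) ->
  measurable [set x | mkseq (b^~ x) m = t].
Proof.
move=> mb; elim: m t => [|m ih] t.
  have [->|t0] := eqVneq t [::].
    by rewrite (_ : mkset _ = setT)//; apply/seteqP; split.
  rewrite (_ : mkset _ = set0)//; apply/seteqP; split=> // x /= xt.
  by rewrite -xt in t0.
case: (lastP t) => [|s c].
  by rewrite (_ : mkset _ = set0)//; apply/seteqP; split=> // x /=.
rewrite (_ : mkset _ = [set x | mkseq (b^~ x) m = s] `&` [set x | b m x = c]).
  apply: measurableI; first exact: ih.
  case: c; first exact: mb.
  rewrite (_ : mkset _ = ~` [set x | b m x]); first exact: measurableC.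
  by apply/seteqP; split=> x /=; case: (b m x).
apply/seteqP; split=> x /=; rewrite mkseqS; last by move=> [-> ->].
by move/rcons_inj => [].
Qed.

Lemma mkseq_sum_indic {R : realType} (T : Type) (b : nat -> T -> bool) m
    (F : seq bool -> R) x :
  F (mkseq (b^~ x) m) =
  \sum_(t : m.-tuple bool) F t * \1_[set x | mkseq (b^~ x) m = t] x.
Proof.
have sz : size (mkseq (b^~ x) m) == m by rewrite size_mkseq.
rewrite (bigD1 (Tuple sz))//= big1 ?addr0 => [|t tx].
  by rewrite indicE mem_set// mulr1.
rewrite indicE memNset ?mulr0//= => xt; move/negP: tx; apply.
by apply/eqP/val_inj; rewrite /= xt.
Qed.

Lemma bounded_measurable_mkseq {R : realType} d (T : measurableType d)
    (b : nat -> T -> bool) m (F : seq bool -> R) :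
  (forall j, measurable [set x | b j x]) ->
  bounded_measurable (fun x => F (mkseq (b^~ x) m)).
Proof.
move=> mb; under eq_fun do rewrite mkseq_sum_indic.
apply: bounded_measurable_sum => t; apply: bounded_measurableM.
  exact: bounded_measurable_cst.
exact/bounded_measurable_indic/measurable_mkseq_eq.
Qed.

(** A function of finitely many bits is a finite combination of indicators of words, so its integral
    converges as soon as the masses of words do. *)
Lemma Rintegral_mkseq {R : realType} d (T : measurableType d)
    (P : probability T R) (b : nat -> T -> bool) m (F : seq bool -> R) :
  (forall j, measurable [set x | b j x]) ->
  \int[P]_x F (mkseq (b^~ x) m) =
  \sum_(t : m.-tuple bool) F t * fine (P [set x | mkseq (b^~ x) m = t]).
Proof.
move=> mb; have mE t := @measurable_mkseq_eq _ _ _ m t mb.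
under eq_Rintegral do rewrite mkseq_sum_indic.
rewrite bounded_Rintegral_sum => [|t]; last first.
  by apply: bounded_measurableM; [exact: bounded_measurable_cst|
    exact: bounded_measurable_indic].
apply: eq_bigr => t _; rewrite bounded_RintegralZl; last exact: bounded_measurable_indic.
by rewrite Rintegral_indic_probability.
Qed.

(** * Realising a consistent family of word masses by Lebesgue measure on [0, 1] *)

Section bit_coding.
Context {R : realType}.
(* [p w] is the mass of a word [w], whose head is the most recent bit. *)
Variable p : seq bool -> R.
Hypothesis p_ge0 : forall w, 0 <= p w.
Hypothesis p_nil : p [::] = 1.
Hypothesis p_cons : forall w, p w = p (false :: w) + p (true :: w).

(* The words of length [m] index the intervals [[lo w, lo w + p w[] of a
   subdivision of [[0, 1[], refined as [m] grows. *)
Fixpoint word_lo (w : seq bool) : R :=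
  if w is c :: w' then word_lo w' + (if c then p (false :: w') else 0) else 0.

(** Points outside [0, 1[ are treated as 0, so that every real has a code; for the uniform law on
    [0, 1] this changes only a null set. *)
Definition clamp01 (x : R) : R := if 0 <= x < 1 then x else 0.

Fixpoint coded_word (x : R) m : seq bool :=
  if m is m'.+1 then
    let w := coded_word x m' in (word_lo w + p (false :: w) <= clamp01 x) :: w
  else [::].

Definition coded_bit m (x : R) : bool :=
  let w := coded_word x m in word_lo w + p (false :: w) <= clamp01 x.

Lemma coded_wordE x m : coded_word x m = rev (mkseq (coded_bit^~ x) m).
Proof. by elim: m => [//|m ih]; rewrite mkseqS rev_rcons -ih. Qed.

Lemma clamp01_itv x : 0 <= clamp01 x < 1.
Proof. by rewrite /clamp01; case: ifPn => // _; rewrite lexx ltr01. Qed.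

(** The strict upper bound matters: it forces every word that actually occurs as a code to have
    positive mass. *)
Lemma coded_word_itv x m : let w := coded_word x m in
  word_lo w <= clamp01 x < word_lo w + p w.
Proof.
elim: m => [|m ih] /=; first by rewrite p_nil add0r; exact: clamp01_itv.
move: (coded_word x m) ih => w /=; rewrite (p_cons w).
case: ifP => h /andP[h1 h2]; first by rewrite h -addrA.
by rewrite addr0 h1 ltNge h.
Qed.

Lemma word_lo_sub c w : word_lo w <= word_lo (c :: w) /\
  word_lo (c :: w) + p (c :: w) <= word_lo w + p w.
Proof.
by rewrite /= (p_cons w); have := p_ge0 (false :: w); have := p_ge0 (true :: w);
  case: c; lra.
Qed.

Lemma word_lo_bounds w : 0 <= word_lo w /\ word_lo w + p w <= 1.
Proof.
elim: w => [|c w [ih1 ih2]]; first by rewrite /= p_nil add0r.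
by have [h1 h2] := word_lo_sub c w; split; [exact: le_trans h1|exact: le_trans ih2].
Qed.

Lemma coded_wordP x w : word_lo w <= clamp01 x < word_lo w + p w ->
  coded_word x (size w) = w.
Proof.
elim: w => [//|c w ih] h; rewrite [LHS]/=.
have [h1 h2] := word_lo_sub c w.
rewrite ih; last by case/andP: h => h3 h4; rewrite (le_trans h1)//= (lt_le_trans h4).
congr (_ :: _); move: h => /=; case: c {h1 h2} => /andP[h3 h4] //.
by apply/negbTE; rewrite -ltNge; rewrite addr0 in h4.
Qed.

Let lambda : probability (measurableTypeR R) R := uniform_prob (@ltr01 R).

Lemma measurable_coded_bit m : measurable [set x | coded_bit m x].
Proof.
pose I w := [set x | word_lo w <= clamp01 x < word_lo w + p w].
have mI w : measurable (I w).
  have mc : measurable_fun setT clamp01.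
    apply: measurable_fun_ifT => //; apply: measurable_and => //.
      exact: measurable_fun_ler.
    exact: measurable_fun_ltr.
  rewrite (_ : I w = setT `&` clamp01 @^-1` `[word_lo w, word_lo w + p w[).
    by apply: mc => //; exact: measurable_itv.
  by rewrite setTI; apply/seteqP; split=> x /=; rewrite in_itv.
(* Bit [m] is 1 exactly on the cells of the words [true :: w] with [w] of length [m], a finite union
   of intervals pulled back by [clamp01]. *)
rewrite (_ : mkset _ = \big[setU/set0]_(w : m.-tuple bool) I (true :: w)).
  by apply: bigsetU_measurable.
rewrite -bigcup_seq; apply/seteqP; split=> x /=.
  move=> bx; have sz : size (coded_word x m) == m.
    by rewrite coded_wordE size_rev size_mkseq.
  exists (Tuple sz); first by rewrite /= mem_index_enum.
  by have := coded_word_itv x m.+1; rewrite /= -/(coded_bit m x) bx.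
move=> [w _ /= /(@coded_wordP x (true :: w))].
by rewrite /= size_tuple -/(coded_bit m x) => -[].
Qed.

Lemma coded_word_prob w :
  fine (lambda [set x | coded_word x (size w) = w]) = p w.
Proof.
have [l0 l1] := word_lo_bounds w; have p0 := p_ge0 w.
set I := `[word_lo w, word_lo w + p w[%classic.
set S := [set x | coded_word x (size w) = w].
have mS : measurable S.
  rewrite /S (_ : mkset _ =
      [set x | mkseq (coded_bit^~ x) (size w) = rev w]).
    apply: measurable_mkseq_eq; exact: measurable_coded_bit.
  by apply/seteqP; split=> x /=; rewrite coded_wordE => h;
    [rewrite -[in RHS]h revK|rewrite -[RHS]revK -h].
have clampE x : 0 <= x < 1 -> clamp01 x = x by rewrite /clamp01 => ->.
have lI : lebesgue_measure I = (p w)%:E.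
  rewrite /I lebesgue_measure_itv/= lte_fin ltrDl.
  case: ltP => [_|pw0]; first by rewrite -EFinD addrAC subrr add0r.
  by congr EFin; apply/eqP; rewrite eq_le p0.
have -> : lambda S = lebesgue_measure (S `&` `[0, 1]).
  rewrite /lambda /= /uniform_prob integral_uniform_pdf.
  rewrite (eq_integral (fun=> 1%:E)); last first.
    by move=> x; rewrite inE/= in_itv/= /uniform_pdf => -[_ ->]; rewrite subr0 invr1.
  by rewrite integral_cst ?mul1e//; exact: measurableI.
suff -> : lebesgue_measure (S `&` `[0, 1]) = (p w)%:E by [].
(* Within [0, 1], the event [S] and the cell [I] can differ only at the point 1, which [clamp01]
   sends to 0. *)
apply/eqP; rewrite eq_le -lI; apply/andP; split.
  apply: (@le_trans _ _ (lebesgue_measure (I `|` [set 1]))); last first.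
    have mI : measurable I by exact: measurable_itv.
    have m1 : measurable [set 1 : R] by exact: measurable_set1.
    apply: (le_trans (measureU2 (@lebesgue_measure R) mI m1)).
    by rewrite [X in (_ + X <= _)%E]lebesgue_measure_set1 adde0.
  rewrite le_measure ?inE//; [exact: measurableI|
    by apply: measurableU => //; exact: measurable_itv|].
  move=> x [/= Sx]; rewrite in_itv/= => /andP[x0 x1].
  have [->|x1'] := eqVneq x 1; [by right|left].
  have x01 : 0 <= x < 1 by rewrite x0 lt_neqAle x1' x1.
  by have := coded_word_itv x (size w); rewrite Sx clampE.
rewrite le_measure ?inE//; [exact: measurable_itv|exact: measurableI|].
move=> x; rewrite /I/= in_itv/= => Ix.
have x01 : 0 <= x < 1 by case/andP: Ix => h1 h2; rewrite (le_trans l0)// (lt_le_trans h2).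
by rewrite in_itv/= /S/= coded_wordP ?clampE//; split=> //; case/andP: x01 => -> /ltW.
Qed.

End bit_coding.

Section limit_bits.
Context {R : realType} d (T : measurableType d).
Variables (P : nat -> probability T R) (U : set_system nat).
Hypothesis UU : UltraFilter U.
Variables (b : nat -> T -> bool).
Hypothesis mb : forall j, measurable [set x | b j x].

(** The limits [p w] of the masses of words satisfy [p w = p (0w) + p (1w)], which is what the
    coding needs. The second clause transfers to the limit every relation between finitely many
    bits, such as their monotonicity in the threshold. *)
Lemma exists_limit_bits : exists dO (Om : measurableType dO)
    (Q : probability Om R) (b' : nat -> Om -> bool),
  [/\ forall j, measurable [set x | b' j x],
      forall x m, exists y, mkseq (b^~ y) m = mkseq (b'^~ x) m &
      forall m (F : seq bool -> R),
        \int[P n]_x F (mkseq (b^~ x) m) @[n --> U] -->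
        \int[Q]_x F (mkseq (b'^~ x) m)].
Proof.
pose A w := [set x | mkseq (b^~ x) (size w) = rev w].
have mA w : measurable (A w) by exact: measurable_mkseq_eq.
pose u w n := fine (P n (A w)).
have u_bnd w n : 0 <= u w n <= 1.
  rewrite fine_ge0//= -lee_fin fineK ?probability_le1//.
  exact: fin_num_measure.
have [p up] : exists p : seq bool -> R, forall w, u w n @[n --> U] --> p w.
  have /choice[p up] w : exists l : R, u w n @[n --> U] --> l.
    have [|l [_ ul]] := @ultra_bounded_cvg _ _ _ (u w) 1 UU; last by exists l.
    apply: filterE => n; have /andP[h1 h2] := u_bnd w n.
    by rewrite /= ger0_norm.
  by exists p.
have p_ge0 w : 0 <= p w.
  by apply: cvgr_to_ge (up w) _; apply: filterE => n; case/andP: (u_bnd w n).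
have uniq (v : nat -> R) (x y : R) : v n @[n --> U] --> x -> v n @[n --> U] --> y -> x = y.
  by move=> vx vy; exact: (norm_cvg_unique vx vy).
have p_nil : p [::] = 1.
  apply: (uniq _ _ _ (up [::])).
  rewrite (_ : u [::] = cst 1); first exact: cvg_cst.
  apply/funext => n; rewrite /u (_ : A [::] = setT) ?probability_setT//.
  by apply/seteqP; split.
have p_cons w : p w = p (false :: w) + p (true :: w).
  apply: (uniq _ _ _ (up w)) .
  rewrite (_ : u w = fun n => u (false :: w) n + u (true :: w) n).
    by apply: cvgD; exact: up.
  apply/funext => n; rewrite /u -fineD ?fin_num_measure//.
  rewrite -measureU//; last first.
    rewrite -subset0 => x; rewrite /A/= !rev_cons => -[->] /rcons_inj [].
    by [].
  congr (fine (P n _)); apply/seteqP; split=> x; rewrite /A/= !rev_cons mkseqS.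
    by move=> ->; case: (b _ x); [right|left].
  by case=> /rcons_inj[].
exists _, (measurableTypeR R), (uniform_prob (@ltr01 R)), (coded_bit p); split.
- exact: measurable_coded_bit.
- move=> x m; set w := coded_word p x m.
  have wx := coded_wordE p x m; rewrite -/w in wx.
  have sw : size w = m by rewrite wx size_rev size_mkseq.
  (* A word realised by no sample point has mass 0 for every [n], hence limit mass 0, whereas a
     coded word has positive mass. *)
  suff [y Awy] : A w !=set0.
    by exists y; move: Awy; rewrite /A/= sw wx revK.
  apply/set0P/eqP => A0.
  have /= := coded_word_itv p_nil p_cons x m; rewrite -/w.
  suff -> : p w = 0 by rewrite addr0 => /andP[+ h]; rewrite leNgt h.
  apply: (uniq _ _ _ (up w)) .
  rewrite (_ : u w = cst 0); first exact: cvg_cst.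
  by apply/funext => n; rewrite /u A0 measure0.
- move=> m F; rewrite Rintegral_mkseq; last exact: measurable_coded_bit.
  under eq_fun do rewrite Rintegral_mkseq//.
  apply: cvg_big => [|t _]; first exact: add_continuous.
  apply: cvgMl_tmp.
  have -> : fine (uniform_prob (@ltr01 R) [set x | mkseq ((coded_bit p)^~ x) m = t]) =
      p (rev t).
    rewrite -(coded_word_prob p_ge0 p_nil p_cons (rev t)) size_rev size_tuple.
    congr (fine (_ _)); apply/seteqP; split=> x /=; rewrite coded_wordE => h; first exact: congr1.
    exact: (can_inj revK).
  rewrite (_ : (fun n => _) = u (rev t)); first exact: up.
  by apply/funext => n; rewrite /u /A size_rev revK size_tuple.
Qed.

End limit_bits.

(** * Limit of tight real random variables, recovered from threshold bits *)

Section limit_coordinates.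
Context {R : realType} d (X : measurableType d) (I : finType) (c : I -> X -> R).
Hypothesis mc : forall i, measurable_fun setT (c i).
Variables (P : nat -> probability X R) (U : set_system nat).
Hypothesis UU : UltraFilter U.
Hypothesis tight : forall i (e : R), 0 < e -> exists K : nat,
  \forall n \near U, fine (P n [set x | K%:R <= `|c i x|]) <= e.

Let code (z : I * rat) : nat := pickle z.

Let bit (k : nat) (x : X) : bool :=
  if unpickle k is Some (i, q) then ratr q <= c i x else false.

Let bitE i q x : bit (code (i, q)) x = (ratr q <= c i x).
Proof. by rewrite /bit /code (@pickleK (I * rat)%type). Qed.

Let measurable_bit k : measurable [set x | bit k x].
Proof.
rewrite /bit; case: (unpickle k) => [[i q]|]; last first.
  by rewrite (_ : mkset _ = set0)//; apply/seteqP; split.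
rewrite (_ : mkset _ = setT `&` c i @^-1` `[ratr q, +oo[); first exact: mc.
by rewrite setTI; apply/seteqP; split=> x /=; rewrite in_itv/= andbT.
Qed.

(* All the bits used at precision [1 / N] on the window [[-K, K[]. *)
Let grid_bound (K N : nat) : nat :=
  (\max_(z : I * 'I_(K * N).*2.+1)
    code (z.1, (z.2%:R - (K * N)%:R) / N%:R)).+1.

Let grid K N (j : nat) : rat := (j%:R - (K * N)%:R) / N%:R.

Let grid_lt K N i j : (j <= (K * N).*2)%N -> (code (i, grid K N j) < grid_bound K N)%N.
Proof.
move=> jKN; rewrite ltnS.
have jlt : (j < (K * N).*2.+1)%N by rewrite ltnS.
exact: (@leq_bigmax _ (fun z : I * 'I_(K * N).*2.+1 => code (z.1, grid K N z.2))
  (i, Ordinal jlt)).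
Qed.

Let gridE K N j : ratr (grid K N j) = (j%:R - (K * N)%:R) / N%:R :> R.
Proof. by rewrite fmorph_div/= rmorphB/= !ratr_nat. Qed.

Let grid0 K N : (0 < N)%N -> ratr (grid K N 0) = - K%:R :> R.
Proof. by move=> N0; rewrite gridE sub0r natrM mulNr mulfK// pnatr_eq0 -lt0n. Qed.

Let grid_last K N : (0 < N)%N -> ratr (grid K N (K * N).*2) = K%:R :> R.
Proof.
move=> N0; rewrite gridE -addnn natrD addrK natrM mulfK// pnatr_eq0 -lt0n//.
Qed.

Let grid_cell K N (v : R) : (0 < N)%N -> - K%:R <= v < K%:R ->
  exists2 j, (j < (K * N).*2)%N &
    ratr (grid K N j) <= v < ratr (grid K N j.+1).
Proof.
move=> N0 /andP[v1 v2]; have NR : 0 < N%:R :> R by rewrite ltr0n.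
pose j := Num.truncn ((v + K%:R) * N%:R).
have w0 : 0 <= (v + K%:R) * N%:R by apply: mulr_ge0; lra.
have /andP[j1 j2] := truncn_itv w0.
exists j.
  rewrite -(ltr_nat R); apply: le_lt_trans j1 _.
  rewrite -mul2n mulnA natrM ltr_pM2r// natrM; lra.
rewrite !gridE ler_pdivrMr// ltr_pdivlMr// natrM; rewrite -/j in j1 j2.
by apply/andP; split; lra.
Qed.

(** Inside a window, finitely many bits determine the coordinates up to [1 / N], both under [P n]
    and in the limit. So [T] of the coordinates is on both sides close to one and the same function
    of finitely many bits, whose integrals converge; tightness handles the complement of the
    window. *)
Lemma exists_limit_coordinates : exists dO (Om : measurableType dO)
    (Q : probability Om R) (Y : I -> Om -> R),
  [/\ forall i, measurable_fun setT (Y i),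
      forall i (e : R), 0 < e -> exists K : nat,
        fine (Q [set x | K%:R < `|Y i x|]) <= e &
      forall (T : (I -> R) -> R) (B L : R),
        (forall v, `|T v| <= B) ->
        (forall v w e, (forall i, `|v i - w i| <= e) -> `|T v - T w| <= L * e) ->
        measurable_fun setT (fun x => T (c^~ x)) ->
        measurable_fun setT (fun x => T (Y^~ x)) ->
        \int[P n]_x T (c^~ x) @[n --> U] --> \int[Q]_x T (Y^~ x)].
Proof.
have [dO [Om [Q [b' [mb' b'_sat b'_lim]]]]] := exists_limit_bits P UU measurable_bit.
pose beta i q w := b' (code (i, q)) w.
(* Finitely many bits of [w] are always those of some [y]. *)
have rep w m : exists y, forall k, (k < m)%N -> b' k w = bit k y.
  have [y ym] := b'_sat w m; exists y => k km.
  by have := congr1 (fun s => nth false s k) ym; rewrite !nth_mkseq.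
have mono i q q' w : q <= q' -> beta i q' w -> beta i q w.
  move=> qq'; have [y yb] := rep w (maxn (code (i, q)) (code (i, q'))).+1.
  rewrite /beta !yb ?bitE ?ltnS ?leq_maxl ?leq_maxr//.
  by apply: le_trans; rewrite ler_rat.
(* [Z] is the supremum of the rationals whose limit bit is 1. It is an extended real, since the bits
   of [w] may be all 1 or all 0; [Y] then takes the default value 0, at points that lie outside
   every window. *)
pose zc i k w : \bar R := if unpickle k is Some q then
  if beta i q w then (ratr q)%:E else -oo%E else -oo%E.
pose Z i w := esups (fun k => zc i k w) 0.
pose Y i w := fine (Z i w).
have Zge i q w : beta i q w -> ((ratr q)%:E <= Z i w)%E.
  move=> bq; apply: ereal_sup_ubound; exists (pickle q) => //=.
  by rewrite /zc pickleK bq.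
have Zle i q w : ~~ beta i q w -> (Z i w <= (ratr q)%:E)%E.
  move=> bq; apply: ge_ereal_sup => _ [k _ <-]; rewrite /zc.
  case: (unpickle k) => [q'|]; last exact: leNye.
  case: ifP => [bq'|]; last by rewrite leNye.
  rewrite lee_fin ler_rat leNgt; apply/negP => /ltW qq'.
  by move: bq; rewrite (mono _ _ _ _ qq').
(* One bit equal to 1 and one equal to 0 make [Z] finite. Both inequalities are weak because [Y = q]
   does not determine the limit bit of [q]. *)
have Yitv i q q' w : beta i q w -> ~~ beta i q' w ->
    ratr q <= Y i w <= ratr q'.
  move=> /Zge h1 /Zle h2; rewrite -!lee_fin fineK ?h1//.
  by rewrite fin_numE; apply/andP; split; apply/eqP => Zoo;
    rewrite Zoo in h1 h2; move: h1 h2; rewrite ?leeNy_eq ?leye_eq.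
have mY i : measurable_fun setT (Y i).
  apply: measurableT_comp => //; apply: measurable_fun_esups => k.
  rewrite /zc; case: (unpickle k) => [q|]; last exact: measurable_cst.
  apply: measurable_fun_ifT => //; apply: (@measurable_fun_bool _ _ _ _ true).
  by rewrite setTI; exact: mb'.
(* Detects, from the two bits at [-K] and [K], that coordinate [i] leaves [[-K, K[]. Since it reads
   finitely many bits, a bound on its expectation passes to the limit. *)
pose out K N i (s : seq bool) : R := (~~ nth false s (code (i, grid K N 0)) ||
  nth false s (code (i, grid K N (K * N).*2)))%:R.
have out_ge0 K N i s : 0 <= out K N i s by exact: ler0n.
have tight_out i e : 0 < e -> exists K0 : nat, forall K N, (K0 <= K)%N -> (0 < N)%N ->
    (\forall n \near U, \int[P n]_x out K N i (mkseq (bit^~ x) (grid_bound K N)) <= e) /\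
    \int[Q]_w out K N i (mkseq (b'^~ w) (grid_bound K N)) <= e.
  move=> e0; have [K0 PK0] := tight i e0; exists K0 => K N K0K N0.
  have near_e : \forall n \near U,
      \int[P n]_x out K N i (mkseq (bit^~ x) (grid_bound K N)) <= e.
    apply: filterS PK0 => n; apply: le_trans.
    have mS : measurable [set x | K0%:R <= `|c i x|].
      rewrite (_ : mkset _ = setT `&` (fun x => `|c i x|) @^-1` `[K0%:R, +oo[).
        by apply: (measurableT_comp (@normr_measurable R setT) (mc i)) => //; exact: measurable_itv.
      by rewrite setTI; apply/seteqP; split=> x /=; rewrite in_itv/= andbT.
    rewrite -Rintegral_indic_probability//; apply: bounded_le_Rintegral.
    - exact: bounded_measurable_mkseq.
    - exact: bounded_measurable_indic.
    move=> x; rewrite /out !nth_mkseq ?grid_lt//.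
    rewrite !bitE grid0// grid_last//.
    rewrite indicE; case: (boolP (x \in _)) => [_|]; first by rewrite lern1 leq_b1.
    rewrite notin_setE/= => /negP; rewrite -ltNge => cK.
    have {}cK : `|c i x| < K%:R by apply: lt_le_trans cK _; rewrite ler_nat.
    move: cK; rewrite ltr_norml => /andP[h1 h2].
    by rewrite (ltW h1) (leNgt K%:R) h2.
  split=> //; apply: cvgr_to_le (b'_lim _ (out K N i)) _; exact: near_e.
have outP K N i w : (0 < N)%N -> out K N i (mkseq (b'^~ w) (grid_bound K N)) = 0 ->
    beta i (grid K N 0) w /\ ~~ beta i (grid K N (K * N).*2) w.
  move=> N0; rewrite /out !nth_mkseq ?grid_lt//.
  by rewrite -/(beta _ _ _) -/(beta _ _ _); case: (beta _ _ _); case: (beta _ _ _) => //=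
    /eqP; rewrite oner_eq0.
exists dO, Om, Q, Y; split => //.
  move=> i e e0; have [K hK] := tight_out i e e0; exists K.
  have [_] := hK K 1%N (leqnn _) isT; apply: le_trans.
  have mS : measurable [set w | K%:R < `|Y i w|].
    rewrite (_ : mkset _ = setT `&` (fun x => `|Y i x|) @^-1` `]K%:R, +oo[).
      by apply: (measurableT_comp (@normr_measurable R setT) (mY i)) => //; exact: measurable_itv.
    by rewrite setTI; apply/seteqP; split=> x /=; rewrite in_itv/= andbT.
  rewrite -Rintegral_indic_probability//; apply: bounded_le_Rintegral.
  - exact: bounded_measurable_indic.
  - exact: bounded_measurable_mkseq.
  move=> w; rewrite indicE; case: (boolP (w \in _)) => [|_]; last exact: out_ge0.
  rewrite inE/= => YK; rewrite leNgt; apply/negP => out1.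
  have out0 : out K 1%N i (mkseq (b'^~ w) (grid_bound K 1)) = 0.
    by move: out1; rewrite /out; case: (_ || _) => //=; rewrite ltxx.
  (* Inside the window only the weak bound [|Y i w| <= K] is available, hence the strict inequality
     in the tightness of [Y]. *)
  have [h1 h2] := outP K 1%N i w isT out0.
  have := Yitv _ _ _ _ h1 h2; rewrite grid0// grid_last// -ler_norml.
  by rewrite leNgt YK.
move=> T B L TB TL mTc mTY.
have B0 : 0 <= B by exact: le_trans (TB (fun=> 0)).
have L0 : 0 <= L.
  by have := TL (fun=> 0) (fun=> 0) 1; rewrite !subrr normr0 mulr1; apply.
(* A sample point with bit word [s], at which [F] evaluates [T]; the default [point] is returned
   only for words that nothing realises. *)
pose rp m (s : seq bool) : X := xget point [set y | mkseq (bit^~ y) m = s].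
pose F m s := T (c^~ (rp m s)).
(* The Lipschitz error for mesh [1 / N], plus the trivial bound [2 B] counted once for each
   coordinate outside the window. *)
pose H K N s := L * N%:R^-1 + 2 * B * \sum_i out K N i s.
have H_ge K N v s y : F (grid_bound K N) s = T (c^~ y) ->
    (forall i, out K N i s = 0 -> `|v i - c i y| <= N%:R^-1) ->
    `|T v - F (grid_bound K N) s| <= H K N s.
  move=> -> vy; have [/existsP[i /eqP oi]|/existsPn oN] :=
      boolP [exists i, out K N i s == 1].
    apply: (@le_trans _ _ (2 * B)).
      by apply: le_trans (ler_normB _ _) _; have := TB v; have := TB (c^~ y); lra.
    rewrite /H -[leLHS]add0r; apply: lerD; first by rewrite mulr_ge0// invr_ge0.
    rewrite -[leLHS]mulr1 ler_wpM2l ?mulr_ge0// (bigD1 i)//= oi lerDl.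
    by apply: sumr_ge0.
  apply: (@le_trans _ _ (L * N%:R^-1)).
    apply: TL => i; apply: vy; have := oN i; rewrite /out.
    by case: (_ || _) => //; rewrite eqxx.
  rewrite lerDl !mulr_ge0//.
  by apply: sumr_ge0.
(* The grid points around [v] also enclose [u], weakly, so that both lie in one closed cell of
   length [1 / N]. *)
have cell K N (u v : R) : (0 < N)%N -> - K%:R <= v < K%:R ->
    (forall j, (j <= (K * N).*2)%N -> ratr (grid K N j) <= v ->
       ratr (grid K N j) <= u) ->
    (forall j, (j <= (K * N).*2)%N -> v < ratr (grid K N j) ->
       u <= ratr (grid K N j)) -> `|u - v| <= N%:R^-1.
  move=> N0 vK h1 h2; have [j jK /andP[j1 j2]] := grid_cell N0 vK.
  have := h1 j (ltnW jK) j1; have := h2 j.+1 jK j2.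
  have NR : 0 < N%:R :> R by rewrite ltr0n.
  have : ratr (grid K N j.+1) = ratr (grid K N j) + N%:R^-1 :> R.
    by rewrite !gridE -natr1; ring.
  by move=> E h3 h4; rewrite ler_norml; lra.
have rpP K N s y0 : mkseq (bit^~ y0) (grid_bound K N) = s ->
    forall k, (k < grid_bound K N)%N ->
    bit k (rp (grid_bound K N) s) = nth false s k.
  move=> y0s k km; have E : mkseq (bit^~ (rp (grid_bound K N) s)) (grid_bound K N) = s.
    by apply: (@xgetPex _ point [set y | mkseq (bit^~ y) (grid_bound K N) = s]); exists y0.
  by rewrite -[in RHS]E nth_mkseq.
have close_c K N x : (0 < N)%N -> forall s, s = mkseq (bit^~ x) (grid_bound K N) ->
    `|T (c^~ x) - F (grid_bound K N) s| <= H K N s.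
  move=> N0 s es; have sE := rpP K N s x (esym es).
  apply: H_ge => // i; rewrite /out -!sE ?grid_lt// !bitE grid0// grid_last//.
  set y := rp _ s => oy.
  apply: (cell K N) => //.
  - by move: oy => /eqP; rewrite pnatr_eq0 eqb0 negb_or negbK -ltNge.
  - by move=> j jK; rewrite -!bitE sE ?grid_lt// es nth_mkseq ?grid_lt.
  - move=> j jK; rewrite !ltNge -bitE sE ?grid_lt// es nth_mkseq ?grid_lt// bitE.
    by rewrite -ltNge => /ltW.
have close_Y K N w : (0 < N)%N -> forall s, s = mkseq (b'^~ w) (grid_bound K N) ->
    `|T (Y^~ w) - F (grid_bound K N) s| <= H K N s.
  move=> N0 s es; have [y0 y0w] := b'_sat w (grid_bound K N).
  have sE := rpP K N s y0 (etrans y0w (esym es)).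
  have betaE i j : (j <= (K * N).*2)%N ->
      beta i (grid K N j) w = (ratr (grid K N j) <= c i (rp (grid_bound K N) s)).
    by move=> jK; rewrite -bitE sE ?grid_lt// es nth_mkseq ?grid_lt.
  apply: H_ge => // i; rewrite {1}es => /(outP _ _ _ _ N0)[lo hi].
  apply: (cell K N) => //.
  - by move: lo hi; rewrite !betaE// grid0// grid_last// -ltNge => -> ->.
  - by move=> j jK; rewrite -betaE// => bj; have /andP[] := Yitv _ _ _ _ bj hi.
  - by move=> j jK; rewrite ltNge -betaE// => bj; have /andP[] := Yitv _ _ _ _ lo bj.
apply/cvgrPdist_le => eps eps0.
(* With this [e] the window term of [H] integrates to at most [eps / 6], as does the mesh term.
   Replacing [T] by [F] costs [eps / 3] on each side, and the last third goes to the convergence of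
   the integrals of [F]. *)
pose e := eps / 6 / (2 * B + 1) / #|I|.+1%:R.
have I0 : 0 < #|I|.+1%:R :> R by rewrite ltr0n.
have e0 : 0 < e by rewrite !divr_gt0//; lra.
have eB : 2 * B * (#|I|%:R * e) <= eps / 6.
  have -> : eps / 6 = (2 * B + 1) * (#|I|.+1%:R * e).
    by rewrite /e; field; rewrite !gt_eqF//; lra.
  apply: ler_pM; [lra|by rewrite mulr_ge0// ltW|lra|].
  by rewrite ler_pM2r// ler_nat.
pose N := (Num.truncn (L / (eps / 6))).+1.
have LN : L * N%:R^-1 <= eps / 6.
  rewrite ler_pdivrMr ?ltr0n// mulrC -ler_pdivrMr; last lra.
  exact/ltW/truncnS_gt.
have /choice[K0 K0P] := fun i => tight_out i e e0.
pose K := \max_i K0 i.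
have {}K0P i := K0P i K N (leq_bigmax i) isT.
have bF n : bounded_measurable (fun x => F (grid_bound K N) (mkseq (bit^~ x) n)).
  exact: bounded_measurable_mkseq.
have bF' n : bounded_measurable (fun x => F (grid_bound K N) (mkseq (b'^~ x) n)).
  exact: bounded_measurable_mkseq.
have bH n : bounded_measurable (fun x => H K N (mkseq (bit^~ x) n)).
  exact: bounded_measurable_mkseq.
have bH' n : bounded_measurable (fun x => H K N (mkseq (b'^~ x) n)).
  exact: bounded_measurable_mkseq.
have bTc : bounded_measurable (fun x => T (c^~ x)) by split=> //; exists B.
have bTY : bounded_measurable (fun x => T (Y^~ x)) by split=> //; exists B.
have intH d' (X' : measurableType d') (P' : probability X' R) (b1 : nat -> X' -> bool) :
    (forall j, measurable [set x | b1 j x]) ->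
    (forall i, \int[P']_x out K N i (mkseq (b1^~ x) (grid_bound K N)) <= e) ->
    \int[P']_x H K N (mkseq (b1^~ x) (grid_bound K N)) <= eps / 3.
  move=> mb1 o1; have bo i : bounded_measurable
    (fun x => out K N i (mkseq (b1^~ x) (grid_bound K N))) by exact: bounded_measurable_mkseq.
  rewrite bounded_RintegralD; [|exact: bounded_measurable_cst|]; last first.
    apply: bounded_measurableM; first exact: bounded_measurable_cst.
    exact: bounded_measurable_sum.
  rewrite Rintegral_probability_cst bounded_RintegralZl; last exact: bounded_measurable_sum.
  rewrite bounded_Rintegral_sum//.
  have : \sum_i \int[P']_x out K N i (mkseq (b1^~ x) (grid_bound K N)) <= #|I|%:R * e.
    by rewrite mulr_natl -sumr_const; exact: ler_sum.
  by move=> /(ler_wpM2l (_ : 0 <= 2 * B)); move=> /(_ ltac:(lra)); lra.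
have HQ := intH _ _ Q b' mb' (fun i => (K0P i).2).
have : \forall n \near U, forall i,
    \int[P n]_x out K N i (mkseq (bit^~ x) (grid_bound K N)) <= e.
  by apply: filter_forall => i; exact: (K0P i).1.
have /cvgrPdist_le/(_ (eps / 3) ltac:(lra)) := b'_lim (grid_bound K N) (F (grid_bound K N)).
apply: filterS2 => n h1 h2; have HP := intH _ _ (P n) bit measurable_bit h2.
have hP : `|\int[P n]_x T (c^~ x) -
      \int[P n]_x F (grid_bound K N) (mkseq (bit^~ x) (grid_bound K N))| <= eps / 3.
  apply: le_trans HP; rewrite -bounded_RintegralB//; apply: Rintegral_normr_le => //.
    exact: bounded_measurableB.
  by move=> x; exact: (@close_c K N x isT _ erefl).
have hQ : `|\int[Q]_x T (Y^~ x) -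
      \int[Q]_x F (grid_bound K N) (mkseq (b'^~ x) (grid_bound K N))| <= eps / 3.
  apply: le_trans HQ; rewrite -bounded_RintegralB//; apply: Rintegral_normr_le => //.
    exact: bounded_measurableB.
  by move=> x; exact: (@close_Y K N x isT _ erefl).
by move: h1 hP hQ; rewrite !ler_norml; lra.
Qed.

End limit_coordinates.

(** * Stone-Weierstrass for trigonometric polynomials *)

(** The sets [B] for which the part of [K] outside [B] is good form a filter. If [K] were not good
    this filter would be proper, and a good neighbourhood of a cluster point would contradict
    clustering. *)
Lemma compact_induction (X : topologicalType) (K : set X) (good : set X -> Prop) :
  compact K -> good set0 -> (forall S S', good S -> good S' -> good (S `|` S')) ->
  (forall S S', S `<=` S' -> good S' -> good S) ->
  (forall p, K p -> exists2 V, nbhs p V & good V) -> good K.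
Proof.
move=> cK good0 goodU goodS goodl; apply: contrapT => nK.
pose F : set_system X := [set B | good (K `\` B)].
have FF : ProperFilter F.
  apply: Build_ProperFilter; first by rewrite /F/= setD0.
  split; first by rewrite /F/= setDT.
    by move=> B C; rewrite /F/= setDIr; exact: goodU.
  by move=> B C BC; apply: goodS; exact: setDS.
have [|p [Kp pF]] := cK F FF; first by rewrite /F/= setDv.
have [V pV gV] := goodl p Kp.
have FnV : F (~` V) by apply: goodS gV; rewrite setDE setCK; exact: subIsetr.
by have [x [nVx Vx]] := pF _ _ FnV pV.
Qed.

Section stone_weierstrass.
Context {R : realType} (X : ptopologicalType) (A : (X -> R) -> Prop).
Hypothesis A_cst : forall a, A (fun=> a).
Hypothesis A_add : forall g h, A g -> A h -> A (fun x => g x + h x).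
Hypothesis A_mul : forall g h, A g -> A h -> A (fun x => g x * h x).
Hypothesis A_bounded : forall g, A g -> exists B, forall x, `|g x| <= B.
Hypothesis A_closed : forall g,
  (forall e, 0 < e -> exists2 h, A h & forall x, `|g x - h x| <= e) -> A g.
Hypothesis A_continuous : forall g, A g -> continuous g.

Let A_scale a g : A g -> A (fun x => a * g x).
Proof. by move=> Ag; exact: (A_mul (A_cst a) Ag). Qed.

(** The classical iteration for the square root of [t^2], increasing to [|t|] on [-1, 1]; it yields
    absolute values, hence lattice operations, inside a closed algebra. *)
Fixpoint abs_poly n (t : R) : R :=
  if n is n'.+1 then abs_poly n' t + (t ^+ 2 - abs_poly n' t ^+ 2) / 2 else 0.

Lemma abs_poly_bounds n t : `|t| <= 1 ->
  [/\ 0 <= abs_poly n t, abs_poly n t <= `|t| &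
      (`|t| - abs_poly n t) * n.+1%:R <= 2].
Proof.
move=> t1; have t0 := normr_ge0 t.
have t2 : t ^+ 2 = `|t| ^+ 2 by rewrite real_normK ?num_real.
elim: n => [|n [p0 pt pn]] /=; first by split=> //; lra.
rewrite t2; move: (abs_poly n t) p0 pt pn => p p0 pt pn.
split; [nra|nra|].
(* The gap [D = |t| - p] becomes [D (1 - (|t| + p)/2)], at most [D (1 - D/2)]. From [D k <= 2]
   follows [D (1 - D/2)(k + 1) <= (1 - D/2)(2 + D) <= 2]. *)
have -> : `|t| - (p + (`|t| ^+ 2 - p ^+ 2) / 2) =
    (`|t| - p) * (1 - (`|t| + p) / 2) by field.
have n0 : 0 <= n.+1%:R :> R by [].
have -> : n.+2%:R = n.+1%:R + 1 :> R by rewrite natr1.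
move: (n.+1%:R : R) n0 pn => k k0 pn.
have D0 : 0 <= `|t| - p by lra.
have h1 : (`|t| - p) * (1 - (`|t| + p) / 2) <= (`|t| - p) * (1 - (`|t| - p) / 2).
  by rewrite ler_wpM2l//; lra.
have D1 : `|t| - p <= 1 by lra.
move: (`|t| - p) D0 pn h1 D1 => D D0 pn h1 D1.
apply: (@le_trans _ _ (D * (1 - D / 2) * (k + 1))); first by rewrite ler_wpM2r//; lra.
have -> : D * (1 - D / 2) * (k + 1) = (1 - D / 2) * (D * k + D) by ring.
apply: (@le_trans _ _ ((1 - D / 2) * (2 + D))); last nra.
by rewrite ler_wpM2l//; lra.
Qed.

Let A_abs g : A g -> A (fun x => `|g x|).
Proof.
move=> Ag; have [B0 gB0] := A_bounded Ag; pose B := `|B0| + 1.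
have B_gt0 : 0 < B by rewrite /B; have := normr_ge0 B0; lra.
have gB x : `|g x / B| <= 1.
  rewrite normrM normfV (gtr0_norm B_gt0) ler_pdivrMr// mul1r /B.
  by have := gB0 x; have := ler_norm B0; lra.
have Ap n : A (fun x => abs_poly n (g x / B)).
  have AgB : A (fun x => g x / B) by under eq_fun do rewrite mulrC; exact: A_scale.
  elim: n => [|n ih] /=; first exact: A_cst.
  apply: A_add => //; under eq_fun do rewrite mulrC; apply: A_scale.
  under eq_fun do rewrite -mulN1r !expr2.
  by apply: A_add; [exact: A_mul|apply: A_scale; exact: A_mul].
apply: A_closed => e e0; pose n := Num.truncn (B * 2 / e).
exists (fun x => B * abs_poly n (g x / B)); first exact: A_scale.
move=> x; have [p0 pt pn] := abs_poly_bounds n (gB x).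
have -> : `|g x| = B * `|g x / B|.
  by rewrite normrM normfV (gtr0_norm B_gt0) mulrC divfK// gt_eqF.
rewrite -mulrBr normrM (gtr0_norm B_gt0) ger0_norm ?subr_ge0//.
have nB : B * 2 < e * n.+1%:R by rewrite [ltRHS]mulrC -ltr_pdivrMr// truncnS_gt.
have n0 : 0 < n.+1%:R :> R by rewrite ltr0n.
rewrite -(ler_pM2r n0); apply: le_trans (ltW nB); rewrite -mulrA.
by rewrite ler_pM2l.
Qed.

Let A_max g h : A g -> A h -> A (fun x => Num.max (g x) (h x)).
Proof.
move=> Ag Ah; under eq_fun do rewrite maxr_absE mulrC.
apply: A_scale; apply: (A_add (g := fun x => g x + h x)); first exact: A_add.
apply: A_abs; under eq_fun do rewrite -mulN1r.
by apply: A_add => //; exact: A_scale.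
Qed.

Let A_min g h : A g -> A h -> A (fun x => Num.min (g x) (h x)).
Proof.
move=> Ag Ah; under eq_fun do rewrite minr_absE mulrC -mulN1r.
apply: A_scale; apply: (A_add (g := fun x => g x + h x)); first exact: A_add.
apply: A_scale; apply: A_abs; under eq_fun do rewrite -mulN1r.
by apply: A_add => //; exact: A_scale.
Qed.

Variables (K : set X) (f : X -> R).
Hypothesis cK : compact K.
Hypothesis cf : continuous f.
Hypothesis A_interpolates : forall x y, exists g, [/\ A g, g x = f x & g y = f y].

Let near_gt g p e : continuous g -> f p - e < g p ->
  \forall z \near p, f z - e < g z.
Proof.
move=> cg fg; have h : (fun z => g z - f z) z @[z --> p] --> g p - f p.
  by apply: cvgB; [exact: cg|exact: cf].
have /(cvgr_gt _ h) : - e < g p - f p by lra.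
by apply: filterS => z /=; lra.
Qed.

Let near_lt g p e : continuous g -> g p < f p + e ->
  \forall z \near p, g z < f z + e.
Proof.
move=> cg fg; have h : (fun z => g z - f z) z @[z --> p] --> g p - f p.
  by apply: cvgB; [exact: cg|exact: cf].
have /(cvgr_lt _ h) : g p - f p < e by lra.
by apply: filterS => z /=; lra.
Qed.

(** A function interpolating [f] at [x] and [p] exceeds [f - e] near [p]. By compactness a maximum
    of finitely many of them does so on [K], and the value at [x] is kept. *)
Let one_sided e x : 0 < e ->
  exists h, [/\ A h, h x = f x & forall z, K z -> f z - e < h z].
Proof.
move=> e0; apply: (compact_induction (good := fun S : set X =>
  exists h, [/\ A h, h x = f x & forall z, S z -> f z - e < h z])) => //.
- by exists (fun=> f x); split.
- move=> S S' [g [Ag gx gS]] [h [Ah hx hS]]; exists (fun z => Num.max (g z) (h z)).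
  split; [exact: A_max|by rewrite gx hx maxxx|move=> z [Sz|Sz]].
    by rewrite lt_max gS.
  by rewrite lt_max hS ?orbT.
- by move=> S S' SS' [g [Ag gx gS]]; exists g; split=> // z /SS'; exact: gS.
- move=> p Kp; have [g [Ag gx gp]] := A_interpolates x p.
  exists [set z | f z - e < g z]; last by exists g.
  by apply: near_gt; [exact: A_continuous|rewrite gp; lra].
Qed.

(** Dual to [one_sided]: the function attached to [p] stays below [f + e] near [p], and a finite
    minimum keeps the lower bound on [K]. *)
Lemma stone_weierstrass e : 0 < e ->
  exists2 g, A g & forall z, K z -> `|f z - g z| <= e.
Proof.
move=> e0; suff [g [Ag gl gu]] : exists h, [/\ A h, forall z, K z -> f z - e < h z &
    forall z, K z -> h z < f z + e].
  exists g => // z Kz; have := gl z Kz; have := gu z Kz.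
  by rewrite ler_norml; lra.
apply: (compact_induction (good := fun S : set X => exists h,
  [/\ A h, forall z, K z -> f z - e < h z & forall z, S z -> h z < f z + e])) => //.
- by have [h [Ah _ hK]] := one_sided point e0; exists h; split.
- move=> S S' [g [Ag gl gS]] [h [Ah hl hS]]; exists (fun z => Num.min (g z) (h z)).
  split; [exact: A_min|by move=> z Kz; rewrite lt_min gl ?hl|move=> z [Sz|Sz]].
    by rewrite gt_min gS.
  by rewrite gt_min hS ?orbT.
- by move=> S S' SS' [g [Ag gl gS]]; exists g; split=> // z /SS'; exact: gS.
- move=> p Kp; have [h [Ah hp hK]] := one_sided p e0.
  exists [set z | h z < f z + e]; last by exists h.
  by apply: near_lt; [exact: A_continuous|rewrite hp; lra].
Qed.

(* Clamping keeps the approximation on [K] and adds a global bound. *)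
Lemma stone_weierstrass_bounded B e : 0 < e -> (forall z, `|f z| <= B) ->
  exists g, [/\ A g, forall z, `|g z| <= B & forall z, K z -> `|f z - g z| <= e].
Proof.
move=> e0 fB; have [g Ag gf] := stone_weierstrass e0.
exists (fun z => Num.max (- B) (Num.min B (g z))); split.
- exact/(A_max (A_cst _))/(A_min (A_cst _)).
- move=> z; have := fB z; rewrite !ler_norml => /andP[h1 h2].
  by rewrite le_max lexx ge_max ge_min lexx/= andbT; lra.
- move=> z Kz; have := gf z Kz; have := fB z; rewrite !ler_norml => /andP[h1 h2] /andP[h3 h4].
  have [h5|h5] := leP B (g z).
    by rewrite (max_idPr _); lra.
  by have [h6|h6] := leP (- B) (g z); lra.
Qed.

End stone_weierstrass.

(** * Density of the span of cosines on compact sets *)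

Section cos_span.
Context {R : realType} (X : ptopologicalType) (Phi : (X -> R) -> Prop).

(** Cosines suffice: when [Phi] contains the constants and is stable under sums, phase shifts give
    the sines, and the product-to-sum formula makes the span an algebra. *)
Inductive cos_span : (X -> R) -> Prop :=
| cos_span0 : cos_span (fun=> 0)
| cos_spanS a phi g : Phi phi -> cos_span g ->
    cos_span (fun x => a * cos (phi x) + g x).

Definition cos_span_closure (g : X -> R) :=
  forall e, 0 < e -> exists2 h, cos_span h & forall x, `|g x - h x| <= e.

Hypothesis Phi_cst : forall a, Phi (fun=> a).
Hypothesis Phi_add : forall g h, Phi g -> Phi h -> Phi (fun x => g x + h x).
Hypothesis Phi_opp : forall g, Phi g -> Phi (fun x => - g x).
Hypothesis Phi_continuous : forall g, Phi g -> continuous g.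
Hypothesis Phi_separates : forall x y, x != y ->
  exists phi, [/\ Phi phi, phi x = 0 & phi y = 1].

Lemma cos_span_add g h : cos_span g -> cos_span h -> cos_span (fun x => g x + h x).
Proof.
move=> sg sh; elim: sg => [|a phi {}g Pphi _ ih].
  by under eq_fun do rewrite add0r.
by under eq_fun do rewrite -addrA; exact: cos_spanS.
Qed.

Lemma cos_span_cos a phi : Phi phi -> cos_span (fun x => a * cos (phi x)).
Proof.
move=> Pphi; rewrite (_ : (fun _ => _) = (fun x => a * cos (phi x) + (fun=> 0) x)).
  by apply: cos_spanS => //; exact: cos_span0.
by apply/funext => x; rewrite addr0.
Qed.

Lemma cos_span_mul g h : cos_span g -> cos_span h -> cos_span (fun x => g x * h x).
Proof.
move=> sg sh; elim: sg => [|a phi {}g Pphi _ ih].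
  by under eq_fun do rewrite mul0r; exact: cos_span0.
under eq_fun do rewrite mulrDl; apply: cos_span_add => //.
elim: sh => [|b chi {ih}h Pchi _ ih].
  by under eq_fun do rewrite mulr0; exact: cos_span0.
under eq_fun do rewrite mulrDr; apply: cos_span_add => //.
rewrite (_ : (fun _ => _) = (fun x => a * b / 2 * cos (phi x + chi x) +
    a * b / 2 * cos (phi x + - chi x))).
  by apply: cos_span_add; apply: cos_span_cos; apply: Phi_add => //; exact: Phi_opp.
by apply/funext => x; rewrite cosB cosD; field.
Qed.

Lemma cos_span_bounded g : cos_span g -> exists B, forall x, `|g x| <= B.
Proof.
elim=> [|a phi {}g _ _ [B gB]]; first by exists 0 => x; rewrite normr0.
exists (`|a| + B) => x; apply: le_trans (ler_normD _ _) _; apply: lerD => //.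
by rewrite normrM ler_piMr// ler_norml cos_le1 cos_geN1.
Qed.

Lemma cos_span_continuous g : cos_span g -> continuous g.
Proof.
elim=> [|a phi {}g Pphi _ cg] x; first exact: cst_continuous.
apply: cvgD; last exact: cg.
apply: cvgMl_tmp; apply: continuous_comp; first exact: Phi_continuous.
exact: continuous_cos.
Qed.

Let A := cos_span_closure.

Let cos_span_A g : cos_span g -> A g.
Proof. by move=> sg e e0; exists g => // x; rewrite subrr normr0 ltW. Qed.

Let A_cst a : A (fun=> a).
Proof.
apply: cos_span_A; have := cos_span_cos a (Phi_cst 0).
by under eq_fun do rewrite cos0 mulr1.
Qed.

Let A_add g h : A g -> A h -> A (fun x => g x + h x).
Proof.
move=> Ag Ah e e0; have [g' sg gg'] := Ag (e / 2) ltac:(lra).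
have [h' sh hh'] := Ah (e / 2) ltac:(lra).
exists (fun x => g' x + h' x); first exact: cos_span_add.
move=> x; rewrite opprD addrACA; apply: le_trans (ler_normD _ _) _.
by have := gg' x; have := hh' x; lra.
Qed.

Let A_bounded g : A g -> exists B, forall x, `|g x| <= B.
Proof.
move=> /(_ 1 ltr01)[h /cos_span_bounded[B hB] gh]; exists (1 + B) => x.
rewrite -[g x](subrK (h x)); apply: le_trans (ler_normD _ _) _.
by have := gh x; have := hB x; lra.
Qed.

Let A_mul g h : A g -> A h -> A (fun x => g x * h x).
Proof.
move=> Ag Ah e e0; have [B hB] := A_bounded Ah.
have B1 : 0 < `|B| + 1 by have := normr_ge0 B; lra.
have [g' sg gg'] := Ag (e / 2 / (`|B| + 1)) ltac:(by rewrite !divr_gt0).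
have [C gC] := cos_span_bounded sg.
have C1 : 0 < `|C| + 1 by have := normr_ge0 C; lra.
have [h' sh hh'] := Ah (e / 2 / (`|C| + 1)) ltac:(by rewrite !divr_gt0).
exists (fun x => g' x * h' x); first exact: cos_span_mul.
move=> x; have -> : g x * h x - g' x * h' x = (g x - g' x) * h x + g' x * (h x - h' x).
  by ring.
apply: le_trans (ler_normD _ _) _; rewrite !normrM.
have h1 : `|g x - g' x| * `|h x| <= e / 2.
  apply: (@le_trans _ _ (e / 2 / (`|B| + 1) * (`|B| + 1))); last by rewrite divfK// gt_eqF.
  by apply: ler_pM => //; have := hB x; have := ler_norm B; lra.
have h2 : `|g' x| * `|h x - h' x| <= e / 2.
  apply: (@le_trans _ _ ((`|C| + 1) * (e / 2 / (`|C| + 1)))); last by rewrite mulrC divfK// gt_eqF.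
  by apply: ler_pM => //; have := gC x; have := ler_norm C; lra.
lra.
Qed.

Let A_closed g :
  (forall e, 0 < e -> exists2 h, A h & forall x, `|g x - h x| <= e) -> A g.
Proof.
move=> Ag e e0; have [h Ah gh] := Ag (e / 2) ltac:(lra).
have [h' sh hh'] := Ah (e / 2) ltac:(lra); exists h' => // x.
rewrite -(subrKA (h x)); apply: le_trans (ler_normD _ _) _.
by have := gh x; have := hh' x; lra.
Qed.

Let A_continuous g : A g -> continuous g.
Proof.
move=> Ag x; apply/cvgrPdist_le => e e0.
have [h sh gh] := Ag (e / 3) ltac:(lra).
have /cvgrPdist_le/(_ (e / 3) ltac:(lra)) := cos_span_continuous sh (x := x).
apply: filterS => y hxy; have := gh x; have := gh y; move: hxy.
by rewrite !ler_norml; lra.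
Qed.

(** Half of [e] is spent on Stone-Weierstrass in the uniform closure, half on coming back from the
    closure to the span; hence the global bound [B + e]. *)
Lemma cos_span_dense (K : set X) (f : X -> R) (B e : R) : compact K ->
  continuous f -> (forall z, `|f z| <= B) -> 0 < e ->
  exists g, [/\ cos_span g, forall z, `|g z| <= B + e &
    forall z, K z -> `|f z - g z| <= e].
Proof.
move=> cK cf fB e0.
have [x y||g [Ag gB gf]] := stone_weierstrass_bounded A_cst A_add A_mul A_bounded
    A_closed A_continuous cK cf _ (_ : 0 < e / 2) fB.
- have [->|xy] := eqVneq x y; first by exists (fun=> f y); split.
  have [phi [Pphi phix phiy]] := Phi_separates xy.
  (* [cos (phi z)] is 1 at [x] and [cos 1] at [y], distinct since [sin 1 > 0]; an affine function of
     it therefore interpolates [f] at both points. *)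
  have c1 : cos 1 - 1 != 0 :> R.
    rewrite subr_eq0 lt_eqF//; have := cos2Dsin2 (1 : R).
    have : 0 < sin 1 :> R by apply: sin2_gt0; lra.
    by have := cos_le1 (1 : R); nra.
  exists (fun z => (f x - (f y - f x) / (cos 1 - 1)) +
    (f y - f x) / (cos 1 - 1) * cos (phi z)); split.
  + by apply: A_add => //; apply: cos_span_A; exact: cos_span_cos.
  + by rewrite phix cos0; field.
  + by rewrite phiy; field.
- lra.
- have [h sh gh] := Ag (e / 2) ltac:(lra); exists h; split=> // z.
    by have := gh z; have := gB z; rewrite !ler_norml; lra.
  by move=> /gf; have := gh z; rewrite !ler_norml; lra.
Qed.

End cos_span.

(** * Tightness from characteristic functions *)

Lemma bounded_cvg_Rintegral {R : realType} d (T : measurableType d)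
    (P : probability T R) (f_ : nat -> T -> R) (f : T -> R) (M : R) :
  (forall n, measurable_fun setT (f_ n)) -> (forall n x, `|f_ n x| <= M) ->
  (forall x, f_ n x @[n --> \oo] --> f x) ->
  bounded_measurable f /\ \int[P]_x f_ n x @[n --> \oo] --> \int[P]_x f x.
Proof.
move=> mf_ fM f_f; have mf : measurable_fun setT f.
  by apply: (measurable_fun_cvg mf_) => x _; exact: f_f.
have bf : bounded_measurable f.
  split=> //; exists M => x; apply: cvgr_to_le (cvg_norm (f_f x)) _.
  exact: nearW.
split=> //; have [] := @dominated_convergence _ _ _ P setT measurableT
  (fun n => EFin \o f_ n) (EFin \o f) (cst M%:E).
- by move=> n; exact/measurable_EFinP.
- exact/measurable_EFinP.
- by apply: aeW => x _; apply: cvg_EFin; [exact: nearW|exact: f_f].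
- exact: (bounded_measurable_integrable P (bounded_measurable_cst T M)).
- by apply: aeW => x n _; rewrite lee_fin.
move=> intf _ h; rewrite /Rintegral; apply: fine_cvg.
by rewrite fineK//; exact: integrable_fin_num.
Qed.

Section tightness_from_characteristic_function.
Context {R : realType}.

Lemma integral_one_sub_cos (y : R) : y != 0 ->
  \int[uniform_prob (@ltr01 R)]_t (1 - cos (t * y)) = 1 - sin y / y.
Proof.
move=> y0; rewrite /Rintegral integral_uniform; last 2 first.
- apply/measurable_EFinP/measurable_funB => //.
  apply: continuous_measurable_fun => t; apply: continuous_comp.
    exact: mulrr_continuous.
  exact: continuous_cos.
- by move=> t; rewrite lee_fin subr_ge0 cos_le1.
rewrite subr0 invr1 mul1e.
pose F t := t - sin (t * y) / y.
have dF (t : R) : is_derive t (1 : R) F (1 - cos (t * y)).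
  have dy : is_derive t (1 : R) (fun s : R => s * y) y.
    by apply: is_derive_eq; rewrite scaler0 add0r /GRing.scale/= mulr1.
  have ds : is_derive t (1 : R) (fun s : R => sin (s * y)) (cos (t * y) * y).
    exact: (@is_derive1_comp _ sin (fun s : R => s * y)).
  rewrite /F; apply: is_derive_eq.
  by rewrite scaler0 add0r /GRing.scale/= mulrCA mulVf// mulr1.
have cF : continuous F by move=> t; exact/differentiable_continuous/derivable1_diffP/ex_derive.
rewrite (@continuous_FTC2 _ _ F)//.
- by rewrite /F mul0r sin0 mul1r mul0r subr0 -EFinB subr0.
- apply: continuous_subspaceT => t; apply: cvgB; first exact: cvg_cst.
  by apply: continuous_comp; [exact: mulrr_continuous|exact: continuous_cos].
- split; first by move=> t _; exact: ex_derive.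
  + by apply: cvg_at_right_filter; exact: cF.
  + by apply: cvg_at_left_filter; exact: cF.
- by move=> t _; rewrite derive1E; exact: derive_val.
Qed.

(** Truncation inequality: the mean over [t] in [0, 1] of [1 - cos(t y)] is [1 - sin y / y], at
    least 1/2 once [|y| >= 2]. Taken at [y = delta * c x] and integrated, it bounds half the tail by
    a mean of [1 - phi] near 0, up to an error that tends to 0. *)
Lemma tight_of_characteristic_cvg d (X : measurableType d)
    (P : nat -> probability X R) (c : X -> R) (phi : R -> R) :
  measurable_fun setT c ->
  (forall t, \int[P n]_x cos (t * c x) @[n --> \oo] --> phi t) ->
  (forall e, 0 < e -> exists2 delta, 0 < delta &
    forall t, `|t| <= delta -> 1 - phi t <= e) ->
  forall e : R, 0 < e -> exists K : nat,
    \forall n \near \oo, fine (P n [set x | K%:R <= `|c x|]) <= e.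
Proof.
move=> mc Pphi phi0 e e0; have [delta d0 phid] := phi0 (e / 4) ltac:(lra).
(* Makes [|delta * c x| >= 2] on the event [|c x| >= K]. *)
pose K := (Num.truncn (2 / delta)).+1.
have K2 : 2 <= delta * K%:R.
  by rewrite mulrC -ler_pdivrMr//; exact/ltW/truncnS_gt.
pose lambda : probability (measurableTypeR R) R := uniform_prob (@ltr01 R).
have mS : measurable [set x | K%:R <= `|c x|].
  rewrite (_ : mkset _ = setT `&` (fun x => `|c x|) @^-1` `[K%:R, +oo[).
    by apply: (measurableT_comp (@normr_measurable R setT) mc) => //; exact: measurable_itv.
  by rewrite setTI; apply/seteqP; split=> x /=; rewrite in_itv/= andbT.
pose f (z : X * measurableTypeR R) := 1 - cos (z.2 * (delta * c z.1)).
have bf : bounded_measurable f.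
  apply: bounded_measurableB; first exact: bounded_measurable_cst.
  apply: bounded_measurable_cos; apply: measurable_funM; first exact: measurable_snd.
  by apply: measurable_funM => //; exact: measurableT_comp mc measurable_fst.
have le_f n : fine (P n [set x | K%:R <= `|c x|]) / 2 <=
    \int[lambda]_t \int[P n]_x f (x, t).
  rewrite -(Rintegral_prod21 _ _ bf) (Rintegral_prod12 _ _ bf) mulrC.
  rewrite -Rintegral_indic_probability// -bounded_RintegralZl; last first.
    exact: bounded_measurable_indic.
  apply: bounded_le_Rintegral.
  - apply: bounded_measurableM; first exact: bounded_measurable_cst.
    exact: bounded_measurable_indic.
  - exact: (bounded_measurable_Rintegral2 (P n) lambda bf).
  move=> x; rewrite indicE; case: (boolP (x \in _)) => [|_]; last first.
    by rewrite mulr0; apply: Rintegral_ge0 => t _; rewrite subr_ge0 cos_le1.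
  rewrite inE/= => cK.
  have y2 : 2 <= `|delta * c x|.
    by rewrite normrM gtr0_norm//; apply: le_trans K2 _; rewrite ler_pM2l.
  have y0 : delta * c x != 0 by rewrite -normr_gt0; lra.
  rewrite /f/= (integral_one_sub_cos y0).
  have : `|sin (delta * c x) / (delta * c x)| <= 1 / 2.
    rewrite normrM normfV ler_pdivrMr ?normr_gt0//.
    have := sin_max (delta * c x); lra.
  by rewrite ler_norml; lra.
have h_cvg t : \int[P n]_x f (x, t) @[n --> \oo] --> 1 - phi (t * delta).
  have -> : (fun n => \int[P n]_x f (x, t)) =
      (fun n => 1 - \int[P n]_x cos (t * delta * c x)).
    apply/funext => n; rewrite bounded_RintegralB ?Rintegral_probability_cst.
    - by congr (_ - _); apply: eq_Rintegral => x _; rewrite mulrA.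
    - exact: bounded_measurable_cst.
    - by apply: bounded_measurable_cos; do 2 apply: measurable_funM => //.
  by apply: cvgB; [exact: cvg_cst|exact: Pphi].
have bh n : bounded_measurable (fun t => \int[P n]_x f (x, t)).
  exact: (bounded_measurable_Rintegral1 (P n) lambda bf).
have f2 z : `|f z| <= 2.
  by rewrite /f ler_norml; have := cos_le1 (z.2 * (delta * c z.1));
    have := cos_geN1 (z.2 * (delta * c z.1)); lra.
have [||b1phi lim_h] := @bounded_cvg_Rintegral _ _ _ lambda _ _ 2 _ _ h_cvg.
- by move=> n; have [] := bh n.
- move=> n t; rewrite -(Rintegral_probability_cst (P n) 2).
  apply: Rintegral_normr_le => //; last exact: bounded_measurable_cst.
  exact: (bounded_measurable_comp (pair2_measurable t) bf).
have lim_le : \int[lambda]_t (1 - phi (t * delta)) <= e / 4.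
  have phi1 t : phi t <= 1.
    apply: cvgr_to_le (Pphi t) _; apply: nearW => n.
    apply: Rintegral_le_cst => [|x]; last exact: cos_le1.
    by apply: bounded_measurable_cos; exact: measurable_funM.
  rewrite /Rintegral integral_uniform; last 2 first.
  - by apply/measurable_EFinP; have [] := b1phi.
  - by move=> t; rewrite lee_fin subr_ge0.
  rewrite subr0 invr1 mul1e; apply: (@le_trans _ _ (fine (e / 4)%:E)) => //.
  have le_int : (\int[lebesgue_measure]_(t in `[0%R, 1%R])
      (1 - phi (t * delta))%:E <= (e / 4)%:E)%E.
    apply: (@le_trans _ _ (\int[lebesgue_measure]_(t in `[0%R, 1%R]) (e / 4)%:E)%E).
      apply: ge0_le_integral => //.
      - by move=> t _; rewrite lee_fin subr_ge0.
      - by apply/measurable_EFinP; apply: measurable_funTS; have [] := b1phi.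
      - move=> t; rewrite /= in_itv/= => /andP[t0 t1]; rewrite lee_fin; apply: phid.
        by rewrite ger0_norm ?mulr_ge0 ?ler_piMl// ltW.
    by rewrite integral_cst//= lebesgue_measure_itv/= lte_fin ltr01 -EFinB subr0 mule1.
  have ge0_int : (0 <= \int[lebesgue_measure]_(t in `[0%R, 1%R])
      (1 - phi (t * delta))%:E)%E.
    by apply: integral_ge0 => t _; rewrite lee_fin subr_ge0.
  apply: fine_le => //; rewrite ge0_fin_numE//.
  by apply: le_lt_trans le_int _; rewrite ltry.
exists K; have /cvgrPdist_le/(_ (e / 4) ltac:(lra)) := lim_h.
apply: filterS => n; have := le_f n; rewrite ler_norml; lra.
Qed.

End tightness_from_characteristic_function.

(** * Real coordinates on Hermitian matrices *)

Section hermitian_coordinates.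
Context {R : realType} (d : nat).
Implicit Types (A M : hermmx R d) (v w : 'I_d * 'I_d -> R).

(* The real part of a Hermitian matrix is symmetric and its imaginary part
   antisymmetric, so that both can be read off their sum; this identifies
   Hermitian matrices with real [d x d] matrices, isometrically. *)
Definition herm_coord (ij : 'I_d * 'I_d) M : R :=
  complex.Re (M ij.1 ij.2) + complex.Im (M ij.1 ij.2).

Definition herm_of_mx v : 'M[R[i]]_d := \matrix_(i, j)
  (((v (i, j) + v (j, i)) / 2) +i* ((v (i, j) - v (j, i)) / 2)).

Lemma herm_of_mx_hermsym v : herm_of_mx v \is hermsymmx.
Proof.
apply/is_hermitianmxP; rewrite expr0 scale1r; apply/matrixP => i j.
by rewrite !mxE; apply: eq_ReIm => /=; field.
Qed.

Definition herm_of v : hermmx R d := Hermmx (herm_of_mx_hermsym v).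

Lemma herm_entryC M i j : M j i = complex.Re (M i j) -i* complex.Im (M i j).
Proof.
have /is_hermitianmxP := hermmxP M; rewrite expr0 scale1r => /matrixP/(_ j i).
by rewrite !mxE => ->; case: (M i j).
Qed.

Lemma herm_of_coord M : herm_of (herm_coord^~ M) = M.
Proof.
apply/val_inj/matrixP => i j; rewrite mxE /herm_coord /= (herm_entryC M i j)/=.
by apply: eq_ReIm => /=; field.
Qed.

Lemma herm_coord_of v ij : herm_coord ij (herm_of v) = v ij.
Proof. by case: ij => i j; rewrite /herm_coord /= /herm_of_mx !mxE /=; field. Qed.

Lemma sum_antisymmetric (F : 'I_d -> 'I_d -> R) :
  (forall i j, F i j = - F j i) -> \sum_i \sum_j F i j = 0.
Proof.
move=> FN; have : \sum_i \sum_j F i j = - \sum_i \sum_j F i j.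
  rewrite [LHS]exchange_big -sumrN; apply: eq_bigr => i _.
  by rewrite -sumrN; apply: eq_bigr => j _.
by lra.
Qed.

Definition herm_pair v w : R := \sum_ij v ij * w ij.

(** The two sides differ by sums of terms antisymmetric in [(i, j)], both in the real part (the
    products of a real by an imaginary part) and in the imaginary part. *)
Lemma mxtrace_herm A M :
  \tr (A *m M) = (herm_pair (herm_coord^~ A) (herm_coord^~ M))%:C.
Proof.
rewrite /herm_pair -(pair_bigA _ (fun i j => herm_coord (i, j) A * herm_coord (i, j) M))/=.
rewrite /mxtrace; under [LHS]eq_bigr do rewrite mxE.
apply: eq_ReIm; rewrite /= ?complexRe_sum ?complexIm_sum.
  under [LHS]eq_bigr do rewrite complexRe_sum.
  apply/eqP; rewrite eq_sym -subr_eq0 -sumrB; apply/eqP.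
  rewrite -[RHS](@sum_antisymmetric (fun i j => complex.Re (A i j) * complex.Im (M i j) +
    complex.Im (A i j) * complex.Re (M i j))).
    apply: eq_bigr => i _; rewrite -sumrB; apply: eq_bigr => j _.
    by rewrite complexReM (herm_entryC M i j) /herm_coord/=; ring.
  by move=> i j; rewrite (herm_entryC M i j) (herm_entryC A i j)/=; ring.
under [LHS]eq_bigr do rewrite complexIm_sum.
apply: sum_antisymmetric => i j.
by rewrite !complexImM (herm_entryC M i j) (herm_entryC A i j)/=; ring.
Qed.

Lemma continuous_herm_coord ij : continuous (herm_coord ij).
Proof.
have ce (g : R[i] -> R) : continuous g ->
    continuous (fun M : hermmx R d => g (M ij.1 ij.2)).
  move=> cg M; apply: (@continuous_comp _ _ _ (fun M : hermmx R d => M ij.1 ij.2));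
    last exact: cg.
  exact: (@continuous_comp _ _ _ (@hermmx_val R d)
    (fun N : 'M[R[i]]_d => N ij.1 ij.2) M
    (@initial_continuous _ _ _ _) (@coord_continuous _ _ _ _ _ _)).
move=> M; have h1 := ce _ continuous_Re M; have h2 := ce _ continuous_Im M.
exact: (cvgD h1 h2).
Qed.

Lemma measurable_herm_coord ij : measurable_fun setT (herm_coord ij).
Proof. by apply: continuous_borel_measurable; exact: continuous_herm_coord. Qed.

Lemma herm_cvg (F : set_system (hermmx R d)) v : ProperFilter F ->
  (forall ij, herm_coord ij M @[M --> F] --> v ij) -> F --> herm_of v.
Proof.
move=> FF Fv V; rewrite nbhsE => -[_ [[W oW <-] /= Wv] WV].
apply: filterS WV _; have [P nP PW] : nbhs (herm_of v : 'M[R[i]]_d) W.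
  exact: open_nbhs_nbhs.
have entry i j : F [set M : hermmx R d | P i j (M i j)].
  have [e /= e0 eP] := nP i j.
  have er : e = (complex.Re e)%:C.
    by move: e0; rewrite ltcE; case: (e) => a b /= /andP[/eqP ->].
  have r0 : 0 < complex.Re e by move: e0; rewrite er ltcR.
  have /cvgrPdist_lt/(_ (complex.Re e / 2) ltac:(lra)) := Fv (i, j).
  have /cvgrPdist_lt/(_ (complex.Re e / 2) ltac:(lra)) := Fv (j, i).
  apply: filterS2 => M; rewrite /herm_coord /= (herm_entryC M i j)/= => h1 h2.
  apply: eP; rewrite /ball_/= er; apply: le_lt_trans (ler_norm_complex _) _.
  rewrite ltcR complexReD complexImD complexReN complexImN mxE/=.
  move: h1 h2; move: (complex.Re (M i j)) (complex.Im (M i j)) => a b.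
  rewrite !ltr_norml => h1 h2.
  have : `|(v (i, j) + v (j, i)) / 2 - a| + `|(v (i, j) - v (j, i)) / 2 - b| < complex.Re e.
    have [] := ger0P ((v (i, j) + v (j, i)) / 2 - a);
    have [] := ger0P ((v (i, j) - v (j, i)) / 2 - b); lra.
  by [].
have : F [set M : hermmx R d | forall i j, P i j (M i j)].
  by apply: filter_forall => i; apply: filter_forall => j; exact: (entry i j).
by apply: filterS => M; exact: PW.
Qed.

(** Ultrafilter criterion: the coordinates converge along any ultrafilter on the box, and
    coordinatewise limits are limits in the topology of [hermmx]. *)
Lemma compact_herm_box (C : R) : compact [set M | forall ij, `|herm_coord ij M| <= C].
Proof.
rewrite compact_ultra => F UF FK.
have /choice[v vP] ij : exists l : R, `|l| <= C /\
    herm_coord ij M @[M --> F] --> l.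
  by apply: ultra_bounded_cvg; apply: filterS FK => M; exact.
exists (herm_of v); split.
  by move=> ij; rewrite herm_coord_of; exact: (vP ij).1.
by apply: herm_cvg => ij; exact: (vP ij).2.
Qed.

Lemma measurable_herm_of e (T : measurableType e) (u : 'I_d * 'I_d -> T -> R) :
  (forall ij, measurable_fun setT (u ij)) ->
  measurable_fun setT (fun x => herm_of (u^~ x)).
Proof.
move=> mu; apply: measurable_fun_hermmx => i j; under eq_fun do rewrite mxE/=.
  by apply: measurable_funM => //; exact: measurable_funD.
by apply: measurable_funM => //; exact: measurable_funB.
Qed.

End hermitian_coordinates.

(** * Lévy's continuity theorem for Hermitian matrices *)

Section levy_continuity.
Context {R : realType} (d : nat).
Variables (P : nat -> probability (hermmx R d) R) (phi : ('I_d * 'I_d -> R) -> R[i]).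

Let chi (v : 'I_d * 'I_d -> R) (M : hermmx R d) := herm_pair v ((@herm_coord R d)^~ M).

Hypothesis P_phi : forall v,
  ctends (fun n => cexpectation (P n) (fun M => cexp ('i%C * (chi v M)%:C))) (phi v).
(** Continuity at 0 along rays, for the real part: exactly what the truncation inequality consumes,
    one coordinate at a time. *)
Hypothesis phi_continuous0 : forall v e, 0 < e -> exists2 delta, 0 < delta &
  forall t, `|t| <= delta -> 1 - complex.Re (phi (fun ij => t * v ij)) <= e.

Let continuous_chi v : continuous (chi v).
Proof.
move=> M; rewrite /chi /herm_pair; have FF : Filter (nbhs M) := nbhs_filter M.
apply: cvg_big => [|ij _]; first exact: add_continuous.
by apply: cvgMl_tmp; exact: continuous_herm_coord.
Qed.

Let measurable_chi v : measurable_fun setT (chi v).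
Proof. by apply: continuous_borel_measurable; exact: continuous_chi. Qed.

Let chi_scale t v M : chi (fun ij => t * v ij) M = t * chi v M.
Proof. by rewrite /chi /herm_pair mulr_sumr; apply: eq_bigr => ij _; rewrite mulrA. Qed.

Let chi_delta ij M : chi (fun kl => (kl == ij)%:R) M = herm_coord ij M.
Proof.
rewrite /chi /herm_pair (bigD1 ij)//= eqxx mul1r big1 ?addr0// => kl /negPf ->.
by rewrite mul0r.
Qed.

Let cos_cvg v : \int[P n]_M cos (chi v M) @[n --> \oo] --> complex.Re (phi v).
Proof.
apply/cvgrPdist_le => e /(P_phi v); apply: filterS => n h.
rewrite distrC; apply: le_trans h; apply: le_trans (normr_Re_le _).
by rewrite complexReD complexReN cexpectation_cexp_imag.
Qed.

Let sin_cvg v : \int[P n]_M sin (chi v M) @[n --> \oo] --> complex.Im (phi v).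
Proof.
apply/cvgrPdist_le => e /(P_phi v); apply: filterS => n h.
rewrite distrC; apply: le_trans h; apply: le_trans (normr_Im_le _).
by rewrite complexImD complexImN cexpectation_cexp_imag.
Qed.

Let tight ij (e : R) : 0 < e -> exists K : nat,
  \forall n \near \oo, fine (P n [set M | K%:R <= `|herm_coord ij M|]) <= e.
Proof.
apply: (@tight_of_characteristic_cvg _ _ _ _ _
  (fun t => complex.Re (phi (fun kl => t * (kl == ij)%:R)))).
- exact: measurable_herm_coord.
- move=> t; under eq_fun do under eq_Rintegral do rewrite -chi_delta -chi_scale.
  exact: cos_cvg.
- by move=> {}e e0; exact: phi_continuous0.
Qed.

(** [Q] is the law of the Hermitian matrix built from the limit coordinates. Cosines and sines of
    linear forms are bounded and Lipschitz in the coordinates, so their integrals pass to the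
    ultrafilter limit. *)
Let exists_limit : exists Q : probability (hermmx R d) R,
  [/\ forall ij (e : R), 0 < e -> exists K : nat,
        fine (Q [set M | K%:R < `|herm_coord ij M|]) <= e,
      forall v, \int[Q]_M cos (chi v M) = complex.Re (phi v) &
      forall v, \int[Q]_M sin (chi v M) = complex.Im (phi v)].
Proof.
have [U [UU ooU]] := ultraFilterLemma (@eventually_filter : ProperFilter \oo).
have [|dO [Om [Q [Y [mY tY limY]]]]] := @exists_limit_coordinates _ _ (hermmx R d) _
    (@herm_coord R d) (@measurable_herm_coord R d) P U UU.
  by move=> ij e /(tight ij)[K /ooU PK]; exists K.
pose f x := herm_of (Y^~ x).
have mf : measurable_fun setT f by exact: measurable_herm_of.
pose F := mfun_Sub (mem_set mf : f \in mfun).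
have FE x : F x = herm_of (Y^~ x) by [].
have coordF ij x : herm_coord ij (F x) = Y ij x by rewrite FE herm_coord_of.
have lip (v : 'I_d * 'I_d -> R) w w' e : (forall ij, `|w ij - w' ij| <= e) ->
    `|herm_pair v w - herm_pair v w'| <= (\sum_ij `|v ij|) * e.
  move=> we; rewrite /herm_pair -sumrB; apply: le_trans (ler_norm_sum _ _ _) _.
  rewrite mulr_suml; apply: ler_sum => ij _.
  by rewrite -mulrBr normrM ler_wpM2l.
have mY' v : measurable_fun setT (fun x => herm_pair v (Y^~ x)).
  by apply: measurable_sum => ij; exact: measurable_funM.
(* The ultrafilter refines the filter at infinity, so a limit along the sequence and a limit along
   [U] must coincide. *)
have uniq (u : nat -> R) (x y : R) : u n @[n --> \oo] --> x -> u n @[n --> U] --> y -> x = y.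
  move=> ux uy; apply: (norm_cvg_unique _ uy); apply: cvg_trans ux.
  by apply: cvg_app => A /ooU.
exists (distribution Q F); split.
- move=> ij e /(tY ij)[K QK]; exists K; move: QK; rewrite /distribution/= /pushforward/=.
  by congr (fine (Q _) <= e); apply/seteqP; split=> x /=; rewrite herm_coord_of.
- move=> v; rewrite Rintegral_distribution; last first.
    by apply: bounded_measurable_cos; exact: measurable_chi.
  apply: esym; apply: (uniq _ _ _ (@cos_cvg v)).
  have := limY (fun w => cos (herm_pair v w)) 1 (\sum_ij `|v ij|).
  rewrite [X in _ -> _ -> _ -> _ -> _ --> X](_ : _ = \int[Q]_x cos (chi v (F x))); last first.
    apply: eq_Rintegral => x _; congr cos; apply: eq_bigr => ij _.
    by rewrite coordF.
  apply.
  + by move=> w; rewrite ler_norml cos_le1 cos_geN1.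
  + by move=> w w' e we; apply: le_trans (cos_lip _ _) _; exact: lip.
  + by have [] := bounded_measurable_cos (measurable_chi v).
  + by have [] := bounded_measurable_cos (mY' v).
- move=> v; rewrite Rintegral_distribution; last first.
    by apply: bounded_measurable_sin; exact: measurable_chi.
  apply: esym; apply: (uniq _ _ _ (@sin_cvg v)).
  have := limY (fun w => sin (herm_pair v w)) 1 (\sum_ij `|v ij|).
  rewrite [X in _ -> _ -> _ -> _ -> _ --> X](_ : _ = \int[Q]_x sin (chi v (F x))); last first.
    apply: eq_Rintegral => x _; congr sin; apply: eq_bigr => ij _.
    by rewrite coordF.
  apply.
  + by move=> w; rewrite ler_norml sin_le1 sin_geN1.
  + by move=> w w' e we; apply: le_trans (sin_lip _ _) _; exact: lip.
  + by have [] := bounded_measurable_sin (measurable_chi v).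
  + by have [] := bounded_measurable_sin (mY' v).
Qed.

(** Affine rather than linear forms: the constant [s] is the phase that turns cosines into sines. *)
Let Phi (g : hermmx R d -> R) := exists v s, g = fun M => chi v M + s.

Let Phi_cst a : Phi (fun=> a).
Proof.
exists (fun=> 0), a; apply/funext => M.
by rewrite /chi /herm_pair big1 ?add0r// => ij _; rewrite mul0r.
Qed.

Let Phi_add g h : Phi g -> Phi h -> Phi (fun M => g M + h M).
Proof.
move=> [v [s ->]] [w [t ->]]; exists (fun ij => v ij + w ij), (s + t).
apply/funext => M; rewrite addrACA; congr (_ + _).
by rewrite /chi /herm_pair -big_split; apply: eq_bigr => ij _ /=; rewrite mulrDl.
Qed.

Let Phi_opp g : Phi g -> Phi (fun M => - g M).
Proof.
move=> [v [s ->]]; exists (fun ij => -1 * v ij), (- s).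
by apply/funext => M; rewrite chi_scale mulN1r opprD.
Qed.

Let Phi_continuous g : Phi g -> continuous g.
Proof.
move=> [v [s ->]] M; exact: (cvgD (@continuous_chi v M) (cvg_cst _)).
Qed.

Let Phi_separates (M N : hermmx R d) : M != N ->
  exists g, [/\ Phi g, g M = 0 & g N = 1].
Proof.
move=> MN; have [ij ijMN] : exists ij, herm_coord ij M != herm_coord ij N.
  apply: contrapT => h; move/eqP: MN; apply.
  rewrite -(herm_of_coord M) -(herm_of_coord N); congr herm_of; apply/funext => ij.
  by apply/eqP/negP => /negP ne; apply: h; exists ij.
pose D := herm_coord ij N - herm_coord ij M.
have D0 : D != 0 by rewrite subr_eq0 eq_sym.
exists (fun M' => chi (fun kl => D^-1 * (kl == ij)%:R) M' + - (D^-1 * herm_coord ij M)).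
split; first by exists (fun kl => D^-1 * (kl == ij)%:R), (- (D^-1 * herm_coord ij M)).
  by rewrite chi_scale chi_delta subrr.
by rewrite chi_scale chi_delta -mulrBr mulVf.
Qed.

Theorem levy_continuity : exists Q : probability (hermmx R d) R,
  weakly_converges P Q /\
  forall v, cexpectation Q (fun M => cexp ('i%C * (chi v M)%:C)) = phi v.
Proof.
have [Q [tQ cosQ sinQ]] := exists_limit; exists Q; split; last first.
  by move=> v; rewrite cexpectation_cexp_imag cosQ sinQ; case: (phi v).
have span_cvg g : cos_span Phi g -> bounded_measurable g /\
    \int[P n]_M g M @[n --> \oo] --> \int[Q]_M g M.
  elim=> [|a psi {}g [v [s ->]] _ [bg gcvg]].
    split; first exact: bounded_measurable_cst.
    rewrite Rintegral_probability_cst; under eq_fun do rewrite Rintegral_probability_cst.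
    exact: cvg_cst.
  have bcs := bounded_measurable_cos (measurable_chi v).
  have bsn := bounded_measurable_sin (measurable_chi v).
  have bM b h : bounded_measurable h -> bounded_measurable (fun M : hermmx R d => b * h M).
    by move=> bh; apply: bounded_measurableM => //; exact: bounded_measurable_cst.
  (* The addition formula removes the phase [s], leaving the two integrals whose limits are the real
     and imaginary parts of [phi v]. *)
  have E (P' : probability (hermmx R d) R) :
      \int[P']_M (a * cos (chi v M + s) + g M) = a * cos s * \int[P']_M cos (chi v M) +
      (- a * sin s * \int[P']_M sin (chi v M) + \int[P']_M g M).
    rewrite -!bounded_RintegralZl// -!bounded_RintegralD//; try exact: bM.
      by apply: eq_Rintegral => M _; rewrite cosD; ring.
    by apply: bounded_measurableD => //; exact: bM.
  split.
    apply: bounded_measurableD => //; apply: bM; apply: bounded_measurable_cos.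
    exact: measurable_funD.
  rewrite E; under eq_fun do rewrite E.
  apply: cvgD; first by apply: cvgMl_tmp; rewrite cosQ; exact: cos_cvg.
  by apply: cvgD => //; apply: cvgMl_tmp; rewrite sinQ; exact: sin_cvg.
move=> f cf [B fB]; apply/cvgrPdist_le => e e0.
have B0 : 0 <= B by exact: le_trans (fB 0).
pose N := #|{: 'I_d * 'I_d}|.+1%:R : R.
have N0 : 0 < N by rewrite ltr0n.
(* [N * eta] bounds the mass outside the box. There [|f - g| <= 2 B + 1], because [r <= 1] gives
   [|g| <= B + 1]; this region thus contributes at most [e / 6]. *)
pose eta := e / 6 / (2 * B + 1) / N.
pose r := Num.min (e / 6) 1.
have r0 : 0 < r by rewrite lt_min; apply/andP; split; lra.
have r1 : r <= 1 by rewrite ge_min lexx orbT.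
have re : r <= e / 6 by rewrite ge_min lexx.
have eta0 : 0 < eta by rewrite !divr_gt0//; lra.
have etaE : (2 * B + 1) * (N * eta) = e / 6.
  by rewrite /eta; field; rewrite !gt_eqF//; lra.
have /choice[K1 K1P] := fun ij => tight ij eta0.
have /choice[K2 K2P] := fun ij => tQ ij _ eta0.
pose C : nat := (maxn (\max_ij K1 ij) (\max_ij K2 ij)).
pose out ij := [set M : hermmx R d | C%:R < `|herm_coord ij M|].
have mge a ij : measurable [set M : hermmx R d | a <= `|herm_coord ij M|].
  rewrite (_ : mkset _ = setT `&` (fun M => `|herm_coord ij M|) @^-1` `[a, +oo[).
    by apply: (measurableT_comp (@normr_measurable R setT) (measurable_herm_coord ij)) => //;
      exact: measurable_itv.
  by rewrite setTI; apply/seteqP; split=> x /=; rewrite in_itv/= andbT.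
have mgt a ij : measurable [set M : hermmx R d | a < `|herm_coord ij M|].
  rewrite (_ : mkset _ = setT `&` (fun M => `|herm_coord ij M|) @^-1` `]a, +oo[).
    by apply: (measurableT_comp (@normr_measurable R setT) (measurable_herm_coord ij)) => //;
      exact: measurable_itv.
  by rewrite setTI; apply/seteqP; split=> x /=; rewrite in_itv/= andbT.
have prob_le (P' : probability (hermmx R d) R) S S' : measurable S -> measurable S' ->
    S `<=` S' -> fine (P' S) <= fine (P' S').
  by move=> mS mS' SS'; apply: fine_le; rewrite ?fin_num_measure// le_measure ?inE.
have outP : \forall n \near \oo, forall ij, fine (P n (out ij)) <= eta.
  apply: filter_forall => ij; apply: filterS (K1P ij) => n; apply: le_trans.
  apply: prob_le => //; first exact: mgt.
  move=> M /= /ltW; apply: le_trans; rewrite ler_nat.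
  by apply: leq_trans (leq_maxl _ _); exact: leq_bigmax.
have outQ ij : fine (Q (out ij)) <= eta.
  apply: le_trans (K2P ij); apply: prob_le; [exact: mgt|exact: mgt|].
  move=> M /=; apply: le_lt_trans; rewrite ler_nat.
  by apply: leq_trans (leq_maxr _ _); exact: leq_bigmax.
have [g [sg gB gf]] := cos_span_dense Phi_cst Phi_add Phi_opp Phi_continuous
  Phi_separates (compact_herm_box (C := C%:R)) cf fB r0.
have [bg gcvg] := span_cvg g sg.
have bf : bounded_measurable f.
  by split; [exact: continuous_borel_measurable|exists B].
(* Dominates [|f - g|] everywhere: [r] on the compact box, the trivial bound as soon as one
   coordinate leaves it. *)
pose H M := r + (2 * B + 1) * \sum_ij \1_(out ij) M.
have bsum : bounded_measurable (fun M : hermmx R d => \sum_ij \1_(out ij) M : R).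
  apply: bounded_measurable_sum => ij; apply: bounded_measurable_indic; exact: mgt.
have bH : bounded_measurable H.
  apply: bounded_measurableD; first exact: bounded_measurable_cst.
  by apply: bounded_measurableM => //; exact: bounded_measurable_cst.
have fgH M : `|f M - g M| <= H M.
  have sum0 : 0 <= \sum_ij \1_(out ij) M :> R by apply: sumr_ge0 => ij _; rewrite indicE ler0n.
  have [/existsP[ij ijM]|/existsPn outN] := boolP [exists ij, M \in out ij].
    have : 1 <= \sum_ij \1_(out ij) M :> R.
      rewrite (bigD1 ij)//= indicE ijM lerDl.
      by apply: sumr_ge0 => kl _; rewrite indicE ler0n.
    move=> h; rewrite /H; have := ler_normB (f M) (g M); have := fB M; have := gB M.
    have B1 : 0 <= 2 * B + 1 by lra.
    by have := ler_wpM2l B1 h; lra.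
  apply: le_trans (gf M _) _.
    by move=> ij; have := outN ij; rewrite notin_setE/= => /negP; rewrite -leNgt.
  by rewrite /H lerDl mulr_ge0//; lra.
have intH (P' : probability (hermmx R d) R) : (forall ij, fine (P' (out ij)) <= eta) ->
    \int[P']_M H M <= e / 3.
  move=> oP; rewrite bounded_RintegralD; last 2 first.
  - exact: bounded_measurable_cst.
  - by apply: bounded_measurableM => //; exact: bounded_measurable_cst.
  rewrite Rintegral_probability_cst bounded_RintegralZl//.
  rewrite bounded_Rintegral_sum; last first.
    by move=> ij; apply: bounded_measurable_indic; exact: mgt.
  have : \sum_ij \int[P']_M \1_(out ij) M <= N * eta.
    apply: (@le_trans _ _ (\sum_(ij : 'I_d * 'I_d) eta)).
      apply: ler_sum => ij _; rewrite Rintegral_indic_probability//; exact: mgt.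
    by rewrite sumr_const -mulr_natl ler_pM2r// ler_nat.
  have B1 : 0 <= 2 * B + 1 by lra.
  by move=> /(ler_wpM2l B1); rewrite etaE; lra.
have fg_le (P' : probability (hermmx R d) R) : (forall ij, fine (P' (out ij)) <= eta) ->
    `|\int[P']_M f M - \int[P']_M g M| <= e / 3.
  move=> oP; apply: le_trans (intH P' oP); rewrite -bounded_RintegralB//.
  by apply: Rintegral_normr_le => //; exact: bounded_measurableB.
have /cvgrPdist_le/(_ (e / 3) ltac:(lra)) := gcvg.
apply: filterS2 outP => n /fg_le h1 h2; have h3 := fg_le Q outQ.
by move: h1 h2 h3; rewrite !ler_norml; lra.
Qed.

End levy_continuity.

(** * Characteristic functions on the line *)

Section complex_continuity.
Context {R : realType}.
Implicit Types f g : R -> R[i].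

Definition complex_continuous f :=
  continuous (fun t => complex.Re (f t) : R) /\
  continuous (fun t => complex.Im (f t) : R).

Lemma complex_continuous_cst z : complex_continuous (fun=> z).
Proof. by split=> t; exact: cvg_cst. Qed.

Lemma complex_continuousB f g : complex_continuous f -> complex_continuous g ->
  complex_continuous (fun t => f t - g t).
Proof.
move=> [f1 f2] [g1 g2]; split=> t.
  under eq_fun do rewrite complexReD complexReN.
  by apply: cvgB; [exact: f1|exact: g1].
under eq_fun do rewrite complexImD complexImN.
by apply: cvgB; [exact: f2|exact: g2].
Qed.

Lemma complex_continuousM f g : complex_continuous f -> complex_continuous g ->
  complex_continuous (fun t => f t * g t).
Proof.
move=> [f1 f2] [g1 g2]; split=> t.
  under eq_fun do rewrite complexReM.
  apply: cvgB; apply: cvgM;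
    [exact: f1|exact: g1|exact: f2|exact: g2].
under eq_fun do rewrite complexImM.
apply: cvgD; apply: cvgM;
  [exact: f1|exact: g2|exact: f2|exact: g1].
Qed.

Lemma complex_continuous_cexp f : complex_continuous f ->
  complex_continuous (fun t => cexp (f t)).
Proof.
move=> [f1 f2]; split=> t; under eq_fun do rewrite cexpE/=.
  apply: cvgM; first exact: (continuous_comp (f1 t) (@continuous_expR R _)).
  exact: (continuous_comp (f2 t) (@continuous_cos R _)).
apply: cvgM; first exact: (continuous_comp (f1 t) (@continuous_expR R _)).
exact: (continuous_comp (f2 t) (@continuous_sin R _)).
Qed.

Lemma complex_continuous_cmod f : complex_continuous f ->
  continuous (fun t => cmod (f t)).
Proof.
move=> [f1 f2] t; under eq_fun do rewrite cmodE.
have h : continuous (fun s => complex.Re (f s) ^+ 2 + complex.Im (f s) ^+ 2 : R).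
  by move=> s; apply: cvgD; under eq_fun do rewrite expr2; apply: cvgM;
    [exact: f1|exact: f1|exact: f2|exact: f2].
exact: (continuous_comp (h t) (@sqrt_continuous R _)).
Qed.

Lemma complex_continuousP f : (forall t e, 0 < e -> exists2 h, 0 < h &
  forall s, `|t - s| <= h -> cmod (f t - f s) <= e) -> complex_continuous f.
Proof.
move=> cf; split=> t; apply/cvgrPdist_le => e /(cf t)[h h0 fh].
  near=> s; rewrite -complexReN -complexReD; apply: le_trans (normr_Re_le _) (fh _ _).
  by near: s; exact: cvgr_dist_le.
near=> s; rewrite -complexImN -complexImD; apply: le_trans (normr_Im_le _) (fh _ _).
by near: s; exact: cvgr_dist_le.
Unshelve. all: by end_near. Qed.

Lemma continuous_complex_continuous f : continuous f -> complex_continuous f.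
Proof.
by move=> cf; split=> t;
  [exact: (continuous_comp (cf t) (@continuous_Re R _))|
   exact: (continuous_comp (cf t) (@continuous_Im R _))].
Qed.

Lemma complex_continuous_bounded f T : complex_continuous f ->
  exists2 B, 0 < B & forall t, `|t| <= T -> cmod (f t) <= B.
Proof.
move=> /complex_continuous_cmod cf; have [T0|T0] := leP 0 T; last first.
  by exists 1 => // t tT; have := normr_ge0 t; lra.
have [|c _ fc] := @EVT_max R (fun t => cmod (f t)) (- T) T _ (continuous_subspaceT cf).
  by lra.
exists (cmod (f c) + 1) => [|t tT]; first by have := cmod_ge0 (f c); lra.
apply: (@le_trans _ _ (cmod (f c))); last lra.
by apply: fc; rewrite in_itv/= -ler_norml.
Qed.

End complex_continuity.

Section characteristic_function.
Context {R : realType}.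

Definition char_fun (P : probability R R) (t : R) : R[i] :=
  cexpectation P (fun x => cexp ('i%C * (t * x)%:C)).

(** Dominates the variation of [cos (t x)] and of [sin (t x)] when [t] moves by at most [h]. Being
    bounded and continuous, it is itself a test function for weak convergence, which gives
    equicontinuity of the characteristic functions along the sequence. *)
Let modulus (h x : R) : R := Num.min 2 (h * `|x|).

Let measurable_scale (t : R) : measurable_fun setT (fun x : R => t * x).
Proof. exact: measurable_funM. Qed.

Let continuous_modulus h : continuous (modulus h).
Proof.
move=> x; apply: (@continuous_min _ _ (fun=> 2) (fun y => h * `|y|) x); first exact: cvg_cst.
by apply: cvgMl_tmp; exact: norm_continuous.
Qed.

Let modulus_bound (h x : R) : 0 <= h -> `|modulus h x| <= 2.
Proof.
move=> h0; rewrite ger0_norm ?ge_min ?lexx//.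
by rewrite le_min mulr_ge0// andbT.
Qed.

Let bounded_modulus (h : R) : 0 <= h -> bounded_measurable (modulus h).
Proof.
move=> h0; split; last by exists 2 => x; exact: modulus_bound.
apply: continuous_measurable_fun; exact: continuous_modulus.
Qed.

Lemma char_fun_modulus P (h s t : R) : 0 <= h -> `|s - t| <= h ->
  cmod (char_fun P s - char_fun P t) <= 2 * \int[P]_x modulus h x.
Proof.
move=> h0 st; apply: le_trans (cmod_le_ReIm _) _.
rewrite complexReD complexImD complexReN complexImN /char_fun !cexpectation_cexp_imag/=.
have aux (g : R -> R) : (forall u, bounded_measurable (fun x : R => g (u * x))) ->
    (forall x y, `|g x - g y| <= `|x - y|) -> (forall x, `|g x| <= 1) ->
    `|\int[P]_x g (s * x) - \int[P]_x g (t * x)| <= \int[P]_x modulus h x.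
  move=> bg lg g1; rewrite -bounded_RintegralB//; apply: Rintegral_normr_le.
  - exact: bounded_measurableB.
  - exact: bounded_modulus.
  move=> x; rewrite le_min; apply/andP; split.
    by apply: le_trans (ler_normB _ _) _; have := g1 (s * x); have := g1 (t * x); lra.
  by apply: le_trans (lg _ _) _; rewrite -mulrBl normrM ler_wpM2r.
have := aux _ (fun u => bounded_measurable_cos (measurable_scale u)) (@cos_lip R) (@cos_max R).
have := aux _ (fun u => bounded_measurable_sin (measurable_scale u)) (@sin_lip R) (@sin_max R).
by lra.
Qed.

Lemma exists_small_modulus (P : probability R R) (e : R) : 0 < e ->
  exists2 h, 0 < h & \int[P]_x modulus h x <= e.
Proof.
move=> e0; have hn n : 0 < n.+1%:R^-1 :> R by [].
have [|||_] := @bounded_cvg_Rintegral R _ R P (fun n => modulus n.+1%:R^-1) (fun=> 0) 2.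
- by move=> n; have [] := bounded_modulus (ltW (hn n)).
- by move=> n x; apply: modulus_bound; exact: ltW.
- move=> x; apply/cvgrPdist_le => d d0; near=> n.
  rewrite sub0r normrN ger0_norm; last by rewrite le_min mulr_ge0// andbT.
  rewrite ge_min; apply/orP; right; rewrite mulrC ler_pdivrMr// -ler_pdivrMl//.
  apply: (@le_trans _ _ n%:R); last by rewrite ler_nat.
  by near: n; exact: nbhs_infty_ger.
rewrite Rintegral_probability_cst => /cvgrPdist_le/(_ e e0)[N _ /(_ N (leqnn N))].
rewrite sub0r normrN => h; exists N.+1%:R^-1 => //.
exact: le_trans (ler_norm _) h.
Unshelve. all: by end_near. Qed.

Lemma complex_continuous_char_fun P : complex_continuous (char_fun P).
Proof.
apply: complex_continuousP => t e e0.
have [h h0 Ph] := @exists_small_modulus P (e / 2) ltac:(lra); exists h => // s ts.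
by apply: le_trans (char_fun_modulus P (ltW h0) ts) _; lra.
Qed.

Lemma cmod_char_fun_le1 P t : cmod (char_fun P t) <= 1.
Proof.
apply: cmod_cexpectation_le; last by move=> x; rewrite cmod_cexp_imag.
exact: complex_bounded_measurable_cexp_imag.
Qed.

Lemma char_fun0 P : char_fun P 0 = 1.
Proof.
rewrite /char_fun -[RHS](cexpectation_cst P 1); congr cexpectation.
by apply/funext => x; rewrite mul0r mulr0 cexp0.
Qed.

Lemma char_fun_convolution_power P t n :
  char_fun (convolution_power (@real_add R) 0 P n) t = char_fun P t ^+ n.
Proof.
rewrite /char_fun cexpectation_convolution_power//.
- exact: complex_bounded_measurable_cexp_imag.
- by move=> x y; rewrite /real_add /= mulrDr rmorphD mulrDr cexpD.
- by rewrite mulr0 mulr0 cexp0.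
Qed.

(** Pointwise convergence on a finite grid of mesh [h], spread to [[-T, T]] by equicontinuity. The
    three errors are [2 e/6] for [P_ n], [e/3] on the grid and [2 e/12] for [P]; the factors 2 count
    cosine and sine. *)
Lemma char_fun_cvg_uniform (P_ : nat -> probability R R) (P : probability R R) (T e : R) :
  weakly_converges P_ P -> 0 < e ->
  \forall n \near \oo, forall t, `|t| <= T ->
    cmod (char_fun (P_ n) t - char_fun P t) <= e.
Proof.
move=> PP e0; have [T0|T0] := leP 0 T; last first.
  by near=> n => t tT; have := normr_ge0 t; lra.
have [h h0 Ph] := @exists_small_modulus P (e / 12) ltac:(lra).
have near_mod : \forall n \near \oo, \int[P_ n]_x modulus h x <= e / 6.
  have bm : exists M : R, forall x, `|modulus h x| <= M.
    by exists 2 => x; exact/modulus_bound/ltW.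
  have /cvgrPdist_le/(_ (e / 12) ltac:(lra)) := PP _ (@continuous_modulus h) bm.
  apply: filterS => n.
  by rewrite ler_norml; lra.
have near_pt t : \forall n \near \oo, cmod (char_fun (P_ n) t - char_fun P t) <= e / 3.
  have cc : continuous (fun x : R => cos (t * x)).
    by move=> x; apply: continuous_comp; [exact: mulrl_continuous|exact: continuous_cos].
  have cs : continuous (fun x : R => sin (t * x)).
    by move=> x; apply: continuous_comp; [exact: mulrl_continuous|exact: continuous_sin].
  have bc : exists M : R, forall x, `|cos (t * x)| <= M.
    by exists 1 => x; rewrite ler_norml cos_le1 cos_geN1.
  have bs : exists M : R, forall x, `|sin (t * x)| <= M.
    by exists 1 => x; rewrite ler_norml sin_le1 sin_geN1.
  have /cvgrPdist_le/(_ (e / 6) ltac:(lra)) := PP _ cc bc.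
  have /cvgrPdist_le/(_ (e / 6) ltac:(lra)) := PP _ cs bs.
  apply: filterS2 => n h1 h2; apply: le_trans (cmod_le_ReIm _) _.
  rewrite complexReD complexImD complexReN complexImN /char_fun !cexpectation_cexp_imag/=.
  by rewrite distrC (distrC (\int[_]_x sin _)); lra.
(* The points [-T + j h] with [j < J] come within [h] of every point of [[-T, T]]. *)
pose J := (Num.truncn (2 * T / h)).+1.
have near_grid : \forall n \near \oo, forall j : 'I_J,
    cmod (char_fun (P_ n) (- T + j%:R * h) - char_fun P (- T + j%:R * h)) <= e / 3.
  by apply: filter_forall => j; exact: near_pt.
apply: filterS2 near_mod near_grid => n hmod hgrid t tT.
have w0 : 0 <= (t + T) / h.
  by apply: divr_ge0; [move: tT; rewrite ler_norml; lra|exact: ltW].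
pose j := Num.truncn ((t + T) / h).
have jJ : (j < J)%N.
  rewrite ltnS; apply: le_truncn; rewrite ler_pM2r ?invr_gt0//.
  by move: tT; rewrite ler_norml; lra.
have /andP[j1 j2] := truncn_itv w0.
have tj : `|t - (- T + j%:R * h)| <= h.
  rewrite -/j in j1 j2; move: j1 j2; rewrite ler_pdivlMr// ltr_pdivrMr// -natr1 => j1 j2.
  by rewrite ler_norml; lra.
have hj := hgrid (Ordinal jJ).
have h1 := char_fun_modulus (P_ n) (ltW h0) tj.
have h2 := char_fun_modulus P (ltW h0) tj.
set tj' := - T + _ in tj hj h1 h2.
have -> : char_fun (P_ n) t - char_fun P t =
    (char_fun (P_ n) t - char_fun (P_ n) tj') + (char_fun (P_ n) tj' - char_fun P tj') -
    (char_fun P t - char_fun P tj') by ring.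
apply: le_trans (cmod_leB _ _) _.
have := cmod_leD (char_fun (P_ n) t - char_fun (P_ n) tj') (char_fun (P_ n) tj' - char_fun P tj').
by move: hj; rewrite /= -/tj'; lra.
Unshelve. all: by end_near. Qed.

End characteristic_function.

(** * Convergence of [k_n (phi_n - 1)] to the Lévy exponent *)

Section levy_exponent_asymptotics.
Context {R : realType}.
Variables (mu : probability R R) (mu_ : nat -> probability R R) (k : nat -> nat).
Variable psi : R -> R[i].
Hypothesis psi_mu : is_levy_exponent mu psi.
Hypothesis k_oo : k n @[n --> \oo] --> \oo.
Hypothesis mu_cvg : weakly_converges
  (fun n => convolution_power (@real_add R) 0 (mu_ n) (k n)) mu.

Let c_psi : complex_continuous psi.
Proof. by case: psi_mu => /continuous_complex_continuous. Qed.

Lemma levy_exponent_bounded (T : R) :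
  exists2 B, 0 < B & forall t, `|t| <= T -> cmod (psi t) <= B.
Proof. exact: complex_continuous_bounded. Qed.

(** Dividing [phi_n] by the explicit root [exp(psi / k_n)] leaves a function [g] with [g 0 = 1] and
    [g^k_n] uniformly close to 1, to which [continuous_root_close] applies. *)
Lemma char_fun_asymptotics (T e : R) : 0 < e ->
  \forall n \near \oo, forall t, `|t| <= T ->
    cmod ((k n)%:R * (char_fun (mu_ n) t - 1) - psi t) <= e.
Proof.
move=> e0; have [B B0 psiB] := levy_exponent_bounded T.
have eB0 : 0 < expR B by exact: expR_gt0.
(* 1/32 meets the requirement [eta < 1/16] of the root lemma; the other term gives
   [2 * eta * exp B <= e / 2], where [exp B] bounds [exp(psi / k_n)]. *)
pose eta := Num.min (1 / 32) (e / 4 / expR B).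
have eta0 : 0 < eta.
  by rewrite lt_min; apply/andP; split; [lra|rewrite !divr_gt0//; lra].
have eta1 : eta <= 1 / 32 by rewrite ge_min lexx.
have eta2 : 2 * eta * expR B <= e / 2.
  have : eta <= e / 4 / expR B by rewrite ge_min lexx orbT.
  by rewrite ler_pdivlMr//; lra.
have etaB0 : 0 < eta / expR B by rewrite divr_gt0.
have near_k1 := near_natr_ge (B * 4) k_oo.
have near_k2 := near_natr_ge (8 * B ^+ 2 / (e / 2)) k_oo.
have near_k3 := near_natr_ge 1 k_oo.
have near_G := char_fun_cvg_uniform T mu_cvg etaB0.
near=> n => t tT.
have k1 : B * 4 <= (k n)%:R by near: n; exact: near_k1.
have k2 : 8 * B ^+ 2 / (e / 2) <= (k n)%:R by near: n; exact: near_k2.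
have k3 : 1 <= (k n)%:R :> R by near: n; exact: near_k3.
have G s : `|s| <= T -> cmod (char_fun (mu_ n) s ^+ k n - cexp (psi s)) <= eta / expR B.
  case: psi_mu => _ _ <-; rewrite -char_fun_convolution_power.
  by move: s; near: n; exact: near_G.
have kR : 0 < (k n)%:R :> R by lra.
have kn0 : (0 < k n)%N by rewrite -(ltr0n R).
have kC : (k n)%:R != 0 :> R[i] by rewrite pnatr_eq0 -lt0n.
pose g s := char_fun (mu_ n) s * cexp (- (psi s * (k n)%:R^-1)).
have cg : complex_continuous g.
  apply: complex_continuousM; first exact: complex_continuous_char_fun.
  apply: complex_continuous_cexp.
  have := complex_continuousB (complex_continuous_cst 0)
    (complex_continuousM c_psi (complex_continuous_cst (k n)%:R^-1)).
  by under eq_fun do rewrite sub0r.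
have cg1 : continuous (fun s => cmod (g s - 1)).
  exact: (complex_continuous_cmod (complex_continuousB cg (complex_continuous_cst 1))).
have g0 : g 0 = 1.
  by case: psi_mu => _ psi0 _; rewrite /g psi0 char_fun0 mul0r oppr0 cexp0 mulr1.
have cexp_bound s : `|s| <= T -> cmod (cexp (- psi s)) <= expR B.
  move=> sT; rewrite cmod_cexp ler_expR complexReN.
  apply: le_trans (ler_norm _) _; rewrite normrN.
  exact: le_trans (normr_Re_le _) (psiB s sT).
have gk s : `|s| <= T -> cmod (g s ^+ k n - 1) <= eta.
  move=> sT; have -> : g s ^+ k n - 1 =
      (char_fun (mu_ n) s ^+ k n - cexp (psi s)) * cexp (- psi s).
    rewrite mulrBl -cexpD subrr cexp0 exprMn -cexpMn; congr (_ * cexp _ - 1).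
    by rewrite mulrN mulrC divfK.
  rewrite cmod_mul; apply: (@le_trans _ _ (eta / expR B * expR B)).
    by apply: ler_pM; rewrite ?cmod_ge0 ?G ?cexp_bound.
  by rewrite divfK// gt_eqF.
have g_close := @continuous_root_close _ g (k n) T eta cg1 g0 ltac:(lra) gk t tT.
have phiE : char_fun (mu_ n) t = g t * cexp (psi t / (k n)%:R).
  by rewrite /g -mulrA -cexpD addNr cexp0 mulr1.
have -> : (k n)%:R * (char_fun (mu_ n) t - 1) - psi t =
    (k n)%:R * (g t - 1) * cexp (psi t / (k n)%:R) +
    ((k n)%:R * (cexp (psi t / (k n)%:R) - 1) - psi t) by rewrite phiE; ring.
apply: le_trans (cmod_leD _ _) _.
have h1 : cmod ((k n)%:R * (g t - 1) * cexp (psi t / (k n)%:R)) <= e / 2.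
  rewrite 2!cmod_mul cmod_nat; apply: le_trans eta2; apply: ler_pM;
    [by rewrite mulr_ge0// cmod_ge0|exact: cmod_ge0|exact: g_close|].
  rewrite cmod_cexp ler_expR; apply: le_trans (ler_norm _) _.
  apply: le_trans (normr_Re_le _) _; apply: le_trans (psiB t tT).
  by rewrite cmod_mul cmodV cmod_nat ler_piMr ?cmod_ge0// invf_le1.
have psi_t := psiB t tT; have psi_t0 := cmod_ge0 (psi t).
have h2 : cmod ((k n)%:R * (cexp (psi t / (k n)%:R) - 1) - psi t) <= e / 2.
  apply: le_trans (cexp_div_le kn0 _) _; first by lra.
  rewrite ler_pdivrMr// [leRHS]mulrC -ler_pdivrMr; last lra.
  apply: le_trans k2; rewrite ler_pM2r ?invr_gt0; last lra.
  by rewrite ler_pM2l// ler_sqr ?nnegrE//; lra.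
by lra.
Unshelve. all: by end_near. Qed.

(** Each factor is [1 + b j] with [b j] of order [1 / k_n], so the product is [1 + sum b] up to
    order [1 / k_n^2]. Uniformity in [t] is what later allows integration over the unitary group. *)
Lemma prod_char_fun_asymptotics (d : nat) (T e : R) : 0 < e ->
  \forall n \near \oo, forall t : 'I_d -> R, (forall j, `|t j| <= T) ->
    cmod ((k n)%:R * (\prod_j char_fun (mu_ n) (t j) - 1) - \sum_j psi (t j)) <= e.
Proof.
move=> e0; have [B B0 psiB] := levy_exponent_bounded T.
have d0 : 0 < d.+1%:R :> R by [].
pose e' := Num.min 1 (e / 2 / d.+1%:R).
have e'0 : 0 < e' by rewrite lt_min ltr01 !divr_gt0.
have e'1 : e' <= 1 by rewrite ge_min lexx.
have e'd : d%:R * e' <= e / 2.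
  apply: (@le_trans _ _ (d.+1%:R * e')); first by rewrite ler_pM2r// ler_nat.
  by rewrite mulrC -ler_pdivlMr// ge_min lexx orbT.
(* [k_n |b j| <= |psi| + e' <= B + 1], hence [D / k_n] bounds the sum of the [|b j|]. *)
pose D := d%:R * (B + 1).
have D0 : 0 <= D by rewrite mulr_ge0//; lra.
have near_k1 := near_natr_ge 1 k_oo.
have near_k2 := near_natr_ge (2 * D) k_oo.
have near_k3 := near_natr_ge (2 * D ^+ 2 / (e / 2)) k_oo.
have near_G := char_fun_asymptotics T e'0.
near=> n => t tT.
have k1 : 1 <= (k n)%:R :> R by near: n; exact: near_k1.
have k2 : 2 * D <= (k n)%:R by near: n; exact: near_k2.
have k3 : 2 * D ^+ 2 / (e / 2) <= (k n)%:R by near: n; exact: near_k3.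
have G s : `|s| <= T -> cmod ((k n)%:R * (char_fun (mu_ n) s - 1) - psi s) <= e'.
  by move: s; near: n; exact: near_G.
have kR : 0 < (k n)%:R :> R by lra.
pose b j := char_fun (mu_ n) (t j) - 1.
have bB j : cmod (b j) <= (B + 1) / (k n)%:R.
  rewrite ler_pdivlMr// mulrC -[X in X * _]cmod_nat -cmod_mul.
  rewrite -[_ * b j](subrK (psi (t j))); apply: le_trans (cmod_leD _ _) _.
  by have := G _ (tT j); have := psiB _ (tT j); rewrite /b; lra.
have sz : (size (index_enum 'I_d))%:R * ((B + 1) / (k n)%:R) = D / (k n)%:R.
  have -> : size (index_enum 'I_d) = d.
    by rewrite -sum1_size -[RHS]card_ord -sum1_card; exact: eq_bigl.
  by rewrite mulrA.
have small : D / (k n)%:R <= 1 / 2 by rewrite ler_pdivrMr//; lra.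
have h := @prod_sub1_sum_le _ _ (index_enum 'I_d) b _ bB.
rewrite sz in h; have {}h := h small.
have -> : \prod_j char_fun (mu_ n) (t j) = \prod_j (1 + b j).
  by apply: eq_bigr => j _; rewrite /b addrCA subrr addr0.
have -> : (k n)%:R * (\prod_j (1 + b j) - 1) - \sum_j psi (t j) =
    (k n)%:R * (\prod_j (1 + b j) - 1 - \sum_j b j) +
    \sum_j ((k n)%:R * b j - psi (t j)).
  by rewrite [X in _ = _ + X]sumrB -mulr_sumr; ring.
apply: le_trans (cmod_leD _ _) _.
have h1 : cmod ((k n)%:R * (\prod_j (1 + b j) - 1 - \sum_j b j)) <= e / 2.
  rewrite cmod_mul cmod_nat.
  apply: (@le_trans _ _ ((k n)%:R * (2 * (D / (k n)%:R) ^+ 2))).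
    by rewrite ler_pM2l.
  have -> : (k n)%:R * (2 * (D / (k n)%:R) ^+ 2) = 2 * D ^+ 2 / (k n)%:R.
    by field; rewrite gt_eqF.
  by rewrite ler_pdivrMr// [leRHS]mulrC -ler_pdivrMr//; lra.
have h2 : cmod (\sum_j ((k n)%:R * b j - psi (t j))) <= e / 2.
  apply: le_trans (cmod_sum_le _ _) _; apply: le_trans e'd.
  rewrite mulr_natl -[in leRHS](card_ord d) -sumr_const; apply: ler_sum => j _.
  exact: G.
by lra.
Unshelve. all: by end_near. Qed.

End levy_exponent_asymptotics.

(** * Columns of Haar unitary matrices *)

Section measurable_matrix.
Local Open Scope sesquilinear_scope.
Context {R : realType} e (X : measurableType e).

Definition measurable_entries m n (f : X -> 'M[R[i]]_(m, n)) :=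
  forall i j, measurable_complex (fun x => f x i j).

Lemma measurable_entries_fun m n (f : X -> 'M[R[i]]_(m, n)) :
  measurable_entries f -> measurable_fun setT f.
Proof.
by move=> mf; apply: measurable_fun_matrix => i j; have [] := mf i j.
Qed.

Lemma measurable_entries_comp m n (f : X -> 'M[R[i]]_(m, n)) :
  measurable_fun setT f -> measurable_entries f.
Proof.
move=> mf i j; have h := measurable_complex_comp (measurable_coord i j) mf.
exact: h.
Qed.

Lemma measurable_entries_mulmx m n p (f : X -> 'M[R[i]]_(m, n))
    (g : X -> 'M[R[i]]_(n, p)) : measurable_entries f -> measurable_entries g ->
  measurable_entries (fun x => f x *m g x).
Proof.
move=> mf mg i j; under eq_fun do rewrite mxE.
by apply: measurable_complex_sum => k; exact: measurable_complexM.
Qed.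

Lemma measurable_entries_cst m n (A : 'M[R[i]]_(m, n)) :
  measurable_entries (fun=> A).
Proof. by move=> i j; split. Qed.

Lemma measurable_entries_adjoint m n (f : X -> 'M[R[i]]_(m, n)) :
  measurable_entries f -> measurable_entries (fun x => (f x)^t*).
Proof.
move=> mf i j; under eq_fun do rewrite !mxE.
exact: measurable_complexC.
Qed.

Lemma measurable_entries_eq m n (f : X -> 'M[R[i]]_(m, n)) (A : 'M[R[i]]_(m, n)) :
  measurable_entries f -> measurable [set x | f x = A].
Proof.
move=> mf; rewrite (_ : mkset _ = \bigcap_(i in [set: 'I_m]) \bigcap_(j in [set: 'I_n])
    ([set x | complex.Re (f x i j) = complex.Re (A i j)] `&`
     [set x | complex.Im (f x i j) = complex.Im (A i j)])); last first.
  apply/seteqP; split=> x /= h; first by move=> i _ j _; rewrite /= h.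
  by apply/matrixP => i j; have [] := h i I j I; exact: eq_ReIm.
apply: fin_bigcap_measurable => // i _; apply: fin_bigcap_measurable => // j _.
have mE (g : X -> R) a : measurable_fun setT g -> measurable [set x | g x = a].
  move=> mg; rewrite (_ : mkset _ = setT `&` g @^-1` [set a]); first exact: mg.
  by rewrite setTI.
by apply: measurableI; apply: mE; have [] := mf i j.
Qed.

End measurable_matrix.

Lemma ae_of_probability1 {R : realType} e (X : measurableType e)
    (P : probability X R) (S : set X) : measurable S -> P S = 1%E ->
  {ae P, forall x, S x}.
Proof.
move=> mS PS; exists (~` S); split; first exact: measurableC.
  by rewrite probability_setC// PS subee.
by [].
Qed.

Section haar.
Local Open Scope sesquilinear_scope.
Context {R : realType} (d : nat).
Hypothesis d_gt0 : (0 < d)%N.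
Variables (haar : probability 'M[R[i]]_d R) (sphere : probability 'cV[R[i]]_d R).
Hypothesis haarP : is_haar_unitary haar.
Hypothesis sphereP : is_uniform_on_sphere sphere.

Lemma hdot_mulmx_unitary (V : 'M[R[i]]_d) u w : V \is unitarymx ->
  hdot (V *m u) (V *m w) = hdot u w.
Proof.
move=> /unitarymxP/mulmx1C VV.
by rewrite /hdot trmx_mul map_mxM -mulmxA (mulmxA _ V) VV mul1mx.
Qed.

Lemma mulmx_unitary_isometry (V : 'M[R[i]]_d) : V \is unitarymx ->
  is_isometry (mulmx V).
Proof. by move=> VU u w; rewrite -mulmxBr hdot_mulmx_unitary. Qed.

Lemma measurable_unitary : measurable [set U : 'M[R[i]]_d | U \is unitarymx].
Proof.
rewrite (_ : mkset _ = [set U | U *m U^t* = 1%:M]).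
  apply: measurable_entries_eq; apply: measurable_entries_mulmx.
    exact: measurable_entries_comp.
  by apply: measurable_entries_adjoint; exact: measurable_entries_comp.
by apply/seteqP; split=> U /= /unitarymxP.
Qed.

Lemma measurable_sphere : measurable [set u : 'cV[R[i]]_d | hdot u u = 1].
Proof.
rewrite (_ : mkset _ = [set u | u^t* *m u = 1%:M]).
  apply: measurable_entries_eq; apply: measurable_entries_mulmx.
    by apply: measurable_entries_adjoint; exact: measurable_entries_comp.
  exact: measurable_entries_comp.
apply/seteqP; split=> u; rewrite /mkset/hdot => h.
  by apply/matrixP => i j; rewrite !ord1 h mxE.
by rewrite h mxE.
Qed.

Lemma ae_unitary : {ae haar, forall U, U \is unitarymx}.
Proof. exact: ae_of_probability1 measurable_unitary haarP.1. Qed.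

Lemma ae_sphere : {ae sphere, forall u, hdot u u = 1}.
Proof. exact: ae_of_probability1 measurable_sphere sphereP.1. Qed.

Let invariance e (X : measurableType e) (P : probability X R) (phi : X -> X)
    (f : X -> R) : measurable_fun setT phi ->
  (forall A, measurable A -> P (phi @^-1` A) = P A) -> bounded_measurable f ->
  \int[P]_x f (phi x) = \int[P]_x f x.
Proof.
move=> mphi Pphi bf; pose F := mfun_Sub (mem_set mphi : phi \in mfun).
rewrite -(Rintegral_distribution P F bf) /Rintegral; congr fine.
apply: eq_measure_integral => A mA _ /=.
by rewrite -[RHS]Pphi.
Qed.

Lemma haar_invariance (V : 'M[R[i]]_d) (f : 'M[R[i]]_d -> R) : V \is unitarymx ->
  bounded_measurable f -> \int[haar]_U f (V *m U) = \int[haar]_U f U.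
Proof.
move=> VU bf; apply: (invariance (phi := mulmx V)) bf; last exact: haarP.2.
apply: measurable_entries_fun; apply: measurable_entries_mulmx.
  exact: measurable_entries_cst.
exact: measurable_entries_comp.
Qed.

Lemma sphere_invariance (V : 'M[R[i]]_d) (f : 'cV[R[i]]_d -> R) : V \is unitarymx ->
  bounded_measurable f -> \int[sphere]_u f (V *m u) = \int[sphere]_u f u.
Proof.
move=> VU bf; apply: (invariance (phi := mulmx V)) bf; last first.
  move=> A; apply: sphereP.2; first exact: mulmx_unitary_isometry.
  exact: mulmx0.
apply: measurable_entries_fun; apply: measurable_entries_mulmx.
  exact: measurable_entries_cst.
exact: measurable_entries_comp.
Qed.

Let bounded_adjoint_mul p (f : 'M[R[i]]_(d, p) -> R) : bounded_measurable f ->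
  bounded_measurable (fun z : 'M[R[i]]_d * 'M[R[i]]_(d, p) => f (z.1^t* *m z.2)).
Proof.
move=> bf; apply: (bounded_measurable_comp
  (g := fun z : 'M[R[i]]_d * 'M[R[i]]_(d, p) => z.1^t* *m z.2)) bf.
apply: measurable_entries_fun; apply: measurable_entries_mulmx.
  by apply: measurable_entries_adjoint; exact: measurable_entries_comp.
exact: measurable_entries_comp.
Qed.

Let const_ae e (X : measurableType e) (P : probability X R) (f : X -> R) c :
  measurable_fun setT f -> {ae P, forall x, f x = c} -> \int[P]_x f x = c.
Proof.
move=> mf fc; rewrite -[RHS](Rintegral_probability_cst P).
exact: ae_eq_Rintegral.
Qed.

(* Both sides are the integral of [f (U^* W)] for independent [U] and [W]. *)
Lemma haar_adjoint (f : 'M[R[i]]_d -> R) : bounded_measurable f ->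
  \int[haar]_U f (U^t*) = \int[haar]_U f U.
Proof.
move=> bf; have bF := bounded_adjoint_mul bf.
have bfa : bounded_measurable (fun U => f (U^t*)).
  apply: (bounded_measurable_comp (g := fun U : 'M[R[i]]_d => U^t*)) bf.
  by apply/measurable_entries_fun/measurable_entries_adjoint/measurable_entries_comp.
transitivity (\int[(haar \x haar)%E]_z f (z.1^t* *m z.2)).
  rewrite Rintegral_prod21//; apply/esym/const_ae.
    by have [] := bounded_measurable_Rintegral1 haar haar bF.
  apply: filterS ae_unitary => W WU /=.
  rewrite -(@haar_invariance (W^t*) _ _ bfa) ?trmxC_unitary//.
  apply: eq_Rintegral => U _; congr f.
  by rewrite trmx_mul map_mxM map_trmx trmxK -map_mx_comp; congr (_ *m _);
    rewrite map_mx_id// => z /=; rewrite conjCK.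
rewrite Rintegral_prod12//; apply: const_ae.
  by have [] := bounded_measurable_Rintegral2 haar haar bF.
apply: filterS ae_unitary => U UU /=.
have UaU : U^t* \is unitarymx by rewrite trmxC_unitary.
exact: (haar_invariance UaU bf).
Qed.

Let i0 : 'I_d := Ordinal d_gt0.

(** Gram-Schmidt is applied to the matrix all of whose rows are [u^T]; it returns a unitary matrix
    even for dependent rows. Its first row is collinear to [u^T], and the scalar [c] has modulus 1,
    so rescaling keeps unitarity. *)
Lemma exists_unitary_col (u : 'cV[R[i]]_d) : hdot u u = 1 ->
  exists2 V : 'M[R[i]]_d, V \is unitarymx & col i0 V = u.
Proof.
move=> u1; pose A : 'M[R[i]]_d := \matrix_i u^T.
have BU := @schmidt_unitarymx _ d d A (leqnn d).
set B := schmidt A in BU.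
have [c uB] : exists c, u^T = c *: row i0 B.
  apply/sub_rVP; have := row_schmidt_sub A i0; rewrite rowK => /submx_trans; apply.
  apply/sumsmx_subP => k; rewrite leqn0 => /eqP k0.
  by rewrite genmxE (_ : k = i0)//; exact: val_inj.
have rowB : (row i0 B *m (row i0 B)^t*) 0 0 = 1.
  move/unitarymxP/matrixP/(_ i0 i0): BU; rewrite !mxE eqxx => h; apply: etrans h.
  by apply: eq_bigr => j _; rewrite !mxE.
have cc : c * Num.conj c = 1.
  have : (u^T *m (u^T)^t*) 0 0 = 1.
    rewrite -[RHS]u1 /hdot !mxE; apply: eq_bigr => j _; rewrite !mxE.
    by rewrite mulrC.
  rewrite uB linearZ/= map_mxZ -scalemxAl -scalemxAr scalerA mxE rowB mulr1.
  by [].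
exists (c *: B)^T.
  rewrite trmx_unitary; apply/unitarymxP; rewrite linearZ/= map_mxZ.
  by rewrite -scalemxAl -scalemxAr scalerA cc scale1r; apply/unitarymxP.
by apply: trmx_inj; rewrite uB tr_col trmxK linearZ.
Qed.

(** Both sides equal the mean of [f (U^* u)] for independent Haar [U] and uniform [u]: freezing [U]
    uses the invariance of the sphere, freezing [u] that of the Haar law. *)
Lemma haar_col (f : 'cV[R[i]]_d -> R) j : bounded_measurable f ->
  \int[haar]_U f (col j U) = \int[sphere]_u f u.
Proof.
move=> bf; have bF := bounded_adjoint_mul bf.
have bcol k : bounded_measurable (fun U : 'M[R[i]]_d => f (col k U)).
  apply: (bounded_measurable_comp (g := fun U : 'M[R[i]]_d => col k U)) bf.
  apply: measurable_entries_fun => i l; under eq_fun do rewrite mxE.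
  exact: measurable_coord.
(* Write [u] as the first column of a unitary [V]; then [U^* u] is the first column of the adjoint
   of [V^* U], which has the law of [U] by invariance and [haar_adjoint]. *)
have FE u : hdot u u = 1 ->
    \int[haar]_U f (U^t* *m u) = \int[haar]_U f (col i0 U).
  move=> /exists_unitary_col[V VU <-].
  rewrite -(haar_adjoint (bcol i0)).
  have bcola : bounded_measurable (fun U : 'M[R[i]]_d => f (col i0 (U^t*))).
    apply: (bounded_measurable_comp (g := fun U : 'M[R[i]]_d => U^t*)) (bcol i0).
    by apply/measurable_entries_fun/measurable_entries_adjoint/measurable_entries_comp.
  rewrite -(@haar_invariance (V^t*) _ _ bcola) ?trmxC_unitary//.
  apply: eq_Rintegral => U _; congr f; rewrite !colE mulmxA; congr (_ *m _).
  by rewrite trmx_mul map_mxM map_trmx trmxK -map_mx_comp; congr (_ *m _);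
    rewrite map_mx_id// => z /=; rewrite conjCK.
(* Column [j] of the adjoint of [U] is [U^*] applied to the basis vector [e_j], a unit vector, so
   [FE] applies. *)
have -> : \int[haar]_U f (col j U) = \int[haar]_U f (col i0 U).
  rewrite -(haar_adjoint (bcol j)) -(FE (delta_mx j 0)).
    by apply: eq_Rintegral => U _; rewrite colE.
  rewrite /hdot !mxE (bigD1 j)//= big1 ?addr0 => [|k kj]; rewrite !mxE ?eqxx.
    by rewrite conjC1 mulr1.
  by rewrite (negPf kj) mulr0.
transitivity (\int[(haar \x sphere)%E]_z f (z.1^t* *m z.2)).
  rewrite Rintegral_prod21//; apply/esym/const_ae.
    by have [] := bounded_measurable_Rintegral1 haar sphere bF.
  by apply: filterS ae_sphere => u; exact: FE.
rewrite Rintegral_prod12//; apply: const_ae.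
  by have [] := bounded_measurable_Rintegral2 haar sphere bF.
apply: filterS ae_unitary => U UU /=.
have UaU : U^t* \is unitarymx by rewrite trmxC_unitary.
exact: (sphere_invariance UaU bf).
Qed.

End haar.

(** * The limit law *)

(** Keeps the argument of [psi] in a window where [psi] is bounded, so that integrands are bounded
    everywhere and not just almost surely. *)
Definition clampr {R : realType} (T x : R) : R := Num.max (- T) (Num.min T x).

Lemma clampr_le {R : realType} (T x : R) : 0 <= T -> `|clampr T x| <= T.
Proof.
move=> T0; rewrite /clampr ler_norml le_max lexx ge_max ge_min lexx/= andbT; lra.
Qed.

Lemma clampr_id {R : realType} (T x : R) : `|x| <= T -> clampr T x = x.
Proof.
by rewrite ler_norml => /andP[h1 h2]; rewrite /clampr (min_idPr h2) (max_idPr h1).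
Qed.

Lemma measurable_clampr {R : realType} (T : R) : measurable_fun setT (clampr T).
Proof.
by apply: measurable_maxr => //; apply: measurable_minr.
Qed.

Lemma ae_eq_cexpectation {R : realType} e (X : measurableType e)
    (P : probability X R) (f g : X -> R[i]) :
  measurable_complex f -> measurable_complex g ->
  {ae P, forall x, f x = g x} -> cexpectation P f = cexpectation P g.
Proof.
move=> [f1 f2] [g1 g2] fg; rewrite /cexpectation.
by congr (_ +i* _); apply: ae_eq_Rintegral => //; apply: filterS fg => x ->.
Qed.

Lemma complex_continuous_measurable {R : realType} e (X : measurableType e)
    (f : R -> R[i]) (g : X -> R) : complex_continuous f -> measurable_fun setT g ->
  measurable_complex (fun x => f (g x)).
Proof.
move=> [f1 f2] mg; split.
  apply: (measurableT_comp (f := fun t : R => complex.Re (f t)) _ mg).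
  exact: continuous_measurable_fun.
apply: (measurableT_comp (f := fun t : R => complex.Im (f t)) _ mg).
exact: continuous_measurable_fun.
Qed.

Section quadratic_form.
Local Open Scope sesquilinear_scope.
Context {R : realType} (d : nat).
Implicit Types (A : hermmx R d) (u : 'cV[R[i]]_d).

Definition herm_form A u : R := complex.Re (hdot u (A *m u)).

Lemma hdot_herm A u : hdot u (A *m u) = (herm_form A u)%:C.
Proof.
apply: eq_ReIm => //=.
have : Num.conj (hdot u (A *m u)) = hdot u (A *m u).
  have /is_hermitianmxP := hermmxP A; rewrite expr0 scale1r => hA.
  have : ((u^t* *m (A *m u))^t*) = u^t* *m (A *m u).
    rewrite !trmx_mul !map_mxM map_trmx trmxK -map_mx_comp.
    rewrite (_ : map_mx _ u = u); last by rewrite map_mx_id// => z /=; rewrite conjCK.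
    by rewrite -hA -mulmxA.
  by move=> /matrixP/(_ 0 0); rewrite /hdot [LHS]mxE [in LHS]mxE.
by case: (hdot _ _) => a b [] /=; lra.
Qed.

Lemma measurable_herm_form A : measurable_fun setT (herm_form A).
Proof.
have : measurable_entries (fun u : 'cV[R[i]]_d => u^t* *m (A *m u)).
  apply: measurable_entries_mulmx.
    by apply: measurable_entries_adjoint; exact: measurable_entries_comp.
  apply: measurable_entries_mulmx; first exact: measurable_entries_cst.
  exact: measurable_entries_comp.
by move=> /(_ 0 0)[].
Qed.

Definition entries_norm A : R := \sum_i \sum_j cmod (A i j).

Lemma entries_norm_ge0 A : 0 <= entries_norm A.
Proof. by apply: sumr_ge0 => i _; apply: sumr_ge0 => j _; exact: cmod_ge0. Qed.

(** Crude but sufficient: every entry of a unit vector has modulus at most 1. *)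
Lemma herm_form_bound A u : hdot u u = 1 -> `|herm_form A u| <= entries_norm A.
Proof.
move=> u1; apply: le_trans (normr_Re_le _) _.
have ui i : cmod (u i 0) <= 1.
  rewrite -(ler_sqr (cmod_ge0 _))// ?nnegrE// expr1n.
  have /(congr1 (@complex.Re R)) := u1; rewrite /hdot mxE complexRe_sum /= => <-.
  have E j : complex.Re (u^t* 0 j * u j 0) = cmod (u j 0) ^+ 2.
    by rewrite sqr_cmodE !mxE complexReM; case: (u j 0) => a b /=; ring.
  rewrite (bigD1 i)//= E lerDl; apply: sumr_ge0 => j _.
  by rewrite E sqr_ge0.
rewrite /hdot mxE; apply: le_trans (cmod_sum_le _ _) _; apply: ler_sum => i _.
rewrite cmod_mul [(A *m u) i 0]mxE.
have -> : cmod (u^t* 0 i) = cmod (u i 0).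
  by rewrite !mxE !cmodE; case: (u i 0) => a b /=; rewrite sqrrN.
apply: (@le_trans _ _ (1 * cmod (\sum_j A i j * u j 0))).
  by rewrite ler_wpM2r// cmod_ge0.
rewrite mul1r; apply: le_trans (cmod_sum_le _ _) _; apply: ler_sum => j _.
by rewrite cmod_mul ler_piMr// cmod_ge0.
Qed.

Lemma hdot_col_unitary (U : 'M[R[i]]_d) j : U \is unitarymx ->
  hdot (col j U) (col j U) = 1.
Proof.
move=> /unitarymxP/mulmx1C/matrixP/(_ j j); rewrite !mxE eqxx => h.
rewrite /hdot mxE; apply: etrans h.
by apply: eq_bigr => i _; rewrite !mxE.
Qed.

Lemma mxtrace_conj_diag A (z : 'M[R[i]]_d * d.-tuple R) :
  \tr (A *m conj_diag_mx z) =
  (\sum_j herm_form A (col j z.1) * tnth z.2 j)%:C.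
Proof.
rewrite rmorph_sum /conj_diag_mx mulmxA mxtrace_mulC !mulmxA.
rewrite mul_mx_diag /mxtrace; apply: eq_bigr => j _.
rewrite rmorphM/= -hdot_herm mxE; congr (_ * _); last by rewrite mxE.
rewrite /hdot mulmxA !mxE; apply: eq_bigr => i _; rewrite !mxE; congr (_ * _).
by apply: eq_bigr => l _; rewrite !mxE.
Qed.

Lemma herm_form_scale (t : R) v u :
  herm_form (herm_of (fun ij => t * v ij)) u = t * herm_form (herm_of v) u.
Proof.
apply: complexI; rewrite rmorphM /= -!hdot_herm /hdot.
rewrite (_ : hermmx_val (herm_of (fun ij => t * v ij)) = t%:C *: hermmx_val (herm_of v)).
  by rewrite -scalemxAl -scalemxAr mxE.
by apply/matrixP => i j; rewrite !mxE; apply: eq_ReIm;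
  rewrite ?complexReM ?complexImM /=; field.
Qed.

End quadratic_form.

Section unitary_diag_char.
Context {R : realType} (d : nat) (haar : probability 'M[R[i]]_d R).
Variable (mu : probability R R).

Definition herm_char (A M : hermmx R d) : R[i] := cexp ('i%C * \tr (A *m M)).

Lemma herm_charE A M : herm_char A M =
  cexp ('i%C * (herm_pair ((@herm_coord R d)^~ A) ((@herm_coord R d)^~ M))%:C).
Proof. by rewrite /herm_char mxtrace_herm. Qed.

Lemma bounded_herm_char A : complex_bounded_measurable (herm_char A).
Proof.
rewrite (_ : herm_char A = fun M => cexp ('i%C * (herm_pair
  ((@herm_coord R d)^~ A) ((@herm_coord R d)^~ M))%:C)); last first.
  by apply/funext => M; exact: herm_charE.
apply: complex_bounded_measurable_cexp_imag; apply: measurable_sum => ij.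
by apply: measurable_funM => //; exact: measurable_herm_coord.
Qed.

Lemma herm_char_convolution_power (Q : probability (hermmx R d) R) A n :
  cexpectation (convolution_power (@hermmx_add R d) 0 Q n) (herm_char A) =
  cexpectation Q (herm_char A) ^+ n.
Proof.
apply: cexpectation_convolution_power; first exact: bounded_herm_char.
  by move=> M N; rewrite /herm_char /= mulmxDr mxtraceD mulrDr cexpD.
by rewrite /herm_char /= mulmx0 mxtrace0 mulr0 cexp0.
Qed.

Lemma cexpectation_unitary_diag_law A :
  cexpectation (unitary_diag_law haar mu) (herm_char A) =
  cexpectation haar (fun U => \prod_j char_fun mu (herm_form A (col j U))).
Proof.
have bA := bounded_herm_char A.
rewrite cexpectation_distribution// cexpectation_prod12; last first.
  apply: (complex_bounded_measurable_comp _ bA); exact: measurable_funPT.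
congr cexpectation; apply/funext => U.
rewrite -(@cexpectation_iid _ _ _ mu d (fun j (x : R) =>
  cexp ('i%C * (herm_form A (col j U) * x)%:C))); last first.
  by move=> j; apply: complex_bounded_measurable_cexp_imag; exact: measurable_funM.
congr cexpectation; apply/funext => x.
by rewrite /= /herm_char /= mxtrace_conj_diag rmorph_sum mulr_sumr cexp_sum.
Qed.

End unitary_diag_char.

Section limit_law.
Context {R : realType}.
Variables (mu : probability R R) (mu_ : nat -> probability R R) (k : nat -> nat).
Variable psi : R -> R[i].
Hypothesis psi_mu : is_levy_exponent mu psi.
Hypothesis k_oo : k n @[n --> \oo] --> \oo.
Hypothesis mu_cvg : weakly_converges
  (fun n => convolution_power (@real_add R) 0 (mu_ n) (k n)) mu.
Variable d : nat.
Hypothesis d_gt0 : (0 < d)%N.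
Variables (haar : probability 'M[R[i]]_d R) (sphere : probability 'cV[R[i]]_d R).
Hypothesis haarP : is_haar_unitary haar.
Hypothesis sphereP : is_uniform_on_sphere sphere.

Let c_psi : complex_continuous psi.
Proof. by case: psi_mu => /continuous_complex_continuous. Qed.

Let measurable_col (A : hermmx R d) j :
  measurable_fun setT (fun U : 'M[R[i]]_d => herm_form A (col j U)).
Proof.
apply: (measurableT_comp (measurable_herm_form A)).
apply: measurable_entries_fun => i l; under eq_fun do rewrite mxE.
exact: measurable_coord.
Qed.

(* Only the values on the unit sphere matter, where the form is bounded by [T]. *)
Let sphere_exponent_clamp (A : hermmx R d) T :
  (forall u, hdot u u = 1 -> `|herm_form A u| <= T) ->
  cexpectation sphere (fun u => d%:R * psi (herm_form A u)) =
  cexpectation sphere (fun u => d%:R * psi (clampr T (herm_form A u))).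
Proof.
move=> AT; apply: ae_eq_cexpectation.
- apply: measurable_complexM; first by split.
  exact: (complex_continuous_measurable c_psi (measurable_herm_form A)).
- apply: measurable_complexM; first by split.
  apply: (complex_continuous_measurable c_psi).
  exact: (measurableT_comp (@measurable_clampr R T) (measurable_herm_form A)).
- by apply: filterS (ae_sphere sphereP) => u /AT /clampr_id ->.
Qed.

Let bounded_psi_clamp e (X : measurableType e) T (g : X -> R) : 0 <= T ->
  measurable_fun setT g ->
  complex_bounded_measurable (fun x => psi (clampr T (g x))).
Proof.
move=> T0 mg; have [B _ psiB] := levy_exponent_bounded psi_mu T.
apply: (@complex_bounded_measurableP _ _ _ _ B).
  apply: (complex_continuous_measurable c_psi).
  exact: (measurableT_comp (@measurable_clampr R T) mg).
by move=> x; apply: psiB; exact: clampr_le.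
Qed.

Let limit_exponent (A : hermmx R d) : R[i] :=
  cexpectation sphere (fun u => d%:R * psi (herm_form A u)).

Let haar_cexpectation_col (f : 'cV[R[i]]_d -> R[i]) j :
  complex_bounded_measurable f ->
  cexpectation haar (fun U => f (col j U)) = cexpectation sphere f.
Proof.
move=> [bf1 bf2]; rewrite /cexpectation; congr (_ +i* _).
  exact: (haar_col d_gt0 haarP sphereP j bf1).
exact: (haar_col d_gt0 haarP sphereP j bf2).
Qed.

Let limit_exponentE (A : hermmx R d) : limit_exponent A =
  cexpectation haar (fun U =>
    \sum_j psi (clampr (entries_norm A) (herm_form A (col j U)))).
Proof.
have bpsi := bounded_psi_clamp (entries_norm_ge0 A) (measurable_herm_form A).
rewrite /limit_exponent (@sphere_exponent_clamp A (entries_norm A)); last first.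
  by move=> u; exact: herm_form_bound.
rewrite cexpectationZl// cexpectation_sum => [|j]; last first.
  by apply: bounded_psi_clamp; [exact: entries_norm_ge0|exact: measurable_col].
under eq_bigr do rewrite (haar_cexpectation_col _ bpsi).
by rewrite sumr_const card_ord mulr_natl.
Qed.

Let law n := unitary_diag_law haar (mu_ n).

(** The estimate of [prod_char_fun_asymptotics] holds uniformly over the clamped forms of the
    columns, so it survives expectation over the Haar law. *)
Let law_cvg (A : hermmx R d) :
  ctends (fun n => (k n)%:R * (cexpectation (law n) (herm_char A) - 1))
    (limit_exponent A).
Proof.
move=> e e0; set T := entries_norm A; have T0 : 0 <= T := entries_norm_ge0 A.
have := prod_char_fun_asymptotics psi_mu k_oo mu_cvg d T e0.
apply: filterS => n hn.
have bchar j : complex_bounded_measurable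
    (fun U : 'M[R[i]]_d => char_fun (mu_ n) (clampr T (herm_form A (col j U)))).
  apply: (@complex_bounded_measurableP _ _ _ _ 1).
    apply: (complex_continuous_measurable (complex_continuous_char_fun (mu_ n))).
    exact: (measurableT_comp (@measurable_clampr R T) (measurable_col _ _)).
  by move=> U; exact: cmod_char_fun_le1.
have bprod := complex_bounded_measurable_prod (index_enum 'I_d) bchar.
have bsum : complex_bounded_measurable (fun U : 'M[R[i]]_d =>
    \sum_j psi (clampr T (herm_form A (col j U)))).
  apply: complex_bounded_measurable_sum => j.
  by apply: bounded_psi_clamp => //; exact: measurable_col.
have -> : cexpectation (law n) (herm_char A) = cexpectation haar
    (fun U => \prod_j char_fun (mu_ n) (clampr T (herm_form A (col j U)))).
  rewrite cexpectation_unitary_diag_law; apply: ae_eq_cexpectation.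
  - have := complex_bounded_measurable_prod (index_enum 'I_d) (fun j =>
      @complex_bounded_measurableP _ _ _ (fun U : 'M[R[i]]_d =>
        char_fun (mu_ n) (herm_form A (col j U))) 1
      (complex_continuous_measurable (complex_continuous_char_fun (mu_ n))
        (measurable_col A j)) (fun U => cmod_char_fun_le1 _ _)).
    by move=> [[h1 _] [h2 _]]; split.
  - by move: bprod => [[h1 _] [h2 _]]; split.
  - apply: filterS (ae_unitary haarP) => U UU; apply: eq_bigr => j _.
    by rewrite clampr_id//; exact/herm_form_bound/hdot_col_unitary.
rewrite limit_exponentE.
have bc (c : R[i]) := complex_bounded_measurable_cst 'M[R[i]]_d c.
(* The difference is gathered into a single expectation, so that the pointwise bound [hn] applies
   under the integral. *)
have -> : (k n)%:R * (cexpectation haar (fun U => \prod_j char_fun (mu_ n)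
      (clampr T (herm_form A (col j U)))) - 1) - cexpectation haar (fun U =>
    \sum_j psi (clampr T (herm_form A (col j U)))) =
  cexpectation haar (fun U => (k n)%:R * (\prod_j char_fun (mu_ n)
      (clampr T (herm_form A (col j U))) + -1) + -1 *
    \sum_j psi (clampr T (herm_form A (col j U)))).
  rewrite cexpectationD; last 2 first.
  - by apply: complex_bounded_measurableM => //; exact: complex_bounded_measurableD.
  - exact: complex_bounded_measurableM.
  rewrite !cexpectationZl//; last exact: complex_bounded_measurableD.
  by rewrite cexpectationD// cexpectation_cst mulN1r.
apply: cmod_cexpectation_le.
  apply: complex_bounded_measurableD; apply: complex_bounded_measurableM => //.
  exact: complex_bounded_measurableD.
by move=> U; rewrite mulN1r; apply: hn => j; exact: clampr_le.
Qed.

(** For a small matrix the forms [<u, Au>] stay near 0 on the whole sphere, where [psi] is small by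
    continuity and [psi 0 = 0]. *)
Let limit_exponent_small (v : 'I_d * 'I_d -> R) e : 0 < e ->
  exists2 delta, 0 < delta & forall t, `|t| <= delta ->
    1 - complex.Re (cexp (limit_exponent (herm_of (fun ij => t * v ij)))) <= e.
Proof.
move=> e0; have d0 : 0 < d%:R :> R by rewrite ltr0n.
(* [|z| <= 1/4] gives [8 |z|^2 <= 2 |z|], hence [|Re (exp z - 1)| <= 3 |z| <= e]. The 1 added to the
   norm keeps the divisor [T] positive. *)
pose e' := Num.min (1 / 4) (e / 3); pose T := entries_norm (herm_of v) + 1.
have T1 : 1 <= T by rewrite /T; have := entries_norm_ge0 (herm_of v); lra.
have e'0 : 0 < e' by rewrite lt_min; apply/andP; split; lra.
have [delta delta0 psid] : exists2 delta, 0 < delta &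
    forall s, `|s| <= delta -> cmod (psi s) <= e' / d%:R.
  have := complex_continuous_cmod c_psi (x := 0); case: psi_mu => _ psi0 _.
  rewrite /continuous_at psi0 cmod0 => /cvgrPdist_le/(_ (e' / d%:R)).
  rewrite divr_gt0// => /(_ isT) [delta /= delta0 h]; exists (delta / 2); first lra.
  move=> s sd; have := h s; rewrite /ball_/= !sub0r !normrN.
  by rewrite (ger0_norm (cmod_ge0 _)); apply; lra.
exists (delta / T); first by rewrite divr_gt0//; lra.
move=> t td; set A := herm_of _.
have tT u : hdot u u = 1 -> `|herm_form A u| <= delta.
  move=> u1; rewrite herm_form_scale normrM.
  apply: (@le_trans _ _ (delta / T * T)); last by rewrite divfK//; lra.
  apply: ler_pM => //; have := herm_form_bound (herm_of v) u1; rewrite /T; lra.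
have z_le : cmod (limit_exponent A) <= e'.
  rewrite /limit_exponent (sphere_exponent_clamp tT).
  apply: cmod_cexpectation_le.
    apply: complex_bounded_measurableM; first exact: complex_bounded_measurable_cst.
    by apply: bounded_psi_clamp; [exact: ltW|exact: measurable_herm_form].
  move=> u; rewrite cmod_mul cmod_nat mulrC -ler_pdivlMr//.
  by apply: psid; apply: clampr_le; exact: ltW.
move: (limit_exponent A) z_le => z z_le.
have z0 := cmod_ge0 z.
have [h1 h2] : e' <= 1 / 4 /\ e' <= e / 3 by split; rewrite ge_min lexx ?orbT.
have := cexp_sub1_le (le_trans z_le h1).
have := normr_Re_le (cexp z - 1 - z); have := normr_Re_le z.
rewrite !(complexReD, complexReN) /= => h3 h4 h5.
have h6 : 8 * cmod z ^+ 2 <= 2 * cmod z by nra.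
by move: h3 h4; rewrite !ler_norml; lra.
Qed.

(** Lévy's theorem is phrased with coordinate vectors [v]; [herm_of] and [herm_of_coord] translate
    between these and Hermitian matrices [A]. *)
Lemma limit_law_exists : exists P : probability (hermmx R d) R,
  weakly_converges
    (fun n => convolution_power (@hermmx_add R d) 0 (law n) (k n)) P /\
  forall A : hermmx R d,
    cexpectation P (herm_char A) = cexp (limit_exponent A).
Proof.
have herm_char_of v (M : hermmx R d) : cexp ('i%C * (herm_pair v
    ((@herm_coord R d)^~ M))%:C) = herm_char (herm_of v) M.
  have coordK : (@herm_coord R d)^~ (herm_of v) = v.
    by apply/funext => ij; rewrite herm_coord_of.
  by rewrite [RHS]herm_charE coordK.
have [v||P [P_cvg P_char]] := @levy_continuity R d
  (fun n => convolution_power (@hermmx_add R d) 0 (law n) (k n))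
  (fun v => cexp (limit_exponent (herm_of v))).
- rewrite (_ : (fun n => _) = (fun n =>
      cexpectation (law n) (herm_char (herm_of v)) ^+ k n)).
    apply: ctends_exprn => // n; apply: cmod_cexpectation_le.
      exact: bounded_herm_char.
    by move=> M; rewrite herm_charE cmod_cexp_imag.
  apply/funext => n; rewrite -herm_char_convolution_power.
  by congr cexpectation; apply/funext => M; exact: herm_char_of.
- by move=> v e; exact: limit_exponent_small.
exists P; split=> // A; rewrite -{2}(herm_of_coord A) -P_char.
by congr cexpectation; apply/funext => M; exact: herm_charE.
Qed.

End limit_law.

Theorem theorem3p1 (R : realType) (mu : probability R R)
    (mu_ : nat -> probability R R) (k : nat -> nat) (psi : R -> R[i])
    (mu_id : infinitely_divisible mu)
    (psi_mu : is_levy_exponent mu psi)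
    (k_oo : k n @[n --> \oo] --> \oo)
    (mu_cvg : weakly_converges
      (fun n => convolution_power (@real_add R) 0 (mu_ n) (k n)) mu)
    (d : nat) (d_gt0 : (0 < d)%N)
    (haar : probability 'M[R[i]]_d R) (haarP : is_haar_unitary haar)
    (sphere : probability 'cV[R[i]]_d R)
    (sphereP : is_uniform_on_sphere sphere) :
  exists P : probability (hermmx R d) R,
    weakly_converges
      (fun n => convolution_power (@hermmx_add R d) 0
                  (unitary_diag_law haar (mu_ n)) (k n)) P /\
    forall A : hermmx R d,
      cexpectation P (fun M : hermmx R d => cexp ('i%C * \tr (A *m M))) =
      cexp (cexpectation sphere
        (fun u => d%:R * psi (complex.Re (hdot u (A *m u))))).
Proof. exact: (limit_law_exists psi_mu k_oo mu_cvg d_gt0 haarP sphereP). Qed.
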